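(* Let $\{S_k; k\ge 1\}$ be a sequence of positive random variables. Suppose there exist, on the same probability space, a standard Wiener process $\{W(t); t\ge 0\}$ and two positive constants $\mu$ and $\sigma$ such that $$S_n-n\mu-\sigma W(n)=o\big(\sqrt{n\log\log n}\big)\quad\text{a.s.}$$ Let $\gamma=\mu/\sigma$ and let $$\mathcal F=\left\{f(t)=\int_0^t f'(u)\,du:\ f(0)=0,\ \int_0^1 (f'(u))^2\,du\le 1\right\}$$ be the set of continuous functions on $[0,1]$ which are absolutely continuous (with respect to Lebesgue measure) with derivative in the unit ball of $L_2[0,1]$. Then with probability one the sequence of functions $$\left\{\Big(\prod_{k=1}^{[nt]}\frac{S_k}{k\mu}\Big)^{\gamma/\sqrt{2n\log\log n}};\ 0\le t\le 1\right\}_{n=3}^{\infty}$$ is relatively compact, and its set of limit points is $$\left\{ x\mapsto \exp\Big\{\int_0^x\frac{f(u)}{u}\,du\Big\},\ 0\le x\le 1:\ f\in\mathcal F\right\}.$$ In particular, $$\limsup_{n\to\infty}\left(\prod_{k=1}^n\frac{S_k}{k\mu}\right)^{\gamma/\sqrt{2n\log\log n}}=e^{\sqrt2}\quad\text{a.s.}$$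
   Context: $[x]$ denotes the integer part of $x$; an empty product equals $1$. Relative compactness and limit points refer to functions on $[0,1]$ with the topology of uniform convergence (supremum norm), as in Strassen's functional law of the iterated logarithm. *)

(* Defs.v *)
From HB Require Import structures.
From mathcomp Require Import all_boot all_order all_algebra.
From mathcomp Require Import all_classical all_reals all_analysis.
Set Implicit Arguments. Unset Strict Implicit. Unset Printing Implicit Defensive.
Import Order.TTheory GRing.Theory Num.Theory.
Import numFieldNormedType.Exports.
Local Open Scope classical_set_scope.
Local Open Scope ring_scope.

Section Defs.
Context {R : realType} {d : measure_display} {T : measurableType d}.
Variable P : probability T R.

Definition indep_family (n : nat) (X : nat -> T -> R) : Prop :=
  forall B : nat -> set R, (forall i, measurable (B i)) ->
    P (\bigcap_(i in `I_n) (X i @^-1` B i)) = (\prod_(i < n) P (X i @^-1` B i))%E.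

Definition std_wiener (W : R -> T -> R) : Prop :=
  (forall t, measurable_fun setT (W t)) /\
  {ae P, forall w, W 0 w = 0} /\
  {ae P, forall w, {within `[0, +oo[, continuous (fun t => W t w)}} /\
  (forall t : nat -> R, 0 <= t 0%N -> (forall i, t i < t i.+1) ->
     (forall n, indep_family n (fun i w => W (t i.+1) w - W (t i) w)) /\
     (forall i (B : set R), measurable B ->
        P ((fun w => W (t i.+1) w - W (t i) w) @^-1` B)
        = normal_prob 0 (Num.sqrt (t i.+1 - t i)) B)).

End Defs.

Section Fun.
Context {R : realType}.

Definition strassen_class : set (R -> R) :=
  [set f : R -> R | f 0 = 0 /\ exists f' : R -> R,
     measurable_fun `[(0:R), 1] f' /\
     lebesgue_measure.-integrable `[(0:R), 1] (EFin \o f') /\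
     (\int[lebesgue_measure]_(u in `[0%R, 1%R]) ((f' u) ^+ 2)%:E <= 1)%E /\
     (forall t, 0 <= t <= 1 -> f t = Rintegral lebesgue_measure `[(0:R), t] f')].

Definition exp_int_ratio (f : R -> R) (x : R) : R :=
  expR (Rintegral lebesgue_measure `[(0:R), x] (fun u => f u / u)).

Definition unif_cvg01 (g : nat -> R -> R) (h : R -> R) : Prop :=
  forall e : R, 0 < e ->
    \forall n \near \oo, forall t, 0 <= t <= 1 -> `|g n t - h t| <= e.

Definition subseq_index (phi : nat -> nat) : Prop :=
  forall n, (phi n < phi n.+1)%N.

Definition rel_compact01 (g : nat -> R -> R) : Prop :=
  forall phi, subseq_index phi -> exists psi, subseq_index psi /\
    exists h : R -> R, unif_cvg01 (fun n => g (phi (psi n))) h.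

Definition limit_point01 (g : nat -> R -> R) (h : R -> R) : Prop :=
  exists phi, subseq_index phi /\ unif_cvg01 (fun n => g (phi n)) h.

Definition prod_path (S : nat -> R) (mu gam : R) (n : nat) (t : R) : R :=
  (\prod_(1 <= k < (Num.truncn (n%:R * t)).+1) (S k / (k%:R * mu)))
    `^ (gam / Num.sqrt (2 * n%:R * ln (ln n%:R))).

End Fun.

(* Main.v *)
Require Import Defs.
From HB Require Import structures.
From mathcomp Require Import all_boot all_order all_algebra.
From mathcomp Require Import all_classical all_reals all_analysis.
From mathcomp Require Import measurable_realfun ring lra zify.
Set Implicit Arguments. Unset Strict Implicit. Unset Printing Implicit Defensive.
Import Order.TTheory GRing.Theory Num.Theory.
Import numFieldNormedType.Exports.
Local Open Scope classical_set_scope.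
Local Open Scope ring_scope.

(* Put r_k = S_k/(k mu) - 1. Since ln (1 + r) = r + O(r^2) and gamma k r_k = W(k) + o(sqrt (k lnln k)),
   the logarithm of the n-th path at t is (1/a_n) sum_{k <= nt} W(k)/k + o(1), a_n = sqrt (2 n lnln n).
   The paths f_n(t) = W([nt])/a_n obey Strassen's law, and f |-> int_0^x f(u)/u du is continuous along
   them: f_n(u)/u is dominated by a multiple of u^(-1/2). So limit points are carried to limit points.

   Strassen's law is obtained from increments of W at integer times only. Gaussian tails and
   Borel-Cantelli over dyadic blocks give equicontinuity of the f_n (chaining) and, for each m,
   m sum_i (f((i+1)/m) - f(i/m))^2 <= 1 for every limit f; by Riesz' criterion (the dyadic difference
   quotients are an L^2-bounded martingale) f lies in the Strassen class. Conversely the increments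
   of W over the blocks [i b^j, (i+1) b^j], 1 <= i < b, are independent for different j, and the second
   Borel-Cantelli lemma makes them hit any prescribed increments of energy < 1 infinitely often.

   The constant: int_0^1 f(u)/u du = - int_0^1 f'(u) ln u du <= (int_0^1 ln^2)^(1/2) = sqrt 2, with
   equality for f' = - ln / sqrt 2. *)

(** Probability enters only through three properties of the single sequence [V k = W k], namely
    [dyadic_osc], [energy_bound] and [approx_targets]. Each consists of countably many conditions,
    so they hold together almost surely, and all limits are then taken path by path. The obstacle on
    the way to products is that division by [u] is not continuous near 0 for the supremum norm. The
    remedy is a bound [|V k| <= C sqrt (k / n) a_n] for all [0 < k <= n] at once. Any [C] will do
    there, so crude chaining constants suffice. The sharp constant comes from the energy alone: a
    box of increments of energy [k] has probability about [(ln n)^(-k)], that is [p^(-k)] at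
    [n = 2^p], summable exactly for [k > 1]. In the converse direction the independent blocks leave
    the interval [[0, 1/b]] uncontrolled; for large [b] both the path and the limit are small
    there. *)

Lemma big_nat_blocks (S : Type) (idx : S) (op : Monoid.law idx) (K N : nat) (g : nat -> S) :
  \big[op/idx]_(l < N * K) g l = \big[op/idx]_(j < N) \big[op/idx]_(i < K) g (j * K + i)%N.
Proof.
elim: N => [|N IH]; first by rewrite mul0n !big_ord0.
rewrite big_ord_recr/= -IH mulSnr.
rewrite -[LHS](big_mkord xpredT g) (big_cat_nat (n := (N * K)%N))//= ?leq_addr// big_mkord.
congr (op _ _); rewrite -{1}[(N * K)%N]add0n big_addn addKn big_mkord.
by apply: eq_bigr => i _; rewrite addnC.
Qed.

(** * Gaussian tails and the Borel-Cantelli lemmas *)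

Section gaussian.
Context {R : realType}.
Implicit Types (s x c h m : R).

(** Where [x^2 <= x y], one has [y^2 >= x^2 + (y - x)^2], so the centred density is at most
    [expR (- x^2 / (2 s^2))] times the density with mean [x], of total mass 1. The sign of [x] is
    free, which covers both half-lines of a tail. *)
Lemma normal_prob_tilt s x (D : set R) : 0 < s -> measurable D ->
  (forall y, D y -> x ^+ 2 <= x * y) ->
  (normal_prob 0 s D <= (expR (- (x ^+ 2 / (2 * s ^+ 2))))%:E)%E.
Proof.
move=> s0 mD Dx; rewrite /normal_prob.
have sn0 : s != 0 by rewrite gt_eqF.
apply: (@le_trans _ _ (\int[lebesgue_measure]_(y in D)
   ((expR (- (x ^+ 2 / (2 * s ^+ 2))))%:E * (normal_pdf x s y)%:E))%E).
  apply: ge0_le_integral => //=.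
  - by move=> y _; rewrite lee_fin normal_pdf_ge0.
  - by apply/measurable_EFinP/measurable_funTS; exact: measurable_normal_pdf.
  - apply/measurable_EFinP/measurable_funTS/measurable_funM => //.
    exact: measurable_normal_pdf.
  - move=> y /Dx xy.
    rewrite -EFinM lee_fin !normal_pdfE// mulrCA ler_wpM2l ?normal_peak_ge0//.
    rewrite /normal_fun -expRD ler_expR subr0 -mulr_natl.
    rewrite !mulNr -opprD lerN2 -mulrDl ler_pM2r; last first.
      by rewrite invr_gt0 mulr_gt0// exprn_gt0.
    nra.
rewrite ge0_integralZl//=.
- rewrite -[leRHS]mule1; apply: lee_pmul => //.
  + by apply: integral_ge0 => y _; rewrite lee_fin normal_pdf_ge0.
  + rewrite -(integral_normal_pdf x s); apply: ge0_subset_integral => //.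
      by apply/measurable_EFinP; exact: measurable_normal_pdf.
    by move=> y _; rewrite lee_fin normal_pdf_ge0.
- by apply/measurable_EFinP/measurable_funTS; exact: measurable_normal_pdf.
- by move=> y _; rewrite lee_fin normal_pdf_ge0.
Qed.

Lemma measurable_norm_ge x : measurable [set y : R | x <= `|y|].
Proof.
have -> : [set y : R | x <= `|y|] = (Num.norm : R -> R) @^-1` `[x, +oo[.
  by apply/seteqP; split => y /=; rewrite in_itv/= andbT.
rewrite -[X in measurable X]setTI; exact: normr_measurable.
Qed.

Lemma measurable_norm_sub_le c h : measurable [set y : R | `|y - c| <= h].
Proof.
have -> : [set y : R | `|y - c| <= h] = [set` `[c - h, c + h]].
  by apply/seteqP; split => y /=; rewrite in_itv/= ler_distl.
exact: measurable_itv.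
Qed.

Lemma normal_prob_tail s x : 0 < s -> 0 <= x ->
  (normal_prob 0 s [set y | x <= `|y|]%R
     <= (2 * expR (- (x ^+ 2 / (2 * s ^+ 2))))%:E)%E.
Proof.
move=> s0 x0.
have -> : [set y : R | x <= `|y|] = `[x, +oo[ `|` `]-oo, (- x)].
  apply/seteqP; split => y /=; rewrite !in_itv/= !andbT.
    by rewrite ler_normr => /orP[->|]; [left|rewrite lerNr => ->; right].
  by case=> xy; rewrite ler_normr ?xy// lerNr xy orbT.
apply: le_trans (measureU2 _ _ _) _ => //.
rewrite mulr_natl mulr2n EFinD leeD//.
  by apply: normal_prob_tilt => // y /=; rewrite in_itv/= andbT; nra.
rewrite -(sqrrN x).
by apply: normal_prob_tilt => // y /=; rewrite in_itv/=; nra.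
Qed.

(** On [[c - s, c + s]] the density is at least its value at distance [|c| + s] from 0, and the
    length [2 s] cancels the factor [1 / s] of the peak. *)
Lemma normal_prob_near s c h : 0 < s -> s <= h ->
  ((2 / Num.sqrt (pi *+ 2) * expR (- ((`|c| / s + 1) ^+ 2 / 2)))%:E
     <= normal_prob 0 s [set y | `|y - c| <= h]%R)%E.
Proof.
move=> s0 sh; rewrite /normal_prob.
have sn0 : s != 0 by rewrite gt_eqF.
have mD := measurable_norm_sub_le c h.
apply: (@le_trans _ _ (\int[lebesgue_measure]_(y in `[(c - s)%R, (c + s)%R])
   (normal_pdf 0 s y)%:E)%E); last first.
  apply: ge0_subset_integral => //=.
  - by apply/measurable_EFinP/measurable_funTS; exact: measurable_normal_pdf.
  - by move=> y _; rewrite lee_fin normal_pdf_ge0.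
  - by move=> y/=; rewrite in_itv/= -ler_distl => /le_trans; apply.
apply: (@le_trans _ _ (\int[lebesgue_measure]_(y in `[(c - s)%R, (c + s)%R])
   (normal_peak s * expR (- ((`|c| / s + 1) ^+ 2 / 2)))%:E)%E).
  rewrite integral_cst//= lebesgue_measure_itv/= lte_fin.
  have -> : c - s < c + s by lra.
  rewrite -EFinD -EFinM lee_fin /normal_peak.
  rewrite [leRHS]mulrAC ler_wpM2r ?expR_ge0//.
  rewrite -mulrnAr sqrtrM ?sqr_ge0// sqrtr_sqr gtr0_norm// invfM.
  by set q := (Num.sqrt _)^-1; have -> : s^-1 * q * (c + s - (c - s)) = 2 * q by field.
apply: ge0_le_integral => //=.
- by move=> y _; rewrite lee_fin mulr_ge0 ?expR_ge0 ?normal_peak_ge0.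
- by apply/measurable_EFinP/measurable_funTS; exact: measurable_normal_pdf.
- move=> y; rewrite in_itv/= -ler_distl => ycs.
  rewrite lee_fin normal_pdfE// ler_wpM2l ?normal_peak_ge0//.
  rewrite /normal_fun ler_expR subr0 mulNr lerN2 -mulr_natl.
  have -> : y ^+ 2 / (2 * s ^+ 2) = (`|y| / s) ^+ 2 / 2.
    by rewrite exprMn real_normK ?num_real// exprVn invfM; field.
  rewrite ler_pM2r// lerXn2r ?nnegrE ?addr_ge0 ?divr_ge0 ?(ltW s0)//.
  rewrite ler_pdivrMr// mulrDl mul1r divfK//.
  by rewrite -lerBlDl (le_trans (lerB_dist _ _)).
Qed.

End gaussian.

Section borel_cantelli.
Context {R : realType} {d : measure_display} {T : measurableType d}.
Variable P : probability T R.

Lemma ae_eventually_not (E : nat -> set T) (u : nat -> R) (k0 : nat) (M : R) :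
  (forall k, measurable (E k)) ->
  (forall k, (k0 <= k)%N -> (P (E k) <= (u k)%:E)%E) ->
  (forall n, \sum_(k0 <= k < n) u k <= M) ->
  {ae P, forall w, \forall k \near \oo, ~ E k w}.
Proof.
move=> mE PE uM.
pose F k := if (k0 <= k)%N then E k else set0.
have mF k : measurable (F k) by rewrite /F; case: ifP.
have F0 : (P (lim_sup_set F) = 0)%E.
  apply: lim_sup_set_cvg0 => //; apply: (@le_lt_trans _ _ M%:E); last exact: ltry.
  apply: lime_le; first exact: is_cvg_nneseries.
  apply: nearW => n /=; apply: (@le_trans _ _ (\sum_(k0 <= k < n) u k)%:E); last by rewrite lee_fin.
  rewrite -sumEFin big_mkcond [leRHS]big_mkcond/=.
  have [nk0|k0n] := leqP n k0.
    rewrite [leRHS]big_geq// big_nat big1// => i /andP[_ ni].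
    by rewrite /F leqNgt (leq_trans ni nk0)/= measure0.
  rewrite (big_cat_nat (leq0n k0) (ltnW k0n))/= big_nat big1 ?add0e; last first.
    by move=> i /andP[_ ik]; rewrite /F leqNgt ik/= measure0.
  rewrite big_nat [leRHS]big_nat; apply: lee_sum => i /andP[ki _].
  by rewrite /F ki PE.
exists (lim_sup_set F); split => //.
  apply: bigcap_measurable => // n _; apply: bigcup_measurable => k _; exact: mF.
move=> w /= nw n _; apply: contrapT => nF; apply: nw.
exists (maxn n k0) => // k /= nk Ek; apply: nF.
exists k => /=; first by rewrite (leq_trans _ nk)// leq_maxl.
by rewrite /F (leq_trans (leq_maxr n k0) nk).
Qed.

(* The events are encoded by Boolean flags so that the product rule for
   [A] alone yields, by induction on the number of complemented events,
   the product rule for the complements. *)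
Lemma prob_bigcap_setC (A : nat -> set T) (p : nat -> R) :
  (forall j, measurable (A j)) ->
  (forall (e : nat -> bool) N,
     P (\bigcap_(j in `I_N) (if e j then A j else setT))
     = (\prod_(j < N) (if e j then p j else 1))%:E) ->
  forall N, P (\bigcap_(j in `I_N) ~` A j) = (\prod_(j < N) (1 - p j))%:E.
Proof.
move=> mA PA N.
pose C e := \bigcap_(j in `I_N) (if e j then A j else setT).
pose D n := \bigcap_(j in `I_n) ~` A j.
have mC e : measurable (C e).
  by apply: bigcap_measurableType => j _; case: ifP.
have mD n : measurable (D n).
  by apply: bigcap_measurableType => j _; exact: measurableC.
suff H n : (n <= N)%N -> forall e : nat -> bool, (forall j, (j < n)%N -> e j = false) ->
    P (D n `&` C e) = (\prod_(j < n) (1 - p j) *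
                       \prod_(j < N) (if e j then p j else 1))%:E.
  have := H N (leqnn N) (fun=> false) (fun _ _ => erefl).
  rewrite [X in _ * X]big1// mulr1 => <-; congr (P _).
  by apply/seteqP; split => [w Dw|w []//]; split.
elim: n => [|n IH] nN e en.
  rewrite /D II0 bigcap_set0 setTI big_ord0 mul1r; exact: PA.
pose e' j := (j == n) || e j.
have en' j : (j < n)%N -> e j = false by move=> jn; rewrite en// ltnS ltnW.
(* Excluding [A n] is a difference of two events with only [n] complements; [e'] is [e] with flag
   [n] raised. *)
have -> : D n.+1 `&` C e = (D n `&` C e) `\` (D n `&` C e').
  apply/seteqP; split => w.
    move=> [Dw Cw]; split; first by split => // j /= jn; apply: Dw => /=; rewrite ltnS ltnW.
    move=> [_ /(_ n nN)]; rewrite /e' eqxx/=; exact: (Dw n (leqnn _)).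
  move=> [[Dw Cw] nw]; split => // j /=; rewrite ltnS leq_eqVlt => /predU1P[->|jn]; last exact: Dw.
  move=> Aw; apply: nw; split => // k kN; rewrite /e'; case: eqP => [->//|_ /=]; exact: Cw.
rewrite measureD/=; [|exact: measurableI|exact: measurableI|]; last first.
  by apply: le_lt_trans (probability_le1 _ _) _; [exact: measurableI|exact: ltry].
have -> : D n `&` C e `&` (D n `&` C e') = D n `&` C e'.
  apply/seteqP; split => [w []//|w [Dw Cw]]; split => //; split => // j jN.
  by have := Cw j jN; rewrite /e'; case: (e j) => //; rewrite orbT.
rewrite !IH//; try exact: ltnW; last first.
  by move=> j jn; rewrite /e' en' // orbF ltn_eqF.
rewrite -EFinB; congr EFin; rewrite big_ord_recr/= -mulrA -mulrBr; congr (_ * _).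
rewrite (bigD1 (Ordinal nN))//= [in X in _ - X](bigD1 (Ordinal nN))//=.
rewrite {1}/e' eqxx/= en// !mul1r mulrBl mul1r.
congr (_ - _ * _); apply: eq_bigr => i ni.
by rewrite /e'; have -> : (i == n :> nat) = false by exact: negbTE ni.
Qed.

Lemma prod_1B_le_expR (p : nat -> R) N : (forall j, p j <= 1) ->
  \prod_(j < N) (1 - p j) <= expR (- \sum_(j < N) p j).
Proof.
move=> p1; rewrite -sumrN expR_sum; apply: ler_prod => j _.
by rewrite subr_ge0 p1/= expR_ge1Dx.
Qed.

(** Second Borel-Cantelli lemma in the form that some [A j] occurs; a family whose index starts late
    then yields occurrences beyond any rank. The product of the [1 - p j] is at most
    [expR (- sum p j)], which is arbitrarily small. *)
Lemma prob_bigcap_setC_eq0 (A : nat -> set T) (p : nat -> R) :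
  (forall j, measurable (A j)) ->
  (forall (e : nat -> bool) N,
     P (\bigcap_(j in `I_N) (if e j then A j else setT))
     = (\prod_(j < N) (if e j then p j else 1))%:E) ->
  (forall M, exists N, M <= \sum_(j < N) p j) ->
  P (\bigcap_j ~` A j) = 0%E.
Proof.
move=> mA PA pM.
have mD N : measurable (\bigcap_(j in `I_N) ~` A j).
  by apply: bigcap_measurableType => j _; exact: measurableC.
have mDT : measurable (\bigcap_j ~` A j).
  by apply: bigcap_measurableType => j _; exact: measurableC.
have pA j : P (A j) = (p j)%:E.
  have := PA (fun k => k == j) j.+1; rewrite big_ord_recr/= eqxx big1 ?mul1r; last first.
    by move=> i _; rewrite ltn_eqF.
  move=> <-; congr (P _); apply/seteqP; split => w.
    by move=> Aw k _; case: eqP => // ->.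
  by move=> /(_ j (ltnSn j)); rewrite eqxx.
have p1 j : p j <= 1 by rewrite -lee_fin -pA probability_le1.
apply/eqP; rewrite eq_le measure_ge0 andbT; apply/lee_addgt0Pr => e e0.
rewrite add0e; have [N MN] := pM (- ln e).
apply: (@le_trans _ _ (P (\bigcap_(j in `I_N) ~` A j))).
  by apply: le_measure; rewrite ?inE// => w Dw j _; exact: Dw.
rewrite (prob_bigcap_setC mA PA) lee_fin (le_trans (prod_1B_le_expR _ p1))//.
by rewrite -[leRHS](@lnK _ e) ?posrE// ler_expR lerNl.
Qed.

End borel_cantelli.

(** * Estimates for the scale [sqrt (2 n lnln n)] and for [p]-series *)

Section real_estimates.
Context {R : realType}.
Implicit Types (x y c : R).

Lemma ln2_ge_half : 2^-1 <= ln (2 : R).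
Proof.
have := @le_ln1Dx R (- 2^-1); rewrite (_ : 1 + - 2^-1 = 2^-1 :> R); last by lra.
by rewrite lnV ?posrE// => /(_ ltac:(lra)); lra.
Qed.

Lemma ln_exp2 p : ln ((2 ^ p)%:R : R) = p%:R * ln 2.
Proof. by rewrite natrX lnXn// mulr_natl. Qed.

(** Integral comparison for [x^(-1-c)], powers being written as exponentials of logarithms because
    Gaussian bounds at times [2 ^ p] arrive in that form. It combines
    [ln ((a + 1) / a) >= 1 / (a + 1)] with [expR z >= 1 + z]. *)
Lemma expR_ln_telescope c m : 0 < c ->
  expR (- ((1 + c) * ln (m.+2%:R : R))) <=
    c^-1 * (expR (- (c * ln m.+1%:R)) - expR (- (c * ln m.+2%:R))).
Proof.
move=> c0; rewrite ler_pdivlMl// lerBrDr.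
set x : R := ln m.+1%:R; set y : R := ln m.+2%:R.
have m1 : (0 : R) < m.+1%:R by rewrite ltr0n.
have m2 : (0 : R) < m.+2%:R by rewrite ltr0n.
have xy : m.+2%:R^-1 <= y - x.
  have := @le_ln1Dx R (- m.+2%:R^-1).
  rewrite ltrN2 invf_lt1// ltr1n => /(_ isT).
  have -> : 1 + - m.+2%:R^-1 = m.+1%:R / m.+2%:R :> R.
    have -> : m.+1%:R = m.+2%:R - 1 :> R by rewrite -(natr1 m.+1) addrK.
    by rewrite mulrBl mul1r divff ?gt_eqF.
  rewrite lnM ?posrE ?invr_gt0// lnV ?posrE//. rewrite -/x -/y.
  by move: (_^-1) => z ?; lra.
have -> : expR (- ((1 + c) * y)) = m.+2%:R^-1 * expR (- (c * y)).
  by rewrite mulrDl mul1r opprD expRD (expRN y) /y lnK ?posrE.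
have -> : - (c * x) = c * (y - x) + - (c * y) by ring.
rewrite expRD -{2}[expR (- _)]mul1r mulrA -mulrDl ler_wpM2r ?expR_ge0//.
apply: le_trans (expR_ge1Dx _); rewrite addrC lerD2l ler_wpM2l// ltW//.
Qed.

Lemma sum_expR_ln_le c n : 0 < c ->
  \sum_(1 <= p < n) expR (- ((1 + c) * ln (p%:R : R))) <= 1 + c^-1.
Proof.
move=> c0.
case: n => [|n]; first by rewrite big_geq// addr_ge0// invr_ge0 ltW.
suff /le_trans : \sum_(1 <= p < n.+1) expR (- ((1 + c) * ln (p%:R : R)))
    <= 1 + c^-1 * (1 - expR (- (c * ln n%:R))).
  apply; rewrite lerD2l -[leRHS]mulr1 ler_wpM2l ?invr_ge0 ?(ltW c0)//.
elim: n => [|n IH].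
  by rewrite big_geq// ln0// mulr0 oppr0 expR0 subrr mulr0 addr0.
rewrite big_nat_recr//=.
case: n => [|n] in IH *.
  by rewrite big_geq// ln1 !mulr0 oppr0 expR0 add0r subrr mulr0 addr0.
apply: (le_trans (lerD IH (expR_ln_telescope n c0))).
by rewrite -addrA lerD2l -mulrDr addrA subrK.
Qed.

Lemma sum_expR_ln_tail_le c k n : 0 < c ->
  \sum_(k.+1 <= p < n) expR (- ((1 + c) * ln (p%:R : R))) <= 1 + c^-1.
Proof.
move=> c0; have [nk|kn] := leqP n k.+1.
  by rewrite big_geq// addr_ge0// invr_ge0 ltW.
apply: le_trans (sum_expR_ln_le n c0).
rewrite [leRHS](big_cat_nat (n := k.+1))//= ?(ltnW kn)// lerDr.
by apply: sumr_ge0 => i _; exact: expR_ge0.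
Qed.

Definition lil_scale (n : nat) : R := Num.sqrt (2 * n%:R * ln (ln n%:R)).

Lemma lil_scale_ge0 n : 0 <= lil_scale n.
Proof. exact: sqrtr_ge0. Qed.

Lemma lnln_mono m n : (1 < m)%N -> (m <= n)%N ->
  ln (ln m%:R) <= ln (ln n%:R) :> R.
Proof.
move=> m1 mn; have m0 : (0 < m)%N by exact: ltnW.
have n0 : (0 < n)%N by exact: leq_trans mn.
have lm : 0 < ln m%:R :> R by rewrite ln_gt0// ltr1n.
have lmn : ln m%:R <= ln n%:R :> R by rewrite ler_ln ?posrE ?ltr0n// ler_nat.
by rewrite ler_ln ?posrE// (lt_le_trans lm).
Qed.

Lemma lnln_gt0 n : (4 <= n)%N -> 0 < ln (ln n%:R) :> R.
Proof.
move=> n4; rewrite ln_gt0//.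
(* [expR (- 1/3) >= 2/3] gives [expR (1/3) <= 3/2], and the cube [27/8] is below 4. *)
have e4 : expR 1 < 4%:R :> R.
  have h : 2 / 3 <= expR (- 3^-1) :> R by have := @expR_ge1Dx R (- 3^-1); lra.
  have h2 : expR (3^-1) <= 3 / 2 :> R.
    by rewrite -[leRHS]invrK -[leLHS]invrK lef_pV2 ?posrE ?invr_gt0 ?expR_gt0// -expRN invf_div.
  have -> : (1 : R) = 3%:R * 3^-1 by rewrite divff.
  rewrite expRM_natl; apply: (@le_lt_trans _ _ ((3 / 2) ^+ 3)); last by lra.
  by rewrite lerXn2r ?nnegrE ?expR_ge0.
by rewrite -(@ltr_expR R) lnK ?posrE ?ltr0n ?(leq_trans _ n4)// (lt_le_trans e4)// ler_nat.
Qed.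

Lemma lil_scale_sqr n : (4 <= n)%N -> lil_scale n ^+ 2 = 2 * n%:R * ln (ln n%:R).
Proof. by move=> n4; rewrite sqr_sqrtr// !mulr_ge0// ltW// lnln_gt0. Qed.

Lemma lil_scale_gt0 n : (4 <= n)%N -> 0 < lil_scale n.
Proof.
by move=> n4; rewrite sqrtr_gt0 !mulr_gt0 ?lnln_gt0// ltr0n (leq_trans _ n4).
Qed.

Lemma lil_scale_mono m n : (4 <= m)%N -> (m <= n)%N -> lil_scale m <= lil_scale n.
Proof.
move=> m4 mn; rewrite ler_wsqrtr//.
rewrite ler_pM ?mulr_ge0 ?(ltW (lnln_gt0 m4))//; last by rewrite lnln_mono// (leq_trans _ m4).
by rewrite ler_wpM2l// ler_nat.
Qed.

Lemma lnln_exp2 p : (0 < p)%N -> ln (ln ((2 ^ p)%:R : R)) = ln p%:R + ln (ln 2).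
Proof. by move=> p0; rewrite ln_exp2 lnM ?posrE ?ltr0n// ln_gt0// ltr1n. Qed.

Lemma expR_lnln_exp2 p c : (0 < p)%N ->
  expR (- (c * ln (ln ((2 ^ p)%:R : R)))) =
    expR (- (c * ln (ln 2))) * expR (- (c * ln p%:R)).
Proof. by move=> p0; rewrite lnln_exp2// -expRD mulrDr opprD addrC. Qed.

Lemma sum_geo_half_le p : \sum_(s < p.+1) (2^-1 : R) ^+ (p - s) <= 2.
Proof.
suff -> : \sum_(s < p.+1) (2^-1 : R) ^+ (p - s) = 2 - 2^-1 ^+ p.
  by rewrite lerBlDr lerDl exprn_ge0.
elim: p => [|p IH]; first by rewrite big_ord1 subnn; lra.
rewrite big_ord_recr/= subnn expr0.
under eq_bigr => i _ do rewrite subSn ?exprS -1?ltnS//.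
by rewrite -mulr_sumr IH exprS; lra.
Qed.

(** The left side of the oscillation exponent: [36 = 6^2] and [9/8 = 2 (3/4)^2]. The 16 makes the
    induction close, as [9/8 * 16 = 16 + 2]. *)
Lemma exp_9_8_ge r : 16 + 2 * r%:R <= 36 * (9 / 8) ^+ r :> R.
Proof.
elim: r => [|r IH]; first by rewrite expr0; lra.
rewrite exprS -natr1; have : (0 : R) <= r%:R by []; lra.
Qed.

End real_estimates.

(** * Almost sure properties of Wiener increments at integer times *)

Section wiener.
Context {R : realType} {d : measure_display} {T : measurableType d}.
Variables (P : probability T R) (W : R -> T -> R).
Hypothesis PW : std_wiener P W.

Let mW t : measurable_fun setT (W t). Proof. by case: PW. Qed.

Lemma measurable_increment s t (B : set R) : measurable B ->
  measurable ((fun w => W t w - W s w) @^-1` B).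
Proof.
move=> mB; rewrite -[X in measurable X]setTI.
by apply: (measurable_funB (mW t) (mW s)).
Qed.

Lemma prob_increment s t (B : set R) : 0 <= s -> s < t -> measurable B ->
  P ((fun w => W t w - W s w) @^-1` B) = normal_prob 0 (Num.sqrt (t - s)) B.
Proof.
move=> s0 st mB; have [_ [_ [_ /(_ (fun n => s + n%:R * (t - s)))]]] := PW.
rewrite mul0r addr0 => /(_ s0) [|_ /(_ 0%N B mB)].
  by move=> i; rewrite ltrD2l ltr_pM2r ?subr_gt0// ltr_nat.
by rewrite mul0r mul1r addr0 addrC subrK.
Qed.

Lemma prob_increment_large s t x : 0 <= s -> s < t -> 0 <= x ->
  (P [set w | x <= `|W t w - W s w|]%R
     <= (2 * expR (- (x ^+ 2 / (2 * (t - s)))))%:E)%E.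
Proof.
move=> s0 st x0.
have -> : [set w | x <= `|W t w - W s w|] =
   (fun w => W t w - W s w) @^-1` [set y | x <= `|y|] by [].
rewrite prob_increment//; last exact: measurable_norm_ge.
apply: le_trans (normal_prob_tail _ x0) _; first by rewrite sqrtr_gt0 subr_gt0.
by rewrite sqr_sqrtr// subr_ge0 ltW.
Qed.

Lemma prob_bigcap_increments (t : nat -> R) (B : nat -> set R) n :
  0 <= t 0%N -> (forall i, t i < t i.+1) -> (forall i, measurable (B i)) ->
  P (\bigcap_(i in `I_n) ((fun w => W (t i.+1) w - W (t i) w) @^-1` B i))
  = (\prod_(i < n) P ((fun w => W (t i.+1) w - W (t i) w)%R @^-1` B i))%E.
Proof.
move=> t0 tS mB; have [_ [_ [_ /(_ t t0 tS)[+ _]]]] := PW.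
by move=> /(_ n); apply.
Qed.

End wiener.

(** * Oscillation over dyadic blocks *)

Section dyadic_oscillation.
Context {R : realType}.

(** The rate [3/4] lies between [2^(-1/2)] and 1: above the former, the Gaussian exponent of a block
    of length [2 ^ s] grows geometrically in [p - s] and beats the number of blocks; below 1, the
    chaining sums converge. *)
Definition dyadic_osc (V : nat -> R) : Prop :=
  \forall p \near \oo, forall s i, (s <= p)%N -> (i < 2 ^ (p.+1 - s))%N ->
    `|V (i.+1 * 2 ^ s)%N - V (i * 2 ^ s)%N| <= 6 * (3 / 4) ^+ (p - s) * lil_scale (2 ^ p).

(** With [r = p - s] the exponent is [36 (9/8)^r L >= (2 + 2 r) L]. The part [2 L] makes the series
    in [p] converge, and [expR (- L) <= 1/2], true for [p >= 6], turns the rest into [4^(-r)]. *)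
Lemma osc_exponent p s : (s <= p)%N -> (6 <= p)%N ->
  expR (- ((6 * (3 / 4) ^+ (p - s) * @lil_scale R (2 ^ p)) ^+ 2 / (2 * (2 ^ s)%:R)))
  <= expR (- (2 * ln (ln (2 ^ p)%:R))) * 4^-1 ^+ (p - s).
Proof.
move=> sp p6; have p24 : (4 <= 2 ^ p)%N by rewrite (@leq_pexp2l 2 2)// (leq_trans _ p6).
set r := (p - s)%N; set L : R := ln (ln (2 ^ p)%:R).
have L0 : 0 < L by exact: lnln_gt0.
have -> : (6 * (3 / 4) ^+ r * @lil_scale R (2 ^ p)) ^+ 2 / (2 * (2 ^ s)%:R) =
    36 * (9 / 8) ^+ r * L.
  rewrite exprMn lil_scale_sqr// -/L.
  have -> : (2 ^ p)%:R = 2 ^+ r * (2 ^ s)%:R :> R.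
    by rewrite -natrX -natrM -expnD /r subnK.
  have -> : (9 / 8 : R) ^+ r = ((3 / 4) ^+ r) ^+ 2 * 2 ^+ r.
    by rewrite -exprM mulnC exprM -exprMn; congr (_ ^+ _); lra.
  have : (2 ^ s)%:R != 0 :> R by rewrite pnatr_eq0 -lt0n expn_gt0.
  by move: (2 ^ s)%:R => z z0; field.
have e2 : expR (- L) <= 2^-1.
  have l2 : 2 <= ln (2 ^ p)%:R :> R.
    rewrite ln_exp2; have := @ln2_ge_half R; have : 6%:R <= p%:R :> R by rewrite ler_nat.
    nra.
  by rewrite expRN lef_pV2 ?posrE ?expR_gt0// lnK// posrE (lt_le_trans _ l2).
apply: (@le_trans _ _ (expR (- (2 * L)) * expR (- L) ^+ (r * 2))).
  rewrite -expRM_natl -expRD ler_expR.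
  have := @exp_9_8_ge R r; rewrite natrM.
  have : (0 : R) <= r%:R by []. nra.
rewrite ler_wpM2l ?expR_ge0// mulnC exprM lerXn2r ?nnegrE ?exprn_ge0 ?expR_ge0//.
have := expR_ge0 (- L); nra.
Qed.

Context {d : measure_display} {T : measurableType d}.
Variables (P : probability T R) (W : R -> T -> R).
Hypothesis PW : std_wiener P W.

(** Union bound: the [2^(r + 1)] blocks at depth [r = p - s] contribute
    [4 expR (- 2 lnln (2 ^ p)) 2^(-r)], and summing over [r] leaves a constant times [p^(-2)]. *)
Lemma ae_dyadic_osc : {ae P, forall w, dyadic_osc (fun k => W k%:R w)}.
Proof.
pose x p s : R := 6 * (3 / 4) ^+ (p - s) * lil_scale (2 ^ p).
pose F p s i := [set w | x p s <= `|W (i.+1 * 2 ^ s)%:R w - W (i * 2 ^ s)%:R w|].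
pose E p := \big[setU/set0]_(s < p.+1) \big[setU/set0]_(i < 2 ^ (p.+1 - s)) F p s i.
have mF p s i : measurable (F p s i).
  exact: (measurable_increment PW _ _ (measurable_norm_ge _)).
have mE p : measurable (E p).
  by apply: bigsetU_measurable => s _; apply: bigsetU_measurable.
pose C : R := expR (- (2 * ln (ln 2))).
have PE p : (6 <= p)%N -> (P (E p) <= (8 * C * expR (- ((1 + 1) * ln p%:R)))%:E)%E.
  move=> p6; apply: (le_trans (@Boole_inequality _ _ _ P
    (fun s => \big[setU/set0]_(i < 2 ^ (p.+1 - s)) F p s i) p.+1 _)).
    by move=> s _; apply: bigsetU_measurable.
  have H (s : 'I_p.+1) : (P (\big[setU/set0]_(i < 2 ^ (p.+1 - s)) F p s i) <=
      (4 * expR (- (2 * ln (ln (2 ^ p)%:R))) * 2^-1 ^+ (p - s))%:E)%E.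
    have sp : (s <= p)%N by rewrite -ltnS.
    apply: (le_trans (@Boole_inequality _ _ _ P (F p s) (2 ^ (p.+1 - s)) _)) => //=.
    apply: (@le_trans _ _ (\sum_(i < 2 ^ (p.+1 - s))
       (2 * (expR (- (2 * ln (ln (2 ^ p)%:R))) * 4^-1 ^+ (p - s)))%:E)%E).
      apply: lee_sum => i _.
      apply: le_trans (prob_increment_large PW _ _ _) _ => //.
      - by rewrite ltr_nat ltn_mul2r expn_gt0/= ltnSn.
      - by rewrite !mulr_ge0 ?lil_scale_ge0.
      - rewrite lee_fin ler_wpM2l// -natrB ?leq_mul2r ?leqnSn ?orbT//.
        by rewrite -mulnBl subSnn mul1n; exact: osc_exponent.
    rewrite sumEFin sumr_const card_ord lee_fin -[leLHS]mulr_natl subSn// expnS natrM [X in 2 * X * _]natrX.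
    have -> : (4^-1 : R) ^+ (p - s) = 2^-1 ^+ (p - s) * 2^-1 ^+ (p - s).
      by rewrite -exprMn; congr (_ ^+ _); lra.
    have h : (2 : R) ^+ (p - s) * 2^-1 ^+ (p - s) = 1 by rewrite -exprMn divff// expr1n.
    rewrite le_eqVlt; apply/orP; left; apply/eqP.
    move: h; move: (2 ^+ _) (2^-1 ^+ _) (expR _) => a b e h.
    have -> : 2 * a * (2 * (e * (b * b))) = 4 * e * b * (a * b) by ring.
    by rewrite h mulr1.
  apply: le_trans (lee_sum _ (fun s _ => H s)) _.
  rewrite sumEFin lee_fin -mulr_sumr expR_lnln_exp2 ?(leq_trans _ p6)// -/C.
  have := @sum_geo_half_le R p; set S := \sum_(_ < _) _ => S2.
  have C0 : 0 < C := expR_gt0 _.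
  have := expR_gt0 (- (2 * ln p%:R) : R); rewrite (_ : (1 + 1 : R) = 2); last by lra.
  move: (expR (- (2 * ln p%:R))) => e e0.
  apply: (@le_trans _ _ (4 * (C * e) * 2)); last by lra.
  by rewrite ler_wpM2l// !mulr_ge0// ltW.
have := ae_eventually_not (u := fun p => 8 * C * expR (- ((1 + 1) * ln p%:R)))
  (M := 8 * C * (1 + 1^-1)) mE PE.
have /[swap]/[apply] : forall n, \sum_(6 <= k < n) 8 * C * expR (- ((1 + 1) * ln k%:R))
    <= 8 * C * (1 + 1^-1).
  by move=> n; rewrite -mulr_sumr ler_wpM2l ?mulr_ge0 ?expR_ge0// sum_expR_ln_tail_le.
apply: filterS => w; apply: filterS => p nE s i sp ip.
rewrite leNgt; apply/negP => xs; apply: nE; rewrite /E.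
rewrite -ltnS in sp.
rewrite -(bigcup_mkord p.+1 (fun s => \big[setU/set0]_(i < 2 ^ (p.+1 - s)) F p s i)).
by exists s => //; rewrite -(bigcup_mkord _ (F p s)); exists i => //; exact: ltW.
Qed.

End dyadic_oscillation.

(** * Upper bound for the energy of increments along geometric scales *)

Section energy.
Context {R : realType}.

(* The scales [a.+1 * 2 ^ p] with bounded [a] approximate every large [n] up to a
   small factor, and form finitely many geometric progressions, along which the
   Borel-Cantelli series converge. *)
Definition energy_bound (V : nat -> R) : Prop :=
  forall m a r : nat, \forall p \near \oo,
    \sum_(i < m) (V (i.+1 * (a.+1 * 2 ^ p))%N - V (i * (a.+1 * 2 ^ p))%N) ^+ 2
      <= (1 + r.+1%:R^-1) * lil_scale (a.+1 * 2 ^ p) ^+ 2.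

Lemma lee_prod_ord m (f g : 'I_m -> \bar R) :
  (forall i, (0 <= f i <= g i)%E) -> (\prod_(i < m) f i <= \prod_(i < m) g i)%E.
Proof.
move=> fg; suff /andP[] : (0 <= \prod_(i < m) f i <= \prod_(i < m) g i)%E by [].
elim/big_ind2 : _ => [|x1 x2 y1 y2 /andP[? ?] /andP[? ?]|//]; first by rewrite lee01 lexx.
by rewrite mule_ge0//= lee_pmul.
Qed.

(** Covers the region of energy at least [1 + e] by finitely many boxes, whose probabilities factor.
    Coordinates are rounded down to multiples of [de] and capped at [M]: rounding loses at most
    [m * de <= e / 2], and one capped coordinate alone weighs [M * de >= 1 + e / 2]. *)
Lemma simplex_cover m M (de e : R) (z : 'I_m -> R) : 0 < de ->
  1 + e / 2 <= M%:R * de -> m%:R * de <= e / 2 ->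
  (forall i, 0 <= z i) -> 1 + e <= \sum_i z i ->
  exists ka : {ffun 'I_m -> 'I_M.+1},
    (forall i, (ka i)%:R * de <= z i) /\ 1 + e / 2 <= \sum_i (ka i)%:R * de.
Proof.
move=> de0 Mde mde z0 ez.
pose k i := Num.truncn (z i / de).
have zk i : (k i)%:R * de <= z i by rewrite -ler_pdivlMr// truncn_le// divr_ge0// ltW.
have kz i : z i - de <= (k i)%:R * de.
  by rewrite lerBlDr -{2}(mul1r de) -mulrDl natr1 -ler_pdivrMr// ltW// truncnS_gt.
exists [ffun i => inord (minn (k i) M)].
have kaE i : [ffun i => inord (minn (k i) M) : 'I_M.+1] i = minn (k i) M :> nat.
  by rewrite ffunE inordK// ltnS geq_minr.
split=> [i|].
  by rewrite kaE (le_trans _ (zk i))// ler_wpM2r ?(ltW de0)// ler_nat geq_minl.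
under eq_bigr do rewrite kaE.
have [/existsP[j Mk]|/existsPn nMk] := boolP [exists j, (M <= k j)%N].
  rewrite (bigD1 j)//= (minn_idPr Mk) (le_trans Mde)// lerDl sumr_ge0// => i _.
  by rewrite mulr_ge0// ltW.
apply: (@le_trans _ _ (\sum_(i < m) (z i - de))).
  rewrite sumrB sumr_const card_ord -[_ *+ m]mulr_natl; lra.
apply: ler_sum => i _; rewrite (minn_idPl _)//.
by have := nMk i; rewrite -ltnNge => /ltnW.
Qed.

Context {d : measure_display} {T : measurableType d}.
Variables (P : probability T R) (W : R -> T -> R).
Hypothesis PW : std_wiener P W.

(** Since [lil_scale N ^ 2 / (2 N) = lnln N], the [i]-th Gaussian tail is at most
    [2 expR (- k i * lnln N)], and independence adds the exponents. *)
Lemma prob_increments_box N m (k : nat -> R) : (4 <= N)%N -> (forall i, 0 <= k i) ->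
  (P (\bigcap_(i in `I_m)
        [set w | Num.sqrt (k i) * lil_scale N <= `|W (i.+1 * N)%:R w - W (i * N)%:R w|]%R)
   <= (2 ^+ m * expR (- ((\sum_(i < m) k i) * ln (ln N%:R))))%:E)%E.
Proof.
move=> N4 k0; have N0 : (0 < N)%N by exact: leq_trans N4.
pose x i : R := Num.sqrt (k i) * lil_scale N.
have := prob_bigcap_increments PW (t := fun i => (i * N)%:R)
  (B := fun i => [set y | x i <= `|y|]) m.
rewrite mul0n => /(_ (lexx _)) /= ->; last 2 first.
- by move=> i; rewrite ltr_nat ltn_mul2r N0/= ltnSn.
- by move=> i; exact: measurable_norm_ge.
apply: (@le_trans _ _ (\prod_(i < m) (2 * expR (- (k i * ln (ln N%:R))))%:E)%E).
  apply: lee_prod_ord => i; rewrite measure_ge0/=.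
  apply: le_trans (prob_increment_large PW _ _ _) _ => //.
  - by rewrite ltr_nat ltn_mul2r N0/= ltnSn.
  - by rewrite mulr_ge0 ?sqrtr_ge0 ?lil_scale_ge0.
  - rewrite lee_fin ler_wpM2l// ler_expR lerN2 -natrB ?leq_mul2r ?leqnSn ?orbT//.
    rewrite -mulnBl subSnn mul1n exprMn sqr_sqrtr// lil_scale_sqr//.
    rewrite ler_pdivlMr ?mulr_gt0 ?ltr0n//.
    by rewrite le_eqVlt; apply/orP; left; apply/eqP; ring.
rewrite prodEFin lee_fin big_split/= prodr_const card_ord ler_wpM2l ?exprn_ge0//.
by rewrite -expR_sum mulr_suml sumrN.
Qed.

Lemma ae_energy_bound : {ae P, forall w, energy_bound (fun k => W k%:R w)}.
Proof.
apply/ae_foralln => m; apply/ae_foralln => a; apply/ae_foralln => r.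
case: m => [|m].
  apply: nearW => w; near=> p.
  by rewrite big_ord0 mulr_ge0 ?exprn_ge0 ?lil_scale_ge0.
pose e : R := r.+1%:R^-1.
have e0 : 0 < e by rewrite invr_gt0.
have e1 : e <= 1 by rewrite invf_le1// ler1n.
(* With these choices [m.+1 * de = e / 2] and [M * de = 2], which is at least [1 + e / 2] as
   [e <= 1]. *)
pose de : R := e / (2 * m.+1%:R).
have de0 : 0 < de by rewrite divr_gt0.
pose M := (4 * m.+1 * r.+1)%N.
have Mde : 1 + e / 2 <= M%:R * de.
  apply: (@le_trans _ _ 2); first lra.
  rewrite /M !natrM /de /e; set x : R := m.+1%:R; set y : R := r.+1%:R.
  have x0 : x != 0 by rewrite pnatr_eq0.
  have y0 : y != 0 by rewrite pnatr_eq0.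
  clearbody x y; rewrite le_eqVlt; apply/orP; left; apply/eqP; field.
  by rewrite x0 y0.
have mde : m.+1%:R * de <= e / 2.
  rewrite /de; set x : R := m.+1%:R.
  have x0 : x != 0 by rewrite pnatr_eq0.
  by rewrite le_eqVlt; apply/orP; left; apply/eqP; field; rewrite ?x0.
pose N p := (a.+1 * 2 ^ p)%N.
pose F (ka : {ffun 'I_m.+1 -> 'I_M.+1}) p := \bigcap_(i in `I_m.+1)
  [set w | Num.sqrt ((ka (inord i))%:R * de) * lil_scale (N p)
             <= `|W (i.+1 * N p)%:R w - W (i * N p)%:R w|].
have mF ka p : measurable (F ka p).
  apply: bigcap_measurableType => i _.
  exact: (measurable_increment PW _ _ (measurable_norm_ge _)).
pose C : R := 2 ^+ m.+1 * expR (- ((1 + e / 2) * ln (ln 2))).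
have PF (ka : {ffun 'I_m.+1 -> 'I_M.+1}) : 1 + e / 2 <= \sum_i (ka i)%:R * de -> forall p, (2 <= p)%N ->
    (P (F ka p) <= (C * expR (- ((1 + e / 2) * ln p%:R)))%:E)%E.
  move=> ka_ge p p2.
  have p4 : (4 <= 2 ^ p)%N by rewrite (@leq_pexp2l 2 2).
  have pN : (2 ^ p <= N p)%N by rewrite leq_pmull.
  have N4 : (4 <= N p)%N := leq_trans p4 pN.
  have := prob_increments_box m.+1 N4 (k := fun i => (ka (inord i))%:R * de).
  move=> /(_ _)/le_trans; apply.
    by move=> i; rewrite mulr_ge0// ltW.
  rewrite lee_fin /C -mulrA ler_wpM2l ?exprn_ge0//.
  rewrite -expR_lnln_exp2 ?(leq_trans _ p2)// ler_expR lerN2.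
  have h := @lnln_mono R _ _ (ltac:(exact: leq_trans p4) : (1 < 2 ^ p)%N) pN.
  have h0 := @lnln_gt0 R _ p4.
  under eq_bigr do rewrite inord_val.
  by apply: ler_pM => //; [lra|exact: ltW].
(* There are finitely many [ka], so the exceptional sets, and later the ranks in [p], can be taken
   common to all of them. *)
have aeF (ka : {ffun 'I_m.+1 -> 'I_M.+1}) : {ae P, forall w, 1 + e / 2 <= \sum_i (ka i)%:R * de ->
    \forall p \near \oo, ~ F ka p w}.
  have [ka_ge|ka_lt] := leP (1 + e / 2) (\sum_i (ka i)%:R * de); last first.
    by apply: nearW.
  have H n : \sum_(2 <= k < n) C * expR (- ((1 + e / 2) * ln k%:R)) <= C * (1 + (e / 2)^-1).
    by rewrite -mulr_sumr ler_wpM2l ?mulr_ge0 ?expR_ge0 ?exprn_ge0// sum_expR_ln_tail_le// divr_gt0.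
  by have := ae_eventually_not (mF ka) (PF ka ka_ge) H; apply: filterS.
have : {ae P, forall w (ka : {ffun 'I_m.+1 -> 'I_M.+1}), 1 + e / 2 <= \sum_i (ka i)%:R * de ->
    \forall p \near \oo, ~ F ka p w} by exact: filter_forall.
apply: filterS => w Fw.
have : \forall p \near \oo, forall (ka : {ffun 'I_m.+1 -> 'I_M.+1}), 1 + e / 2 <= \sum_i (ka i)%:R * de -> ~ F ka p w.
  apply: filter_forall => ka.
  have [ka_ge|ka_lt] := leP (1 + e / 2) (\sum_i (ka i)%:R * de); last first.
    by apply: nearW.
  by apply: filterS (Fw ka ka_ge).
move=> {Fw} Fw; near=> p.
have Fp : forall (ka : {ffun 'I_m.+1 -> 'I_M.+1}), 1 + e / 2 <= \sum_i (ka i)%:R * de -> ~ F ka p w by near: p.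
have N4 : (4 <= N p)%N.
  rewrite (@leq_trans (2 ^ p)) ?leq_pmull// (@leq_pexp2l 2 2)//.
  by near: p; exists 2%N.
rewrite -/(N p) -/e leNgt; apply/negP => lt_sum.
have Q0 : 0 < lil_scale (N p) ^+ 2 :> R by rewrite exprn_gt0// lil_scale_gt0.
pose z (i : 'I_m.+1) := (W (i.+1 * N p)%:R w - W (i * N p)%:R w) ^+ 2 / lil_scale (N p) ^+ 2.
have [ka [kaz ka_ge]] : exists ka : {ffun 'I_m.+1 -> 'I_M.+1},
    (forall i, (ka i)%:R * de <= z i) /\ 1 + e / 2 <= \sum_i (ka i)%:R * de.
  apply: simplex_cover => //.
  - by move=> i; rewrite divr_ge0// ?sqr_ge0// ltW.
  - by rewrite -mulr_suml ler_pdivlMr// ltW.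
apply: (Fp ka ka_ge) => i /= im.
have := kaz (inord i); rewrite /z inordK// => h.
rewrite -(@ler_pXn2r _ 2)// ?nnegrE ?mulr_ge0 ?sqrtr_ge0 ?lil_scale_ge0//.
rewrite [leLHS]exprMn sqr_sqrtr; last by rewrite mulr_ge0// ltW.
by rewrite real_normK ?num_real// -ler_pdivlMr.
Unshelve. all: by end_near. Qed.

End energy.

(** * Prescribed increments of energy below 1 are hit infinitely often *)

Section targets.
Context {R : realType}.

(* Rational targets keep the almost sure statement a countable intersection. *)
Definition approx_targets (V : nat -> R) : Prop :=
  forall (m M r : nat) (z : seq int),
    m.+2%:R * (\sum_(i < m.+1) ((nth 0 z i)%:~R / M.+1%:R) ^+ 2) < 1 :> R ->
    forall j0, exists2 j, (j0 <= j)%N & forall i, (i < m.+1)%N ->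
      `|V (i.+2 * m.+2 ^ j)%N - V (i.+1 * m.+2 ^ j)%N
          - (nth 0 z i)%:~R / M.+1%:R * lil_scale (m.+2 ^ j.+1)|
        <= r.+1%:R^-1 * lil_scale (m.+2 ^ j.+1).

Lemma sum_harmonic_unbounded (c : R) J : 0 < c ->
  forall M, exists N, M <= \sum_(j < N) c / (j + J).+1%:R.
Proof.
move=> c0 M.
have H N : ln (N + J).+1%:R - ln J.+1%:R <= \sum_(j < N) (j + J).+1%:R^-1 :> R.
  elim: N => [|N IH]; first by rewrite big_ord0 add0n subrr.
  rewrite big_ord_recr/=; set x : R := (N + J).+1%:R.
  have x0 : 0 < x by rewrite ltr0n.
  have -> : (N.+1 + J).+1%:R = x * (1 + x^-1) :> R.
    by rewrite addSn -[in LHS]natr1 mulrDr mulr1 divff// gt_eqF.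
  have xV0 : 0 < x^-1 by rewrite invr_gt0.
  rewrite lnM ?posrE ?addr_gt0//.
  have := @le_ln1Dx R x^-1; move: IH; rewrite -/x; move: (\sum_(_ < _) _) (x^-1) xV0 => S y y0.
  by move=> ? /(_ ltac:(lra)) ?; lra.
pose y := expR (M / c + ln J.+1%:R).
exists (Num.truncn y); under eq_bigr do rewrite mulrC.
rewrite -mulr_suml -ler_pdivrMr//; apply: le_trans (H _); rewrite lerBrDr.
rewrite -[leLHS]expRK ler_ln ?posrE ?expR_gt0 ?ltr0n// -/y.
by rewrite (le_trans (ltW (truncnS_gt y)))// ler_nat ltnS leq_addr.
Qed.

(** Young's inequality [2 x <= et x^2 + 1 / et]: the [+ 1] left by [normal_prob_near] costs a factor
    [1 + et] on the energy and an additive constant. *)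
Lemma sqrD1_half_le (x et : R) : 0 < et ->
  (x + 1) ^+ 2 / 2 <= (1 + et) * (x ^+ 2 / 2) + (1 + et^-1) / 2.
Proof.
move=> et0; have : 0 <= et * (x - et^-1) ^+ 2 by rewrite mulr_ge0 ?sqr_ge0// ltW.
have -> : et * (x - et^-1) ^+ 2 = et * x ^+ 2 - 2 * x + et^-1.
  by field; rewrite gt_eqF.
lra.
Qed.

Lemma lnln_unbounded b (M : R) : (1 < b)%N -> \forall j \near \oo, M <= ln (ln (b ^ j.+1)%:R).
Proof.
move=> b1; exists (Num.truncn (expR M / ln b%:R)) => // j /= Mj.
have lb : 0 < ln b%:R :> R by rewrite ln_gt0// ltr1n.
rewrite natrX lnXn ?ltr0n ?(ltnW b1)// -[ln _ *+ _]mulr_natl -[leLHS]expRK ler_ln ?posrE ?expR_gt0 ?mulr_gt0//.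
rewrite -ler_pdivrMr// (le_trans (ltW (truncnS_gt _)))// ler_nat ltnS//.
Qed.

(** The variance is [s^2 = b ^ j] and [lil_scale (b ^ j.+1) ^ 2 = s^2 * 2 b L], so the target lies
    at [|q| sqrt (2 b L)] standard deviations, whence the exponent [b q^2 L]. The hypothesis on [h]
    says that the half-width of the window is at least one standard deviation. *)
Lemma normal_prob_target b j (q h et : R) :
  (4 <= b ^ j.+1)%N -> 0 < et -> 0 < h -> 1 <= h ^+ 2 * (2 * b%:R * ln (ln (b ^ j.+1)%:R)) ->
  ((2 / Num.sqrt (pi *+ 2) * expR (- ((1 + et^-1) / 2)) *
     expR (- ((1 + et) * (b%:R * q ^+ 2) * ln (ln (b ^ j.+1)%:R))))%:E <=
   normal_prob 0 (Num.sqrt (b ^ j)%:R)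
     [set y | `|y - q * lil_scale (b ^ j.+1)| <= h * lil_scale (b ^ j.+1)]%R)%E.
Proof.
move=> b4 et0 h0 hL; have b0 : (0 < b)%N.
  by rewrite lt0n; apply: contraTneq b4 => ->; rewrite exp0n.
set s : R := Num.sqrt (b ^ j)%:R; set a : R := lil_scale (b ^ j.+1).
set L := ln (ln (b ^ j.+1)%:R) in hL *.
have s0 : 0 < s by rewrite sqrtr_gt0 ltr0n expn_gt0 b0.
have L0 : 0 < L by exact: lnln_gt0.
have s2 : s ^+ 2 = (b ^ j)%:R by rewrite sqr_sqrtr.
have a2 : a ^+ 2 = s ^+ 2 * (2 * b%:R * L).
  by rewrite /a lil_scale_sqr// s2 -/L expnS natrM; ring.
have sh : s <= h * a.
  rewrite -(@ler_pXn2r _ 2)// ?nnegrE ?mulr_ge0 ?lil_scale_ge0 ?(ltW s0) ?(ltW h0)//.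
  rewrite exprMn a2 mulrCA ler_pMr// exprn_gt0//.
apply: le_trans (normal_prob_near _ s0 sh).
rewrite lee_fin -mulrA ler_wpM2l ?divr_ge0 ?sqrtr_ge0// -expRD ler_expR -opprD lerN2.
apply: le_trans (sqrD1_half_le _ et0) _; rewrite addrC lerD2l.
have -> : (`|q * a| / s) ^+ 2 / 2 = b%:R * q ^+ 2 * L.
  rewrite exprMn real_normK ?num_real// exprMn a2 exprVn.
  by field; rewrite gt_eqF.
by rewrite mulrA.
Qed.

Context {d : measure_display} {T : measurableType d}.
Variables (P : probability T R) (W : R -> T -> R).
Hypothesis PW : std_wiener P W.

(* The times [i * b ^ j], [1 <= i <= b], with [b = K + 1], listed in increasing
   order: the blocks of [K] increments for different [j] do not overlap. *)
Lemma ae_hit_targets (K J : nat) (q h : nat -> R) :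
  (0 < K)%N -> (forall j, 0 < h j) ->
  K.+1%:R * (\sum_(i < K) q i ^+ 2) < 1 ->
  {near \oo, forall j, 1 <= h j ^+ 2 * (2 * K.+1%:R * ln (ln (K.+1 ^ j.+1)%:R))} ->
  {ae P, forall w, exists2 j, (J <= j)%N & forall i, (i < K)%N ->
    `|W (i.+2 * K.+1 ^ j)%:R w - W (i.+1 * K.+1 ^ j)%:R w
       - q i * lil_scale (K.+1 ^ j.+1)| <= h j * lil_scale (K.+1 ^ j.+1)}.
Proof.
move=> K0 h0 q1 [J' _ hJ].
set b := K.+1 in q1 hJ *.
(* [J] serves the conclusion, [J'] the hypothesis on [h], and 1 ensures [b ^ j.+1 >= 4] for
   [j >= J0]. *)
pose J0 := maxn (maxn J J') 1.
(* The times fit together across blocks because [(K + 1) b^j = b^(j + 1)], so all [K] increments of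
   a block have the same length. *)
pose t l : R := ((l %% K).+1 * b ^ (l %/ K + J0))%:R.
pose X l w := W (t l.+1) w - W (t l) w.
pose Bx j i := [set y : R | `|y - q i * lil_scale (b ^ j.+1)| <= h j * lil_scale (b ^ j.+1)].
have mBx j i : measurable (Bx j i) by exact: measurable_norm_sub_le.
pose A j := \bigcap_(i in `I_K) (X (j * K + i)%N @^-1` Bx (j + J0)%N i).
have tE j i : (i < K)%N -> t (j * K + i)%N = (i.+1 * b ^ (j + J0))%:R.
  by move=> iK; rewrite /t modnMDl modn_small// divnMDl// divn_small// addn0.
have tSE j i : (i < K)%N -> t (j * K + i).+1 = (i.+2 * b ^ (j + J0))%:R.
  move=> iK; have [iK1|] := ltnP i.+1 K; first by rewrite -addnS tE.
  move=> Ki; have {}Ki : i.+1 = K by apply/eqP; rewrite eqn_leq iK Ki.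
  rewrite -addnS Ki -mulSnr -[(_ * K)%N]addn0 tE// mul1n addSn expnS.
  by [].
have tS l : t l.+1 - t l = (b ^ (l %/ K + J0))%:R.
  rewrite (divn_eq l K); set j := (l %/ K)%N; set i := (l %% K)%N.
  have iK : (i < K)%N by rewrite ltn_mod.
  rewrite tSE// tE// -natrB ?leq_mul2r ?leqnSn ?orbT// -mulnBl subSnn mul1n.
  by rewrite divnMDl// divn_small// addn0.
have tlt l : t l < t l.+1 by rewrite -subr_gt0 tS ltr0n expn_gt0.
have mA j : measurable (A j).
  apply: bigcap_measurableType => i _; exact: (measurable_increment PW).
pose pr j i := fine (normal_prob 0 (Num.sqrt (b ^ j)%:R) (Bx j i)).
have prE j i : normal_prob 0 (Num.sqrt (b ^ j)%:R) (Bx j i) = (pr j i)%:E.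
  rewrite fineK//; apply: fin_num_measure; exact: mBx.
pose p j := \prod_(i < K) pr (j + J0)%N i.
have PA (e : nat -> bool) N : P (\bigcap_(j in `I_N) (if e j then A j else setT))
    = (\prod_(j < N) (if e j then p j else 1))%:E.
  pose B l := if e (l %/ K)%N then Bx (l %/ K + J0)%N (l %% K)%N else setT.
  have mB l : measurable (B l) by rewrite /B; case: ifP.
  have -> : \bigcap_(j in `I_N) (if e j then A j else setT)
      = \bigcap_(l in `I_(N * K)) (X l @^-1` B l).
    apply/seteqP; split => w.
      move=> Hw l /= lNK; rewrite /B; case: ifP => // el.
      have := Hw (l %/ K)%N; rewrite /= ltn_divLR// lNK => /(_ isT).
      by rewrite el => /(_ (l %% K)%N); rewrite /= ltn_mod K0 -divn_eq => /(_ isT).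
    move=> Hw j /= jN; case: ifP => // ej i /= iK.
    have := Hw (j * K + i)%N; rewrite /= /B divnMDl// divn_small// addn0 modnMDl modn_small// ej.
    by apply; rewrite (leq_trans (_ : _ < j * K + K)%N) ?ltn_add2l// -mulSnr leq_mul2r jN orbT.
  rewrite (prob_bigcap_increments PW (t := t) (B := B))//.
  rewrite (big_nat_blocks _ K N (fun l => P (X l @^-1` B l))) -prodEFin; apply: eq_bigr => j _.
  case: ifP => ej; last first.
    rewrite big1// => i _; rewrite /B divnMDl// divn_small// addn0 ej.
    by rewrite preimage_setT probability_setT.
  rewrite /p -prodEFin; apply: eq_bigr => i _.
  rewrite (prob_increment PW)//.
  rewrite tS /B divnMDl// divn_small// addn0 ej modnMDl modn_small//.
have [c c0 pc] : exists2 c : R, 0 < c & forall j, c / (j + J0).+1%:R <= p j.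
  pose th := b%:R * (\sum_(i < K) q i ^+ 2).
  have th0 : 0 <= th by rewrite mulr_ge0// sumr_ge0// => i _; rewrite sqr_ge0.
  (* Then [(1 + et) * th = 1 - et^2 <= 1], so the product of the [K] lower bounds is at least a
     constant times [expR (- L) = 1 / (n.+1 * ln b)]: a divergent harmonic series. *)
  pose et := 1 - th.
  have et0 : 0 < et by rewrite subr_gt0.
  pose ka : R := 2 / Num.sqrt (pi *+ 2) * expR (- ((1 + et^-1) / 2)).
  have ka0 : 0 < ka.
    by rewrite mulr_gt0 ?expR_gt0// divr_gt0// sqrtr_gt0 mulrn_wgt0// pi_gt0.
  have lb0 : 0 < ln b%:R :> R by rewrite ln_gt0// ltr1n.
  exists (ka ^+ K / ln b%:R); first by rewrite divr_gt0// exprn_gt0.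
  move=> j; set n := (j + J0)%N.
  have n1 : (0 < n)%N by rewrite (leq_trans _ (leq_addl _ _))// leq_max ltnSn orbT.
  have b4 : (4 <= b ^ n.+1)%N.
    by rewrite (@leq_trans (2 ^ n.+1)%N) ?(@leq_pexp2l 2 2)// leq_exp2r.
  set L : R := ln (ln (b ^ n.+1)%:R).
  have L0 : 0 < L by exact: lnln_gt0.
  apply: (@le_trans _ _ (\prod_(i < K) (ka * expR (- ((1 + et) * (b%:R * q i ^+ 2) * L))))).
    rewrite big_split/= prodr_const card_ord -[leLHS]mulrA ler_wpM2l ?exprn_ge0 ?(ltW ka0)//.
    rewrite -expR_sum sumrN -mulr_suml -mulr_sumr -mulr_sumr -/th.
    rewrite -invfM mulr_natr -lnXn ?ltr0n// -natrX.
    rewrite -[X in X^-1]lnK; last first.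
      by rewrite posrE ln_gt0// ltr1n (leq_trans _ b4).
    rewrite -/L -expRN ler_expR lerN2 ler_piMl ?(ltW L0)//.
    by rewrite /et; move: (th) => x; have := sqr_ge0 (1 - x); rewrite expr2; lra.
  apply: ler_prod => i _; rewrite mulr_ge0 ?expR_ge0 ?(ltW ka0)//=.
  rewrite -lee_fin -prE; apply: normal_prob_target => //.
  by apply: hJ; rewrite /= (leq_trans _ (leq_addl _ _))// !leq_max leqnn orbT.
have := prob_bigcap_setC_eq0 mA PA.
have pM M : exists N, M <= \sum_(j < N) p j.
  have [N MN] := sum_harmonic_unbounded J0 c0 M.
  by exists N; apply: le_trans MN _; apply: ler_sum.
move=> /(_ pM) D0; exists (\bigcap_j ~` A j); split => //.
  by apply: bigcap_measurableType => j _; exact: measurableC.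
move=> w /= nw j _ Aw; apply: nw; exists (j + J0)%N.
  by rewrite (leq_trans _ (leq_addl _ _))// !leq_max leqnn.
move=> i iK; have := Aw i iK; rewrite /X /= tSE// tE//.
Qed.

Lemma ae_approx_targets : {ae P, forall w, approx_targets (fun k => W k%:R w)}.
Proof.
apply/ae_foralln => m; apply/ae_foralln => M; apply/ae_foralln => r.
(* Finite integer sequences are quantified through their codes [c], which makes the intersection
   countable; a code that decodes to nothing stands for the empty sequence. *)
have : {ae P, forall w (c j0 : nat), let z := odflt [::] (unpickle c : option (seq int)) in
    m.+2%:R * (\sum_(i < m.+1) ((nth 0 z i)%:~R / M.+1%:R) ^+ 2) < 1 :> R ->
    exists2 j, (j0 <= j)%N & forall i, (i < m.+1)%N ->
      `|W (i.+2 * m.+2 ^ j)%:R w - W (i.+1 * m.+2 ^ j)%:R w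
          - (nth 0 z i)%:~R / M.+1%:R * lil_scale (m.+2 ^ j.+1)|
        <= r.+1%:R^-1 * lil_scale (m.+2 ^ j.+1)}.
  apply/ae_foralln => c; apply/ae_foralln => j0.
  set z : seq int := odflt _ _.
  have [q1|q1] := boolP (m.+2%:R * (\sum_(i < m.+1) ((nth 0 z i)%:~R / M.+1%:R) ^+ 2) < 1 :> R);
    last by apply: nearW => w /= q1'; rewrite q1' in q1.
  have r0 : 0 < r.+1%:R^-1 :> R by rewrite invr_gt0.
  have H := @ae_hit_targets m.+1 j0 (fun i => (nth 0 z i)%:~R / M.+1%:R)
    (fun=> r.+1%:R^-1) isT (fun=> r0) q1.
  suff /H : {near \oo, forall j, 1 <= r.+1%:R^-1 ^+ 2 *
      (2 * m.+2%:R * ln (ln (m.+2 ^ j.+1)%:R)) :> R} by apply: filterS => w.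
  near=> j; rewrite exprVn ler_pdivlMl ?exprn_gt0// mulr1.
  apply: (@le_trans _ _ (1 * 1 * ln (ln (m.+2 ^ j.+1)%:R))).
    by rewrite !mul1r; near: j; exact: lnln_unbounded.
  rewrite ler_wpM2r//; last by rewrite ler_pM// ler1n.
  by apply: (le_trans (sqr_ge0 r.+1%:R)); near: j; exact: lnln_unbounded.
apply: filterS => w H z q1 j0.
by have := H (pickle z) j0; rewrite pickleK; apply.
Unshelve. all: by end_near. Qed.

End targets.

(** * Moduli of continuity and growth bounds of a single path *)

Section path_modulus.
Context {R : realType}.
Implicit Types V : nat -> R.

Definition dyadic_osc_at V (p : nat) (a : R) : Prop :=
  forall s i, (s <= p)%N -> (i < 2 ^ (p.+1 - s))%N ->
    `|V (i.+1 * 2 ^ s)%N - V (i * 2 ^ s)%N| <= 6 * (3 / 4) ^+ (p - s) * a.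

(** Binary descent: the point lies in the left half of the block, or in the right half after one
    step of half length. The constant 18 is the fixed point of [c = 3/4 (c + 6)]. *)
Lemma chaining_block V p a : 0 <= a -> dyadic_osc_at V p a ->
  forall q i l, (q <= p)%N -> (l < 2 ^ q)%N -> (i * 2 ^ q + l < 2 ^ p.+1)%N ->
    `|V (i * 2 ^ q + l)%N - V (i * 2 ^ q)%N| <= 18 * (3 / 4) ^+ (p - q) * a.
Proof.
move=> a0 osc; elim=> [|q IH] i l qp lq kp.
  move: lq; rewrite expn0 ltnS leqn0 => /eqP ->; rewrite addn0 subrr normr0.
  by rewrite !mulr_ge0// exprn_ge0.
have pq : (p - q = (p - q.+1).+1)%N by rewrite -subSn// subSS.
have rho0 : 0 <= (3 / 4 : R) ^+ (p - q.+1) * a by rewrite mulr_ge0// exprn_ge0.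
have [lq'|lq'] := ltnP l (2 ^ q).
  have := IH (i * 2)%N l (ltnW qp) lq'.
  rewrite -mulnA -expnS => /(_ kp)/le_trans; apply.
  rewrite pq exprS; move: rho0; move: (_ ^+ _) => x; nra.
have e1 : (i * 2 ^ q.+1 + l = (i * 2).+1 * 2 ^ q + (l - 2 ^ q))%N.
  by rewrite expnS; move: lq'; move: (2 ^ q)%N => x; nia.
have l' : (l - 2 ^ q < 2 ^ q)%N by rewrite ltn_subLR// addnn -mul2n -expnS.
rewrite e1 in kp *.
have h1 := IH (i * 2).+1 (l - 2 ^ q)%N (ltnW qp) l' kp.
have h2 : `|V ((i * 2).+1 * 2 ^ q)%N - V (i * 2 * 2 ^ q)%N| <= 6 * (3 / 4) ^+ (p - q) * a.
  apply: osc; first exact: ltnW.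
  rewrite -(@ltn_pmul2r (2 ^ q)) ?expn_gt0// -expnD subnK ?(leq_trans (ltnW qp))//.
  rewrite (leq_ltn_trans _ kp)// (leq_trans _ (leq_addr _ _))// leq_mul2r.
  by rewrite leqnSn orbT.
rewrite expnS mulnA.
apply: le_trans (ler_distD (V ((i * 2).+1 * 2 ^ q)%N) _ _) _.
apply: le_trans (lerD h1 h2) _; rewrite pq exprS.
by move: rho0; move: (_ ^+ _) => x; lra.
Qed.

(** Points at distance at most [2 ^ q] lie in the same or in adjacent blocks, and
    [42 = 18 + 18 + 6]: two descents and one step between the left ends. *)
Lemma chaining_close V p a q k k' : 0 <= a -> dyadic_osc_at V p a ->
  (q <= p)%N -> (k <= k')%N -> (k' < 2 ^ p.+1)%N -> (k' <= k + 2 ^ q)%N ->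
  `|V k - V k'| <= 42 * (3 / 4) ^+ (p - q) * a.
Proof.
move=> a0 osc qp kk' k'p kq.
have q0 : (0 < 2 ^ q)%N by rewrite expn_gt0.
have kp : (k < 2 ^ p.+1)%N by exact: leq_ltn_trans k'p.
pose i := (k %/ 2 ^ q)%N; pose i' := (k' %/ 2 ^ q)%N.
have ii' : (i <= i')%N by exact: leq_div2r.
have i'i : (i' <= i.+1)%N.
  by rewrite /i' (leq_trans (leq_div2r _ kq))// divnDr ?dvdnn// divnn q0 addn1.
have hk := chaining_block a0 osc qp (ltn_pmod k q0).
have hk' := chaining_block a0 osc qp (ltn_pmod k' q0).
have {}hk : `|V k - V (i * 2 ^ q)%N| <= 18 * (3 / 4) ^+ (p - q) * a.
  by have := hk i; rewrite -divn_eq; apply.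
have {}hk' : `|V k' - V (i' * 2 ^ q)%N| <= 18 * (3 / 4) ^+ (p - q) * a.
  by have := hk' i'; rewrite -divn_eq; apply.
have hi : `|V (i' * 2 ^ q)%N - V (i * 2 ^ q)%N| <= 6 * (3 / 4) ^+ (p - q) * a.
  have : (i' == i) || (i' == i.+1) by lia.
  case/orP => /eqP ->; first by rewrite subrr normr0 !mulr_ge0// exprn_ge0.
  apply: osc => //; rewrite -(@ltn_pmul2r (2 ^ q))// -expnD subnK ?(leq_trans qp)//.
  by rewrite (leq_ltn_trans (leq_divM _ _)).
move: hk hk' hi; rewrite !ler_norml => /andP[? ?] /andP[? ?] /andP[? ?].
by apply/andP; split; lra.
Qed.

Definition lil_equicont V : Prop := forall e : R, 0 < e -> exists2 de : R, 0 < de &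
  \forall n \near \oo, forall k k', (k <= n)%N -> (k' <= n)%N ->
    `|k%:R - k'%:R| <= de * n%:R :> R -> `|V k - V k'| <= e * lil_scale n.

Lemma ler_exp_small (x y : R) : 0 <= x < 1 -> 0 < y -> exists r, x ^+ r <= y.
Proof.
move=> /andP[x0 x1] y0.
have : (x ^+ n @[n --> \oo] --> (0 : R)) by apply: cvg_expr; rewrite ger0_norm.
move=> /cvgrPdist_le/(_ _ y0)[N _ /(_ N (leqnn _))] /=.
by rewrite sub0r normrN ger0_norm ?exprn_ge0// => ?; exists N.
Qed.

Lemma lil_equicont_of_dyadic V : dyadic_osc V -> lil_equicont V.
Proof.
move=> [p0 _ osc] e e0.
have [r hr] := @ler_exp_small (3 / 4) (e / 42) ltac:(lra) ltac:(lra).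
(* As [n < 2 ^ p.+1], a distance of at most [n / 2 ^ r.+1] is below [2 ^ (p - r)], the block length
   at which chaining gives [42 (3/4)^r <= e]. *)
exists (2^-1 ^+ r.+1); first by rewrite exprn_gt0.
exists (2 ^ (maxn p0 (maxn r 2)))%N => // n /= pn k k' kn k'n.
have n0 : (0 < n)%N by rewrite (leq_trans _ pn)// expn_gt0.
pose p := trunc_log 2 n.
have /andP[pn1 pn2] : (2 ^ p <= n < 2 ^ p.+1)%N by exact: trunc_log_bounds.
have : (maxn p0 (maxn r 2) <= p)%N by exact: trunc_log_max.
rewrite !geq_max => /and3P[p0p rp p2].
have p4 : (4 <= 2 ^ p)%N by rewrite (@leq_pexp2l 2 2).
move=> kk'.
have pr : (p - (p - r) = r)%N by rewrite subKn.
have close x y : (x <= y)%N -> (y <= n)%N -> y%:R - x%:R <= 2^-1 ^+ r.+1 * n%:R :> R ->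
    `|V x - V y| <= e * lil_scale n.
  move=> xy yn yx.
  apply: (@le_trans _ _ (42 * (3 / 4) ^+ (p - (p - r)) * lil_scale (2 ^ p))).
    apply: chaining_close; rewrite ?lil_scale_ge0 ?leq_subr//.
    - exact: osc.
    - exact: leq_ltn_trans pn2.
    - rewrite -leq_subLR -(ler_nat R) natrB// natrX; apply: (le_trans yx).
      rewrite exprVn ler_pdivrMl ?exprn_gt0// -exprD -natrX ler_nat.
      by rewrite addSn subnKC// ltnW.
  rewrite pr ler_pM ?mulr_ge0 ?exprn_ge0 ?lil_scale_ge0 ?lil_scale_mono//.
  by lra.
have [kle|/ltnW kle] := leqP k k'.
  by apply: close => //; move: kk'; rewrite ler_norml => /andP[]; lra.
by rewrite distrC; apply: close => //; move: kk'; rewrite ler_norml => /andP[]; lra.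
Qed.

(** [24 = 6 + 18]: one step from 0 to [2 ^ p], then a descent between [2 ^ p] and [2 ^ p.+1]. *)
Lemma lil_bound_of_dyadic V : V 0%N = 0 -> dyadic_osc V ->
  \forall n \near \oo, `|V n| <= 24 * lil_scale n.
Proof.
move=> V0 [p0 _ osc].
exists (2 ^ (maxn p0 2))%N => // n /= pn.
have n0 : (0 < n)%N by rewrite (leq_trans _ pn)// expn_gt0.
pose p := trunc_log 2 n.
have /andP[pn1 pn2] : (2 ^ p <= n < 2 ^ p.+1)%N by exact: trunc_log_bounds.
have : (maxn p0 2 <= p)%N by exact: trunc_log_max.
rewrite geq_max => /andP[p0p p2].
have p4 : (4 <= 2 ^ p)%N by rewrite (@leq_pexp2l 2 2).
have osc_p := osc p p0p.
have h2 := osc_p p 0%N (leqnn _); rewrite mul0n mul1n V0 subr0 subnn expr0 mulr1 subSnn in h2.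
have h1 := @chaining_block V p _ (lil_scale_ge0 _) osc_p p 1%N (n - 2 ^ p)%N (leqnn _).
rewrite mul1n subnKC// subnn expr0 mulr1 in h1.
have {}h1 := h1 _ pn2.
rewrite -[V n](subrK (V (2 ^ p)%N)); apply: le_trans (ler_normD _ _) _.
apply: (@le_trans _ _ (18 * lil_scale (2 ^ p) + 6 * lil_scale (2 ^ p))).
  by rewrite lerD ?h2// h1// ltn_subLR// addnn -mul2n -expnS.
have := @lil_scale_mono R _ _ p4 pn1; lra.
Qed.

Lemma lil_scale_unbounded (M : R) : \forall n \near \oo, M <= lil_scale n.
Proof.
have [N N0] : exists N : nat, M ^+ 2 / (2 * ln (ln 4)) <= N%:R.
  by exists (Num.truncn (M ^+ 2 / (2 * ln (ln 4)))).+1; rewrite ltW// truncnS_gt.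
have l4 : 0 < ln (ln 4) :> R by have := @lnln_gt0 R 4 isT.
exists (maxn N 4) => // n /=; rewrite geq_max => /andP[Nn n4].
have [M0|M0] := leP M 0; first by rewrite (le_trans M0)// lil_scale_ge0.
rewrite -(@ler_pXn2r _ 2)// ?nnegrE ?lil_scale_ge0 ?(ltW M0)// lil_scale_sqr//.
rewrite ler_pdivrMr ?mulr_gt0// in N0; apply: (le_trans N0).
have h : ln (ln 4) <= ln (ln n%:R) :> R by exact: (@lnln_mono R 4).
have Nn' : N%:R <= n%:R :> R by rewrite ler_nat.
by rewrite mulrA [N%:R * 2]mulrC ler_pM ?mulr_ge0 ?(ltW l4)// ler_wpM2l.
Qed.

Lemma lil_bound_uniform V (C e : R) : 0 <= C -> 0 < e ->
  (\forall n \near \oo, `|V n| <= C * lil_scale n) ->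
  \forall n \near \oo, forall k, (k <= n)%N -> `|V k| <= (C + e) * lil_scale n.
Proof.
move=> C0 e0 [N' _ VN'].
pose N := maxn N' 4.
have VN n : (N <= n)%N -> `|V n| <= C * lil_scale n.
  by rewrite geq_max => /andP[+ _]; exact: VN'.
pose M := \sum_(k < N) `|V k|.
near=> n; move=> k kn.
have a0 := @lil_scale_ge0 R n.
have Ma : M <= e * lil_scale n.
  by rewrite -ler_pdivrMl//; near: n; exact: lil_scale_unbounded.
have [kN|Nk] := ltnP k N.
  apply: (@le_trans _ _ M); first by rewrite /M (bigD1 (Ordinal kN))//= lerDl sumr_ge0.
  by rewrite mulrDl (le_trans Ma)// lerDr mulr_ge0.
apply: (le_trans (VN k Nk)); rewrite ler_pM ?lil_scale_ge0//; first by rewrite lerDl ltW.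
by apply: lil_scale_mono => //; rewrite (leq_trans _ Nk)// leq_maxr.
Unshelve. all: by end_near. Qed.

Lemma lil_scale_ratio k n : (4 <= k)%N -> (k <= n)%N ->
  lil_scale k <= Num.sqrt (k%:R / n%:R) * lil_scale n :> R.
Proof.
move=> k4 kn; have n4 : (4 <= n)%N by exact: leq_trans kn.
have n0 : 0 < n%:R :> R by rewrite ltr0n (leq_trans _ n4).
have q0 : 0 <= k%:R / n%:R :> R by rewrite divr_ge0// ltW.
rewrite -(@ler_pXn2r _ 2)// ?nnegrE ?mulr_ge0 ?sqrtr_ge0 ?lil_scale_ge0//.
rewrite exprMn (sqr_sqrtr q0) !lil_scale_sqr//.
have -> : k%:R / n%:R * (2 * n%:R * ln (ln n%:R)) = 2 * k%:R * ln (ln n%:R) :> R.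
  by field; rewrite gt_eqF.
by rewrite ler_wpM2l// lnln_mono// (leq_trans _ k4).
Qed.

(** For large [k] the ratio [lil_scale k / lil_scale n] is at most [sqrt (k / n)], as [lnln]
    increases. For the finitely many small [k] the right side is at least [sqrt (2 lnln n)], which
    is unbounded. Divided by [u = k / n], this gives the integrable majorant [u^(-1/2)]. *)
Lemma lil_bound_sqrt V (C : R) : 0 <= C -> (\forall n \near \oo, `|V n| <= C * lil_scale n) ->
  \forall n \near \oo, forall k, (0 < k)%N -> (k <= n)%N ->
    `|V k| <= (C + 1) * Num.sqrt (k%:R / n%:R) * lil_scale n.
Proof.
move=> C0 [N' _ VN'].
pose N := maxn N' 4.
have VN n : (N <= n)%N -> `|V n| <= C * lil_scale n.
  by rewrite geq_max => /andP[+ _]; exact: VN'.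
pose M := \sum_(k < N) `|V k|.
have M0 : 0 <= M by rewrite sumr_ge0.
have L4 : 0 < ln (ln 4) :> R by have := @lnln_gt0 R 4 isT.
near=> n; move=> k k0 kn.
have n4 : (4 <= n)%N by near: n; exists 4%N.
have n0 : 0 < n%:R :> R by rewrite ltr0n (leq_trans _ n4).
have q0 : 0 <= k%:R / n%:R :> R by rewrite divr_ge0// ltW.
have qa0 : 0 <= Num.sqrt (k%:R / n%:R) * lil_scale n :> R.
  by rewrite mulr_ge0 ?sqrtr_ge0 ?lil_scale_ge0.
rewrite -mulrA; have [kN|Nk] := ltnP k N; last first.
  apply: (le_trans (VN k Nk)); apply: ler_pM; rewrite ?lil_scale_ge0//; first by rewrite lerDl.
  by apply: lil_scale_ratio => //; rewrite (leq_trans _ Nk)// leq_maxr.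
apply: (@le_trans _ _ M); first by rewrite /M (bigD1 (Ordinal kN))//= lerDl sumr_ge0.
rewrite -[leLHS]mul1r ler_pM//; first by rewrite lerDr.
rewrite -(@ler_pXn2r _ 2)// ?nnegrE// exprMn (sqr_sqrtr q0) lil_scale_sqr//.
have -> : k%:R / n%:R * (2 * n%:R * ln (ln n%:R)) = k%:R * (2 * ln (ln n%:R)) :> R.
  by field; rewrite gt_eqF.
have ML : M ^+ 2 / 2 <= ln (ln n%:R).
  near: n; exists (maxn 4 (Num.truncn (expR (expR (M ^+ 2 / 2)))).+1) => // m /=.
  rewrite geq_max => /andP[m4 Mm].
  have m0 : (0 < m)%N by exact: leq_trans m4.
  have lm : expR (M ^+ 2 / 2) <= ln m%:R :> R.
    rewrite -[leLHS]expRK ler_ln ?posrE ?expR_gt0 ?ltr0n//.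
    by rewrite (le_trans (ltW (truncnS_gt _)))// ler_nat.
  by rewrite -[leLHS]expRK ler_ln ?posrE ?expR_gt0// (lt_le_trans _ lm)// expR_gt0.
apply: (@le_trans _ _ (1 * (2 * ln (ln n%:R)))); first lra.
by rewrite ler_wpM2r ?ler1n// mulr_ge0// ltW// lnln_gt0.
Unshelve. all: by end_near. Qed.

End path_modulus.

(** * The Strassen class *)

Section real_integrable.
Context {d : measure_display} {T : measurableType d} {R : realType}.
Variables (mu : {measure set T -> \bar R}) (D : set T).
Hypothesis mD : measurable D.
Implicit Types f g : T -> R.

Lemma integrable_realZ c f : mu.-integrable D (EFin \o f) ->
  mu.-integrable D (EFin \o (fun u => c * f u)).
Proof. exact: integrableZl. Qed.

Lemma integrable_realB f g : mu.-integrable D (EFin \o f) ->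
  mu.-integrable D (EFin \o g) -> mu.-integrable D (EFin \o (fun u => f u - g u)).
Proof. exact: integrableB. Qed.

Lemma integrable_real_norm f : mu.-integrable D (EFin \o f) ->
  mu.-integrable D (EFin \o (fun u => `|f u|)).
Proof. by move=> /integrable_norm. Qed.

Lemma EFin_Rintegral f : mu.-integrable D (EFin \o f) ->
  ((Rintegral mu D f)%:E = \int[mu]_(x in D) (f x)%:E)%E.
Proof. by move=> fi; rewrite /Rintegral fineK//; exact: integrable_fin_num. Qed.

Lemma integrable_real_bounded f c : (mu D < +oo)%E -> measurable_fun D f ->
  (forall u, D u -> `|f u| <= c) -> mu.-integrable D (EFin \o f).
Proof.
move=> muD mf fc; apply: measurable_bounded_integrable => //.
exists c; split; first exact: num_real.
by move=> x cx u Du /=; apply: le_trans (fc u Du) _; exact: ltW.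
Qed.

Lemma integrable_real_cst c : (mu D < +oo)%E -> mu.-integrable D (EFin \o cst c).
Proof. by move=> muD; apply: (@integrable_real_bounded _ `|c|). Qed.

(* The quadratic function [c -> int (f - c)^2] is nonnegative at the mean value. *)
Lemma Rintegral_sqr_le f : (mu D < +oo)%E -> mu.-integrable D (EFin \o f) ->
  mu.-integrable D (EFin \o (fun u => f u ^+ 2)) ->
  (Rintegral mu D f) ^+ 2 <= fine (mu D) * Rintegral mu D (fun u => f u ^+ 2).
Proof.
move=> muD fi f2i; set A := Rintegral mu D f; set E := Rintegral mu D _.
have H c : 0 <= E - (2 * c * A - c ^+ 2 * fine (mu D)).
  have := @Rintegral_ge0 _ _ _ mu D (fun u => f u ^+ 2 - (2 * c * f u - cst (c ^+ 2) u)).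
  rewrite RintegralB//; last first.
    apply: integrable_realB; [exact: integrable_realZ|exact: integrable_real_cst].
  rewrite RintegralB//; [|exact: integrable_realZ|exact: integrable_real_cst].
  rewrite RintegralZl// Rintegral_cst//; apply => u _ /=.
  have -> : f u ^+ 2 - (2 * c * f u - c ^+ 2) = (f u - c) ^+ 2 by ring.
  exact: sqr_ge0.
have := fine_ge0 (measure_ge0 mu D); rewrite le_eqVlt => /predU1P[m0|m0].
  rewrite -m0 mul0r; suff -> : A = 0 by rewrite expr0n.
  apply/eqP; apply: contraT => An0.
  have := H ((E + 1) / A); rewrite -m0 mulr0 subr0.
  have -> : 2 * ((E + 1) / A) * A = 2 * (E + 1) by field.
  have : 0 <= E by apply: Rintegral_ge0 => u _; exact: sqr_ge0.
  lra.
have := H (A / fine (mu D)); move: m0; move: (fine _) => m m0.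
have -> : E - (2 * (A / m) * A - (A / m) ^+ 2 * m) = E - A ^+ 2 / m.
  by field; rewrite gt_eqF.
by rewrite subr_ge0 ler_pdivrMr// mulrC.
Qed.

End real_integrable.

Section strassen_energy.
Context {R : realType}.
Notation mu := (@lebesgue_measure R).
Implicit Types (f g : R -> R) (s t : R).

Lemma lebesgue_itvoc s t : s <= t -> (mu `]s, t] = (t - s)%:E)%E.
Proof.
rewrite le_eqVlt => /predU1P[->|st].
  by rewrite set_itv_ge ?measure0 ?subrr// bnd_simp ltxx.
by rewrite lebesgue_measure_itv/= lte_fin st EFinB.
Qed.

Lemma lebesgue_itvcc s t : s <= t -> (mu `[s, t] = (t - s)%:E)%E.
Proof.
rewrite le_eqVlt => /predU1P[->|st].
  by rewrite set_itv1 lebesgue_measure_set1 subrr.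
by rewrite lebesgue_measure_itv/= lte_fin st EFinB.
Qed.

Lemma Rintegral_increment g s t : 0 <= s -> s <= t ->
  mu.-integrable `[0, t] (EFin \o g) ->
  Rintegral mu `[0, t] g - Rintegral mu `[0, s] g = Rintegral mu `]s, t] g.
Proof. by move=> s0 st ig; apply: Rintegral_itvB; rewrite ?bnd_simp. Qed.

Lemma integrable_itv0 g t : t <= 1 -> mu.-integrable `[0, 1] (EFin \o g) ->
  mu.-integrable `[0, t] (EFin \o g).
Proof.
move=> t1; apply: integrableS => //.
by apply: subset_itvl; rewrite bnd_simp.
Qed.

Lemma integrable_itvoc g s t : 0 <= s -> t <= 1 -> mu.-integrable `[0, 1] (EFin \o g) ->
  mu.-integrable `]s, t] (EFin \o g).
Proof.
move=> s0 t1; apply: integrableS => //.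
by apply: subset_itv; rewrite bnd_simp.
Qed.

Lemma Rintegral_increment_sqr_le g s t :
  mu.-integrable `[0, 1] (EFin \o g) ->
  mu.-integrable `[0, 1] (EFin \o (fun u => g u ^+ 2)) ->
  0 <= s -> s <= t -> t <= 1 ->
  (Rintegral mu `[0, t] g - Rintegral mu `[0, s] g) ^+ 2 <=
  (t - s) * (Rintegral mu `[0, t] (fun u => g u ^+ 2) - Rintegral mu `[0, s] (fun u => g u ^+ 2)).
Proof.
move=> ig ig2 s0 st t1.
rewrite !Rintegral_increment//; try exact: integrable_itv0.
have -> : t - s = fine (mu `]s, t]) by rewrite lebesgue_itvoc.
have st_fin : (mu `]s, t] < +oo)%E by rewrite lebesgue_itvoc// ltry.
by apply: Rintegral_sqr_le => //; exact: integrable_itvoc.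
Qed.

Lemma Rintegral01_sqr_le g :
  mu.-integrable `[0, 1] (EFin \o g) ->
  mu.-integrable `[0, 1] (EFin \o (fun u => g u ^+ 2)) ->
  Rintegral mu `[0, 1] g ^+ 2 <= Rintegral mu `[0, 1] (fun u => g u ^+ 2).
Proof.
move=> ig ig2; have := @Rintegral_increment_sqr_le g 0 1 ig ig2 (lexx _) ler01 (lexx _).
by rewrite !set_itv1 !Rintegral_set1 !subr0 mul1r.
Qed.

(** [E] is the energy [int_0^t f'^2]. Cauchy-Schwarz on []s, t]] trades the derivative for this
    monotone function, from which the Hoelder bound and the grid inequality follow without returning
    to integrals. *)
Lemma strassen_energyP f : strassen_class f -> exists2 E : R -> R,
  [/\ E 0 = 0, E 1 <= 1 & forall s t, 0 <= s -> s <= t -> t <= 1 -> E s <= E t] &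
  forall s t, 0 <= s -> s <= t -> t <= 1 -> (f t - f s) ^+ 2 <= (t - s) * (E t - E s).
Proof.
move=> [_ [g [mg [ig [g2 fE]]]]].
have ig2 : mu.-integrable `[0, 1] (EFin \o (fun u => g u ^+ 2)).
  apply/integrableP; split.
    by apply/measurable_EFinP; exact: measurable_funX.
  apply: le_lt_trans (ltry 1); apply: le_trans g2; rewrite le_eqVlt; apply/orP; left.
  by apply/eqP; apply: eq_integral => u _ /=; rewrite ger0_norm// sqr_ge0.
exists (fun t => Rintegral mu `[0, t] (fun u => g u ^+ 2)).
  split => [||s t s0 st t1].
  - by rewrite set_itv1 Rintegral_set1.
  - rewrite /Rintegral -lee_fin fineK//; apply: integrable_fin_num => //.
  - rewrite -subr_ge0 Rintegral_increment//; last exact: integrable_itv0.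
    by apply: Rintegral_ge0 => u _; exact: sqr_ge0.
move=> s t s0 st t1; rewrite !fE ?t1 ?s0 ?(le_trans s0 st) ?(le_trans st t1)//.
exact: Rintegral_increment_sqr_le.
Qed.

Lemma strassen_holder f s t : strassen_class f -> 0 <= s <= 1 -> 0 <= t <= 1 ->
  (f t - f s) ^+ 2 <= `|t - s|.
Proof.
move=> /strassen_energyP[E [E0 E1 Em] fE] /andP[s0 s1] /andP[t0 t1].
wlog st : s t s0 s1 t0 t1 / s <= t.
  move=> H; have [st|/ltW ts] := leP s t; first exact: H.
  by rewrite -sqrrN opprB distrC; exact: H.
rewrite ger0_norm ?subr_ge0//; apply: le_trans (fE _ _ s0 st t1) _.
rewrite ler_piMr ?subr_ge0//.
have := Em _ _ (lexx 0) s0 s1; have := Em _ _ t0 t1 (lexx 1); rewrite E0; lra.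
Qed.

Lemma strassen_sqr_le f t : strassen_class f -> 0 <= t <= 1 -> f t ^+ 2 <= t.
Proof.
move=> fS t01; have := strassen_holder fS (s := 0) (t := t).
have [-> _] := fS; rewrite !subr0 lexx ler01 => /(_ isT t01).
by case/andP: t01 => t0 _; rewrite ger0_norm.
Qed.

Lemma strassen_grid f m : strassen_class f -> (0 < m)%N ->
  m%:R * (\sum_(i < m) (f (i.+1%:R / m%:R) - f (i%:R / m%:R)) ^+ 2) <= 1.
Proof.
move=> /strassen_energyP[E [E0 E1 Em] fE] m0.
have m0R : 0 < m%:R :> R by rewrite ltr0n.
apply: (@le_trans _ _ (\sum_(i < m) (E (i.+1%:R / m%:R) - E (i%:R / m%:R)))).
  rewrite mulr_sumr; apply: ler_sum => i _.
  have -> : E (i.+1%:R / m%:R) - E (i%:R / m%:R) =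
     m%:R * ((i.+1%:R / m%:R - i%:R / m%:R) * (E (i.+1%:R / m%:R) - E (i%:R / m%:R))).
    by rewrite -mulrBl -natrB// subSnn mul1r mulVKf// gt_eqF.
  rewrite ler_pM2l//; apply: fE; first by rewrite divr_ge0.
    by rewrite ler_pM2r ?invr_gt0// ler_nat.
  by rewrite ler_pdivrMr// mul1r ler_nat.
rewrite -(big_mkord xpredT (fun i => E (i.+1%:R / m%:R) - E (i%:R / m%:R))).
rewrite telescope_sumr// divff ?gt_eqF// mul0r E0 subr0//.
Qed.

End strassen_energy.

(** * Step functions on uniform grids *)

Section step_functions.
Context {R : realType}.
Notation mu := (@lebesgue_measure R).
Implicit Types (phi : nat -> R) (u : R).

(** At [u = 1] the value is [phi M], which belongs to no cell of [[0, 1[]: integrals do not see it,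
    pointwise bounds do. *)
Definition stepf M phi u : R := phi (Num.truncn (M%:R * u)).

Lemma measurable_stepf M phi : measurable_fun setT (stepf M phi).
Proof.
move=> _ B mB; rewrite setTI.
have le_meas n : measurable [set u : R | (Num.truncn (M%:R * u) <= n)%N].
  have -> : [set u : R | (Num.truncn (M%:R * u) <= n)%N] =
      ( *%R M%:R : R -> R) @^-1` `]-oo, n.+1%:R[%classic.
    by apply/seteqP; split => u /=; rewrite in_itv/= truncn_le_nat.
  rewrite -[X in measurable X]setTI.
  by apply: (measurable_funM (f := cst M%:R) (g := id)).
have -> : stepf M phi @^-1` B =
    \bigcup_(i in [set i | B (phi i)]) [set u | Num.truncn (M%:R * u) = i].
  apply/seteqP; split => [u Bu|u [i Bi /= ui]]; first by exists (Num.truncn (M%:R * u)).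
  by rewrite /= /stepf ui.
apply: bigcup_measurable => -[_|i _].
  rewrite [X in measurable X](_ : _ = [set u : R | (Num.truncn (M%:R * u) <= 0)%N])//.
  by apply/seteqP; split => u /=; rewrite leqn0 => /eqP.
rewrite [X in measurable X](_ : _ = [set u : R | (Num.truncn (M%:R * u) <= i.+1)%N] `\`
    [set u : R | (Num.truncn (M%:R * u) <= i)%N]); first exact: measurableD.
apply/seteqP; split => u /=; first by move=> ->; rewrite leqnn ltnn.
by move=> [h1 /negP]; rewrite -ltnNge => h2; apply/eqP; rewrite eqn_leq h1.
Qed.

Lemma truncn_muln (d : nat) u : (0 < d)%N -> 0 <= u ->
  Num.truncn u = (Num.truncn (u * d%:R) %/ d)%N.
Proof.
move=> d0 u0; have d0R : 0 < d%:R :> R by rewrite ltr0n.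
have ud0 : 0 <= u * d%:R by rewrite mulr_ge0// ltW.
apply/eqP; rewrite truncn_eq//; apply/andP; split.
  rewrite -(ler_pM2r d0R) -natrM -truncn_ge_nat//.
  exact: leq_divM.
by rewrite -(ltr_pM2r d0R) -natrM -truncn_lt_nat// -ltn_divLR.
Qed.

Lemma stepf_refine M d phi u : (0 < d)%N -> 0 <= u ->
  stepf M phi u = stepf (M * d) (fun i => phi (i %/ d)%N) u.
Proof.
move=> d0 u0; rewrite /stepf (truncn_muln d0) ?mulr_ge0//.
by rewrite natrM mulrAC.
Qed.

Lemma stepf_cell M phi i u : (0 < M)%N -> i%:R / M%:R <= u < i.+1%:R / M%:R ->
  stepf M phi u = phi i.
Proof.
move=> M0; have M0R : 0 < M%:R :> R by rewrite ltr0n.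
rewrite ler_pdivrMr// ltr_pdivlMr// => iu; rewrite /stepf (@truncn_def _ _ i)//.
by rewrite mulrC.
Qed.

Lemma integrable_stepf M phi t : t <= 1 -> mu.-integrable `[0, t] (EFin \o stepf M phi).
Proof.
move=> t1; pose c : R := \sum_(i < M.+1) `|phi i|.
have fin_t : (mu `[0%R, t] < +oo)%E.
  have [t0|t0] := leP 0 t; first by rewrite lebesgue_itvcc// ltry.
  by rewrite set_itv_ge ?measure0// bnd_simp -ltNge.
apply: (@integrable_real_bounded _ _ _ _ _ _ _ c) => //.
- by apply: measurable_funTS; exact: measurable_stepf.
- move=> u /=; rewrite in_itv/= => /andP[u0 ut]; rewrite /stepf.
  have uM : (Num.truncn (M%:R * u) < M.+1)%N.
    rewrite truncn_lt_nat ?mulr_ge0//.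
    rewrite (@le_lt_trans _ _ M%:R) ?ltr_nat// ler_piMr// (le_trans ut)//.
  by rewrite /c (bigD1 (Ordinal uM))//= lerDl sumr_ge0.
Qed.

Lemma Rintegral_stepf M phi k : (0 < M)%N -> (k <= M)%N ->
  Rintegral mu `[0, k%:R / M%:R] (stepf M phi) = M%:R^-1 * \sum_(i < k) phi i.
Proof.
move=> M0; have M0R : 0 < M%:R :> R by rewrite ltr0n.
elim: k => [_|k IH kM]; first by rewrite mul0r set_itv1 Rintegral_set1 big_ord0 mulr0.
have k1 : k.+1%:R / M%:R <= 1 :> R by rewrite ler_pdivrMr// mul1r ler_nat.
have kk : k%:R / M%:R <= k.+1%:R / M%:R :> R by rewrite ler_pM2r ?invr_gt0// ler_nat.
have k0 : 0 <= k%:R / M%:R :> R by rewrite divr_ge0.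
rewrite big_ord_recr/= mulrDr -IH ?(ltnW kM)//.
apply/eqP; rewrite addrC -subr_eq; apply/eqP.
rewrite Rintegral_increment//; last exact: integrable_stepf.
have ioc : mu.-integrable `]k%:R / M%:R, k.+1%:R / M%:R] (EFin \o stepf M phi).
  by apply: integrable_itvoc => //; exact: integrable_stepf.
rewrite -Rintegral_itv_bndo_bndc; last first.
  by apply: integrableS ioc => //; apply: subset_itvl; rewrite bnd_simp.
transitivity (Rintegral mu `]k%:R / M%:R, k.+1%:R / M%:R[ (cst (phi k))).
  apply: eq_Rintegral => u; rewrite inE/= in_itv/= => /andP[ku uk].
  by apply: stepf_cell => //; rewrite (ltW ku).
rewrite Rintegral_cst//= mulrC; congr (_ * _).
rewrite lebesgue_measure_itv/= lte_fin ltr_pM2r ?invr_gt0// ltr_nat ltnSn.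
by rewrite -EFinB/= -mulrBl -natrB// subSnn mul1r.
Qed.

End step_functions.

(** * Riesz' criterion through dyadic difference quotients *)

Section riesz.
Context {R : realType}.
Notation mu := (@lebesgue_measure R).

Definition ucont01 (f : R -> R) : Prop := forall e : R, 0 < e -> exists2 de : R, 0 < de &
  forall s t, 0 <= s <= 1 -> 0 <= t <= 1 -> `|s - t| <= de -> `|f s - f t| <= e.

Variable f : R -> R.

(** [en p] is the squared norm of [G p] in [L^2[0, 1]], equivalently [2 ^ p] times the sum of the
    squared increments of [f]; so [en p <= 1] is the grid inequality for [m = 2 ^ p]. *)
Let dq p i : R := (2 ^ p)%:R * (f (i.+1%:R / (2 ^ p)%:R) - f (i%:R / (2 ^ p)%:R)).
Let G p : R -> R := stepf (2 ^ p) (dq p).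
Let en p : R := (2 ^ p)%:R^-1 * \sum_(i < 2 ^ p) dq p i ^+ 2.

Let pow2_gt0 p : 0 < (2 ^ p)%:R :> R. Proof. by rewrite ltr0n expn_gt0. Qed.

Lemma dq_block_sum p d j :
  \sum_(l < 2 ^ d) dq (p + d) (j * 2 ^ d + l)%N = (2 ^ d)%:R * dq p j.
Proof.
rewrite /dq -mulr_sumr.
under eq_bigr => l _ do rewrite -addnS.
rewrite -(big_mkord xpredT (fun l => f ((j * 2 ^ d + l.+1)%N%:R / (2 ^ (p + d))%:R) -
   f ((j * 2 ^ d + l)%N%:R / (2 ^ (p + d))%:R))) telescope_sumr// addn0 -mulSnr.
have d0 := pow2_gt0 d; have p0 := pow2_gt0 p.
have E i : (i * 2 ^ d)%N%:R / (2 ^ (p + d))%:R = i%:R / (2 ^ p)%:R :> R.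
  by rewrite expnD !natrM; field; rewrite !gt_eqF.
by rewrite !E expnD natrM mulrA [(2 ^ d)%:R * _]mulrC.
Qed.

(* The difference quotients on the dyadic grids form a martingale, so their
   increments are orthogonal. *)
Lemma dq_orthogonal p d :
  (2 ^ (p + d))%:R^-1 * \sum_(i < 2 ^ (p + d)) (dq (p + d) i - dq p (i %/ 2 ^ d)%N) ^+ 2
  = en (p + d) - en p.
Proof.
rewrite /en; have d0 := pow2_gt0 d; have p0 := pow2_gt0 p.
have -> : \sum_(i < 2 ^ (p + d)) (dq (p + d) i - dq p (i %/ 2 ^ d)%N) ^+ 2 =
    \sum_(i < 2 ^ (p + d)) dq (p + d) i ^+ 2 - (2 ^ d)%:R * \sum_(j < 2 ^ p) dq p j ^+ 2.
  rewrite expnD (big_nat_blocks _ _ _ (fun i => (dq (p + d) i - dq p (i %/ 2 ^ d)%N) ^+ 2)).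
  rewrite (big_nat_blocks _ _ _ (fun i => dq (p + d) i ^+ 2)).
  rewrite mulr_sumr -sumrB; apply: eq_bigr => j _.
  transitivity (\sum_(l < 2 ^ d) (dq (p + d) (j * 2 ^ d + l)%N ^+ 2 -
      (2 * dq p j * dq (p + d) (j * 2 ^ d + l)%N - dq p j ^+ 2))).
    apply: eq_bigr => l _; rewrite divnMDl ?expn_gt0// divn_small// addn0; ring.
  rewrite sumrB sumrB -mulr_sumr dq_block_sum sumr_const card_ord -[dq p j ^+ 2 *+ _]mulr_natl /=.
  by move: ((2 ^ d)%:R) => x; ring.
rewrite mulrBr; congr (_ - _); rewrite mulrA expnD natrM; congr (_ * _).
by field; rewrite !gt_eqF.
Qed.

Hypothesis en1 : forall p, en p <= 1.

Lemma en_le p q : (p <= q)%N -> en p <= en q.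
Proof.
move=> /subnKC <-; rewrite -subr_ge0 -dq_orthogonal mulr_ge0 ?invr_ge0// sumr_ge0// => i _.
exact: sqr_ge0.
Qed.

(** By orthogonality [en] increases, and being bounded it converges; a fast subsequence has [L^2]
    distances of order [2^(-k)], enough for almost everywhere convergence. *)
Lemma en_fast_subseq : exists P : nat -> nat,
  [/\ forall k, (k <= P k)%N, forall k, (P k <= P k.+1)%N &
      forall k q, (P k <= q)%N -> en q - en (P k) <= (2^-1 ^+ k) ^+ 2].
Proof.
have cen : cvgn en.
  apply: nondecreasing_is_cvgn; first by move=> p q pq; exact: en_le.
  by exists 1 => _ [p _ <-].
have enl p : en p <= limn en.
  by apply: nondecreasing_cvgn_le => // q r qr; exact: en_le.
have /choice[Q HQ] : forall k, exists Q, limn en - en Q <= (2^-1 ^+ k) ^+ 2.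
  move=> k; have e0 : 0 < (2^-1 ^+ k : R) ^+ 2 by rewrite !exprn_gt0.
  have /cvgrPdist_le/(_ _ e0)[N _ /(_ N (leqnn N))] := cen.
  by rewrite /= => /(le_trans (ler_norm _)) ?; exists N.
(* Summing the ranks plus one makes [P] increasing, at least [k] and at least [Q k] at once. *)
pose P k := (\sum_(i < k.+1) (Q i).+1)%N.
have QP k : (Q k <= P k)%N by rewrite /P big_ord_recr/= (leq_trans (leqnSn _))// leq_addl.
exists P; split.
- elim=> // k IH; rewrite /P big_ord_recr/= -/(P k) addnS ltnS (leq_trans IH)//.
  exact: leq_addr.
- by move=> k; rewrite /P [X in (_ <= X)%N]big_ord_recr/= leq_addr.
- move=> k q kq; apply: le_trans (HQ k); rewrite lerB//.
  exact: en_le.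
Qed.

Lemma Rintegral_stepf01 M phi : (0 < M)%N ->
  Rintegral mu `[0, 1] (stepf M phi) = M%:R^-1 * \sum_(i < M) phi i.
Proof.
by move=> M0; rewrite -Rintegral_stepf// divff// pnatr_eq0 -lt0n.
Qed.

Lemma integrable_G p : mu.-integrable `[0, 1] (EFin \o G p).
Proof. exact: integrable_stepf. Qed.

Lemma integrable_G_sqr p : mu.-integrable `[0, 1] (EFin \o (fun u => G p u ^+ 2)).
Proof. exact: (@integrable_stepf _ _ (fun i => dq p i ^+ 2)). Qed.

Lemma Rintegral_G_sqr p : Rintegral mu `[0, 1] (fun u => G p u ^+ 2) = en p.
Proof.
by rewrite (@Rintegral_stepf01 _ (fun i => dq p i ^+ 2))// expn_gt0.
Qed.

Lemma Rintegral_G_dist p q : (p <= q)%N ->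
  Rintegral mu `[0, 1] (fun u => `|G q u - G p u|) ^+ 2 <= en q - en p.
Proof.
move=> /subnKC <-; move: (q - p)%N => {q} d; set q := (p + d)%N.
pose phi i := dq q i - dq p (i %/ 2 ^ d)%N.
have GE u : 0 <= u -> G q u - G p u = stepf (2 ^ q) phi u.
  move=> u0; rewrite /G (@stepf_refine _ (2 ^ p) (2 ^ d))// ?expn_gt0//.
  by rewrite -expnD.
have -> : Rintegral mu `[0, 1] (fun u => `|G q u - G p u|) =
    Rintegral mu `[0, 1] (stepf (2 ^ q) (fun i => `|phi i|)).
  by apply: eq_Rintegral => u; rewrite inE/= in_itv/= => /andP[u0 _]; rewrite GE.
apply: le_trans (Rintegral01_sqr_le _ _) _.
- exact: integrable_stepf.
- exact: (@integrable_stepf _ _ (fun i => `|phi i| ^+ 2)).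
rewrite (@Rintegral_stepf01 _ (fun i => `|phi i| ^+ 2)) ?expn_gt0//.
rewrite -dq_orthogonal ler_wpM2l ?invr_ge0//; apply: ler_sum => i _.
by rewrite real_normK ?num_real.
Qed.

Let aeF : Filter (almost_everywhere mu) := ae_filter_ringOfSetsType mu.

(** As in the completeness of [L^1]: the series [H] of the [|G (P k.+1) - G (P k)|] has integral at
    most 2, hence is finite almost everywhere. There [G (P k)] converges, and [|G (P 0)| + H]
    dominates, so the primitives converge too. *)
Lemma riesz_density : exists2 g : R -> R,
  measurable_fun `[(0 : R), 1] g & exists P : nat -> nat,
  [/\ forall k, (k <= P k)%N,
      {ae mu, forall u : R, `[(0 : R), 1]%classic u -> G (P k) u @[k --> \oo] --> g u},
      mu.-integrable `[0, 1] (EFin \o g) &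
      forall t, 0 <= t <= 1 ->
        Rintegral mu `[0, t] (G (P k)) @[k --> \oo] --> Rintegral mu `[0, t] g].
Proof.
have [P [kP PS Pen]] := en_fast_subseq.
pose h k u : R := `|G (P k.+1) u - G (P k) u|.
have ih k : mu.-integrable `[0, 1] (EFin \o h k).
  by apply: integrable_real_norm; apply: integrable_realB => //; exact: integrable_G.
have mh k : measurable_fun `[(0 : R), 1] (EFin \o h k) by case/integrableP : (ih k).
have hle k : Rintegral mu `[0, 1] (h k) <= 2^-1 ^+ k.
  rewrite -(@ler_pXn2r _ 2)// ?nnegrE ?exprn_ge0//; last exact: Rintegral_ge0.
  by apply: le_trans (Rintegral_G_dist (PS k)) _; apply: Pen.
pose H u := (\sum_(0 <= k <oo) (h k u)%:E)%E.
have mH : measurable_fun `[(0 : R), 1] H.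
  have hp k (u : R) : `[(0 : R), 1]%classic u -> xpredT k -> (0 <= (EFin \o h k) u)%E.
    by move=> _ _; rewrite lee_fin; exact: normr_ge0.
  exact: (ge0_emeasurable_sum hp (fun k _ => mh k)).
have H0 u : (0 <= H u)%E by apply: nneseries_ge0 => k _ _; rewrite lee_fin; exact: normr_ge0.
have iH : mu.-integrable `[0, 1] H.
  apply/integrableP; split => //.
  under eq_integral do rewrite gee0_abs//.
  rewrite integral_nneseries//; last by move=> k u _; rewrite lee_fin; exact: normr_ge0.
  apply: (@le_lt_trans _ _ 2%:E); last exact: ltry.
  apply: lime_le.
    by apply: is_cvg_nneseries => k _ _; apply: integral_ge0 => u _; rewrite lee_fin; exact: normr_ge0.
  apply: nearW => n /=.
  apply: (@le_trans _ _ (\sum_(0 <= k < n) (2^-1 ^+ k)%:E)%E).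
    apply: lee_sum => k _.
    by rewrite -EFin_Rintegral// lee_fin.
  rewrite sumEFin lee_fin big_mkord; case: n => [|n]; first by rewrite big_ord0.
  have := @sum_geo_half_le R n; rewrite (reindex_inj rev_ord_inj)/=.
  by under eq_bigr => i _ do rewrite subSS subKn -1?ltnS//.
have partial u n : ((\sum_(k < n) h k u)%:E <= H u)%E.
  rewrite -sumEFin -(big_mkord xpredT (fun k => (h k u)%:E)).
  by apply: nneseries_lim_ge => k _ _; rewrite lee_fin; exact: normr_ge0.
have GP u n : G (P n) u = G (P 0%N) u + \sum_(k < n) (G (P k.+1) u - G (P k) u).
  rewrite -(big_mkord xpredT (fun k => G (P k.+1) u - G (P k) u)) telescope_sumr//.
  by rewrite addrC subrK.
have Gcvg u : H u \is a fin_num -> cvgn (fun k => G (P k) u).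
  move=> Hfin.
  suff : cvgn (series (fun k => G (P k.+1) u - G (P k) u)).
    move=> c; rewrite (_ : (fun k => G (P k) u) = (fun n => G (P 0%N) u +
      series (fun k => G (P k.+1) u - G (P k) u) n)); last first.
      by apply/funext => n; rewrite GP /series/= big_mkord.
    by apply: is_cvgD => //; exact: is_cvg_cst.
  apply: (@normed_cvg _ R^o); apply: nondecreasing_is_cvgn.
    by move=> n m nm; rewrite /series/= [leRHS](big_cat_nat (n := n))//= lerDl sumr_ge0.
  exists (fine (H u)) => _ [n _ <-]; rewrite -lee_fin fineK//.
  by apply: le_trans (partial u n); rewrite lee_fin -(big_mkord xpredT (fun k => h k u)).
(* The upper limit is defined everywhere, also where [G (P k)] may diverge, and it is measurable. *)
pose g u := fine (limn_esup (fun k => (G (P k) u)%:E)).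
have mG k : measurable_fun `[(0 : R), 1] (fun u => (G k u)%:E).
  by case/integrableP : (integrable_G k).
have mg : measurable_fun `[(0 : R), 1] g.
  by apply: measurableT_comp => //; apply: measurable_fun_limn_esup.
have ae_cvg : {ae mu, forall u : R, `[(0 : R), 1]%classic u -> G (P k) u @[k --> \oo] --> g u}.
  have Hae : {ae mu, forall u : R, `[(0 : R), 1]%classic u -> H u \is a fin_num}.
    exact: integrable_ae iH.
  apply: (@filterS _ _ aeF _ _ _ Hae) => u Hu u01.
  have /cvg_ex[l Gl] := Gcvg u (Hu u01).
  suff -> : g u = l by [].
  have : (G (P k) u)%:E @[k --> \oo] --> l%:E by apply: cvg_EFin => //; exact: nearW.
  by move=> /cvg_limn_einf_sup[_]; rewrite /g => ->.
pose dom u := (`|G (P 0%N) u|%:E + H u)%E.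
have idom : mu.-integrable `[0, 1] dom.
  apply: integrableD => //; apply: integrable_real_norm; exact: integrable_G.
have Gdom k u : (`|(G (P k) u)%:E| <= dom u)%E.
  rewrite /dom GP; apply: (@le_trans _ _ (`|G (P 0%N) u|%:E + (\sum_(i < k) h i u)%:E)%E).
    by rewrite -EFinD lee_fin (le_trans (ler_normD _ _))// lerD2l ler_norm_sum.
  by rewrite leeD2l.
have DC t : t <= 1 -> [/\ mu.-integrable `[0, t] (EFin \o g),
    [sequence (\int[mu]_(x in `[0%R, t]) `|(G (P n) x)%:E - (g x)%:E|)%E]_n @ \oo --> 0%E
  & [sequence (\int[mu]_(x in `[0%R, t]) (G (P n) x)%:E)%E]_n @ \oo
     --> (\int[mu]_(x in `[0%R, t]) (g x)%:E)%E].
  move=> t1; have sub : `[0, t] `<=` (`[0, 1] : set R) by apply: subset_itvl; rewrite bnd_simp.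
  apply: (@dominated_convergence _ _ _ mu _ _
    (fun n u => (G (P n) u)%:E) (EFin \o g) dom) => //.
  - by move=> n; apply: measurable_funS (mG (P n)).
  - by apply/measurable_EFinP; apply: measurable_funS mg.
  - apply: (@filterS _ _ aeF _ _ _ ae_cvg) => u Hu /sub u01; apply: cvg_EFin; first exact: nearW.
    exact: Hu.
  - exact: integrableS idom.
  - by apply: (@nearW _ _ _ aeF) => u n _; exact: Gdom.
exists g => //; exists P; split => //; first by case: (DC 1 (lexx _)).
move=> t /andP[t0 t1]; have [ig _ lim] := DC t t1.
rewrite [X in _ --> X](_ : _ = fine (\int[mu]_(x in `[0%R, t]) (g x)%:E)%E)//.
apply: (@fine_cvg _ _ _ _ (fun k => \int[mu]_(x in `[0%R, t]) (G (P k) x)%:E)%E).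
by rewrite -EFin_Rintegral in lim *.
Qed.

(** The primitive of [G p] agrees with [f] at the points [i / 2 ^ p]. From there to [t] it moves by
    at most [2^(-p/2)], by Cauchy-Schwarz and [en p <= 1], while [f] moves little by uniform
    continuity. *)
Lemma G_primitive_cvg t : f 0 = 0 -> ucont01 f -> 0 <= t <= 1 ->
  Rintegral mu `[0, t] (G p) @[p --> \oo] --> f t.
Proof.
move=> f0 cf /andP[t0 t1]; apply/cvgrPdist_le => e e0.
have e20 : 0 < e / 2 by rewrite divr_gt0.
have [de de0 fde] := cf _ e20.
have ed0 : 0 < Num.min de ((e / 2) ^+ 2) by rewrite lt_min de0 exprn_gt0.
have [r hr] := @ler_exp_small R 2^-1 _ ltac:(lra) ed0.
exists r => // p /= rp.
set M := (2 ^ p)%N; have M0 : (0 < M)%N by rewrite expn_gt0.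
have M0R : 0 < M%:R :> R by rewrite ltr0n.
have Msmall : M%:R^-1 <= Num.min de ((e / 2) ^+ 2).
  apply: le_trans hr; rewrite /M natrX -exprVn ler_wiXn2l// ?invr_ge0// invf_le1//.
  by rewrite ler1n.
have {Msmall} [Mde Me] : M%:R^-1 <= de /\ M%:R^-1 <= (e / 2) ^+ 2.
  by move: Msmall; rewrite le_min => /andP[].
pose i := Num.truncn (M%:R * t); pose s : R := i%:R / M%:R.
have /andP[it ti] : i%:R <= M%:R * t < i.+1%:R by rewrite truncn_itv// mulr_ge0// ltW.
have st : s <= t by rewrite ler_pdivrMr// mulrC.
have s0 : 0 <= s by rewrite divr_ge0.
have ts : t - s <= M%:R^-1.
  rewrite lerBlDr -[X in X + _]mul1r -mulrDl ler_pdivlMr// mulrC ltW// (lt_le_trans ti)//.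
  by rewrite -natr1 addrC.
have iM : (i <= M)%N by rewrite -(ler_nat R) (le_trans it)// ler_piMr// ltW.
have fs : Rintegral mu `[0, s] (G p) = f s.
  rewrite Rintegral_stepf// -mulr_sumr mulrA mulVf ?gt_eqF// mul1r.
  rewrite -(big_mkord xpredT (fun j => f (j.+1%:R / M%:R) - f (j%:R / M%:R))) telescope_sumr//.
  by rewrite mul0r f0 subr0.
have inc : (Rintegral mu `[0, t] (G p) - Rintegral mu `[0, s] (G p)) ^+ 2 <= (e / 2) ^+ 2.
  apply: le_trans (Rintegral_increment_sqr_le (integrable_G p) (integrable_G_sqr p) s0 st t1) _.
  apply: le_trans Me; apply: le_trans ts; rewrite ler_piMr ?subr_ge0//.
  apply: le_trans (en1 p); rewrite -Rintegral_G_sqr lerBlDr ler_wpDr//.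
    by apply: Rintegral_ge0 => u _; exact: sqr_ge0.
  rewrite -subr_ge0 Rintegral_increment//; last exact: integrable_G_sqr.
  by apply: Rintegral_ge0 => u _; exact: sqr_ge0.
have : `|Rintegral mu `[0, t] (G p) - f s| <= e / 2.
  by rewrite -(@ler_pXn2r _ 2)// ?nnegrE ?(ltW e20)// real_normK ?num_real// -fs.
have : `|f t - f s| <= e / 2.
  by apply: fde; rewrite ?t0 ?t1 ?s0 ?(le_trans st t1)// ger0_norm ?subr_ge0// (le_trans ts).
move: (Rintegral _ _ _) => I; rewrite !ler_norml => /andP[? ?] /andP[? ?].
by apply/andP; split; lra.
Qed.

(** The density is the almost everywhere limit of the [G (P k)], and Fatou's lemma passes
    [en (P k) <= 1] on to it. *)
Lemma riesz_strassen : f 0 = 0 -> ucont01 f -> strassen_class f.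
Proof.
move=> f0 cf; split => //.
have [g mg [P [kP ae_cvg ig Icvg]]] := riesz_density.
exists g; split => //; split => //; split; last first.
  move=> t t01; apply/esym; apply: cvg_unique (Icvg t t01) _ => //.
  apply: (@cvg_comp _ _ _ P (fun p => Rintegral mu `[0, t] (G p)) _ \oo).
    by move=> A [N _ NA]; exists N => // k /= Nk; apply: NA => /=; exact: leq_trans (kP k).
  exact: G_primitive_cvg.
have mG2 k : measurable_fun `[(0 : R), 1] (fun u => (G (P k) u ^+ 2)%:E).
  by case/integrableP : (integrable_G_sqr (P k)).
apply: (@le_trans _ _ (\int[mu]_(u in `[0%R, 1%R]) limn_einf (fun k => (G (P k) u ^+ 2)%:E))%E).
  rewrite le_eqVlt; apply/orP; left; apply/eqP; apply: ae_eq_integral => //.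
  - by apply/measurable_EFinP; exact: measurable_funX.
  - have -> : (fun u => limn_einf (fun k => (G (P k) u ^+ 2)%:E)) =
        (fun u => - limn_esup (fun k => - (G (P k) u ^+ 2)%:E))%E.
      apply/funext => u; rewrite -[in LHS](oppeK (limn_einf _)) -limn_esupN; congr oppe.
    apply: measurableT_comp => //; apply: measurable_fun_limn_esup => k.
    apply: measurableT_comp; [exact: oppe_measurable|exact: mG2].
  - apply: (@filterS _ _ aeF _ _ _ ae_cvg) => u Hu u01.
    have : (G (P k) u ^+ 2)%:E @[k --> \oo] --> (g u ^+ 2)%:E.
      apply: cvg_EFin; first exact: nearW.
      by rewrite expr2; under eq_fun do rewrite /= expr2; apply: cvgM; exact: Hu.
    by move=> /cvg_limn_einf_sup[->].
have G20 n (u : R) : `[(0 : R), 1]%classic u -> (0 <= (G (P n) u ^+ 2)%:E)%E.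
  by move=> _; rewrite lee_fin sqr_ge0.
apply: (le_trans (fatou mu (measurable_itv _) mG2 G20)).
have le1 k : (\int[mu]_(u in `[0%R, 1%R]) (G (P k) u ^+ 2)%:E <= 1)%E.
  by rewrite -EFin_Rintegral ?Rintegral_G_sqr ?lee_fin//; exact: integrable_G_sqr.
rewrite limn_einf_lim; apply: lime_le; first exact: is_cvg_einfs.
apply: nearW => n; apply: le_trans (le1 n); apply: ereal_inf_lbound.
by exists n => /=.
Qed.

End riesz.

(** * The functional [int_0^x f(u)/u du] and its approximating sums *)

Section log_integral.
Context {R : realType}.
Notation mu := (@lebesgue_measure R).

Lemma FTC2_pos (F f : R -> R) (a b : R) : 0 < a -> a <= b ->
  (forall x : R, 0 < x -> is_derive x 1 F (f x)) ->
  (forall x : R, 0 < x -> {for x, continuous f}) ->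
  (\int[mu]_(x in `[a, b]) (f x)%:E = (F b - F a)%:E)%E.
Proof.
move=> a0; rewrite le_eqVlt => /predU1P[<-|ab] dF cf.
  by rewrite set_itv1 integral_set1 subrr.
have pos x : x \in `[a, b] -> 0 < x by rewrite in_itv/= => /andP[ax _]; exact: lt_le_trans ax.
have posoo x : x \in `]a, b[ -> 0 < x by rewrite in_itv/= => /andP[ax _]; exact: lt_trans ax.
have cF x : 0 < x -> {for x, continuous F}.
  move=> /dF dFx; apply: differentiable_continuous; apply/derivable1_diffP.
  by case: dFx.
rewrite (@continuous_FTC2 _ f F)//.
- apply: continuous_in_subspaceT => x; rewrite inE/= => xab; apply: cf; exact: pos.
- split => [x xab||].
  + by case: (dF x (posoo x xab)).
  + by apply: cvg_at_right_filter; apply: cF.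
  + by apply: cvg_at_left_filter; apply: cF; exact: lt_trans ab.
- by move=> x xab; rewrite derive1E; case: (dF x (posoo x xab)).
Qed.

Lemma measurable_invsqrt : measurable_fun [set: R] (fun u : R => u `^ (- 2^-1)).
Proof. exact: measurable_powR. Qed.

Lemma bigcup_itv_inv1 : \bigcup_n `[(n.+1%:R^-1 : R), 1]%classic = `]0, 1]%classic.
Proof.
apply/seteqP; split => [x [n _]|x] /=; rewrite !in_itv/=.
  by move=> /andP[nx ->]; rewrite andbT (lt_le_trans _ nx)// invr_gt0.
move=> /andP[x0 x1]; exists (Num.truncn x^-1) => //=; rewrite in_itv/= x1 andbT.
by rewrite -[leRHS]invrK lef_pV2 ?posrE ?invr_gt0// ltW// truncnS_gt.
Qed.

Lemma integrable_invsqrt : mu.-integrable `[0, 1] (EFin \o (fun u : R => u `^ (- 2^-1))).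
Proof.
pose g (u : R) : R := u `^ (- 2^-1).
have mg (D : set R) : measurable_fun D (EFin \o g).
  by apply/measurable_EFinP/measurable_funTS; exact: measurable_invsqrt.
have g0 (u : R) : 0 <= g u by exact: powR_ge0.
apply/integrableP; split; first exact: mg.
under eq_integral do rewrite /= ger0_norm ?powR_ge0//.
rewrite -(@integral_itv_obnd_cbnd _ _ _ (EFin \o g)); last exact: mg.
rewrite -bigcup_itv_inv1.
have nd : nondecreasing_seq (fun n => `[(n.+1%:R^-1 : R), 1]%classic).
  move=> m n mn; apply/subsetPset; apply: subset_itvr.
  by rewrite bnd_simp lef_pV2 ?posrE ?ltr0n// ler_nat.
have lim : (\int[mu]_(x in `[(n.+1%:R^-1)%R, 1%R]) (g x)%:E)%E @[n --> \oo] -->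
    (\int[mu]_(x in \bigcup_n `[(n.+1%:R^-1)%R : R, 1%R]%classic) (g x)%:E)%E.
  apply: ge0_nondecreasing_set_cvg_integral => //.
    by move=> n; have := mg `[(n.+1%:R^-1 : R), 1]%classic.
  by move=> n x _; rewrite lee_fin.
apply: (@le_lt_trans _ _ 2%:E); last exact: ltry.
rewrite -(cvg_lim _ lim)//; apply: lime_le; first by apply/cvg_ex; eexists; exact: lim.
apply: nearW => n /=.
have dF (x : R) : 0 < x -> is_derive x 1 (fun u : R => 2 * u `^ 2^-1) (g x).
  move=> x0; have -> : g x = 2 * (2^-1 * x `^ (2^-1 - 1)).
    by rewrite /g mulrA divff// mul1r; congr (_ `^ _); lra.
  exact: is_deriveZ (is_derive1_powR 2^-1 x0).
have cg (x : R) : 0 < x -> {for x, continuous g}.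
  move=> x0; apply: differentiable_continuous; apply/derivable1_diffP.
  by case: (is_derive1_powR (- 2^-1) x0).
rewrite (FTC2_pos _ _ dF cg) ?invr_gt0//.
  by rewrite lee_fin powR1; have := powR_ge0 (n.+1%:R^-1 : R) 2^-1; lra.
by rewrite invf_le1// ler1n.
Qed.

Lemma strassen_ratio_le (f : R -> R) (u : R) : strassen_class f -> 0 <= u <= 1 ->
  `|f u / u| <= u `^ (- 2^-1).
Proof.
move=> fS /andP[]; rewrite le_eqVlt => /predU1P[<- _|u0 u1].
  by rewrite invr0 mulr0 normr0 powR_ge0.
have u01 : 0 <= u <= 1 by rewrite ltW.
rewrite powRN powR12_sqrt ?(ltW u0)//.
have s0 : 0 < Num.sqrt u by rewrite sqrtr_gt0.
rewrite normrM normfV [`|u|]gtr0_norm// ler_pdivrMr//.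
rewrite -[X in _ <= _ * X](sqr_sqrtr (ltW u0)) expr2 mulKf ?gt_eqF//.
rewrite -(@ler_pXn2r _ 2)// ?nnegrE ?(ltW s0)// real_normK ?num_real// sqr_sqrtr ?(ltW u0)//.
exact: strassen_sqr_le.
Qed.

Lemma strassen_cvg_right (f : R -> R) (w : nat -> R) (u : R) : strassen_class f -> 0 <= u <= 1 ->
  (forall n, 0 <= w n <= 1) -> w @ \oo --> u -> f (w n) @[n --> \oo] --> f u.
Proof.
move=> fS u01 w01 wu; apply/cvgrPdist_le => e e0.
have e20 : 0 < e ^+ 2 by rewrite exprn_gt0.
have /cvgrPdist_le/(_ _ e20) := wu; apply: filterS => n wn.
rewrite -(@ler_pXn2r _ 2)// ?nnegrE ?(ltW e0)// real_normK ?num_real//.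
exact: le_trans (strassen_holder fS (w01 n) u01) wn.
Qed.

Lemma cvg_truncn_ratio (N : nat -> nat) (u : R) : 0 <= u ->
  (forall M, \forall j \near \oo, (M <= N j)%N) ->
  (Num.truncn ((N j)%:R * u))%:R / (N j)%:R @[j --> \oo] --> u.
Proof.
move=> u0 Noo; apply/cvgrPdist_le => e e0.
near=> j.
have Nj : ((Num.truncn e^-1).+1 <= N j)%N by near: j; exact: Noo.
have N0 : 0 < (N j)%:R :> R by rewrite ltr0n (leq_trans _ Nj).
have Ne : (N j)%:R^-1 <= e.
  rewrite -[leRHS]invrK lef_pV2 ?posrE ?invr_gt0//.
  by rewrite (le_trans (ltW (truncnS_gt _)))// ler_nat.
have Nu0 : 0 <= (N j)%:R * u by rewrite mulr_ge0// ltW.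
have /andP[h1 h2] := truncn_itv Nu0.
set k := Num.truncn _ in h1 h2 *.
have -> : u - k%:R / (N j)%:R = ((N j)%:R * u - k%:R) / (N j)%:R.
  by rewrite mulrBl mulrAC divff ?gt_eqF// mul1r.
rewrite ger0_norm ?divr_ge0 ?subr_ge0 ?(ltW N0)//.
apply: le_trans Ne; rewrite ler_pdivrMr// mulVf ?gt_eqF// lerBlDr.
by rewrite addrC natr1 ltW.
Unshelve. all: by end_near. Qed.

(** The class says nothing of [f] outside [[0, 1]], so [f u / u] is obtained as a pointwise limit of
    step functions sampled inside. At [u = 0] all of them vanish, the inverse of 0 being 0. *)
Lemma measurable_strassen_ratio (f : R -> R) : strassen_class f ->
  measurable_fun `[(0 : R), 1] (fun u => f u / u).
Proof.
move=> fS.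
apply: (@measurable_fun_cvg _ _ _ _
   (fun n => stepf n.+1 (fun i => f (i%:R / n.+1%:R) / (i%:R / n.+1%:R)))).
  by move=> n; apply: measurable_funTS; exact: measurable_stepf.
move=> u /=; rewrite in_itv/= => u01; rewrite /stepf.
have /andP[u0 u1] := u01.
have wu := @cvg_truncn_ratio (fun n => n.+1) u u0.
have {}wu : (Num.truncn (n.+1%:R * u))%:R / n.+1%:R @[n --> \oo] --> u.
  by apply: wu => M; exists M => // n /= /leqW.
have [u_eq0|u_neq0] := eqVneq u 0.
  rewrite u_eq0 invr0 mulr0; under eq_fun do rewrite mulr0 truncn0 mul0r invr0 mulr0.
  exact: cvg_cst.
apply: cvgM; last exact: cvgV.
apply: strassen_cvg_right => // n; rewrite divr_ge0//= ler_pdivrMr ?ltr0n// mul1r.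
by rewrite (@le_trans _ _ (n.+1%:R * u)) ?truncn_le ?mulr_ge0// ler_piMr.
Qed.

Lemma integrable_strassen_ratio (f : R -> R) : strassen_class f ->
  mu.-integrable `[0, 1] (EFin \o (fun u => f u / u)).
Proof.
move=> fS; apply: (le_integrable _ _ _ integrable_invsqrt) => //.
  by apply/measurable_EFinP; exact: measurable_strassen_ratio.
move=> u /=; rewrite in_itv/= => u01.
by rewrite lee_fin [leRHS]ger0_norm ?powR_ge0//; exact: strassen_ratio_le.
Qed.

Section functional.
Variables (v : nat -> nat -> R) (N : nat -> nat) (f : R -> R) (C : R).
Hypothesis fS : strassen_class f.
Hypothesis N0 : forall j, (0 < N j)%N.
Hypothesis Noo : forall M, \forall j \near \oo, (M <= N j)%N.
Hypothesis vf : unif_cvg01 (fun j t => v j (Num.truncn ((N j)%:R * t))) f.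
Hypothesis vC : forall j k, (0 < k)%N -> (k <= N j)%N ->
  `|v j k| <= C * Num.sqrt (k%:R / (N j)%:R).

(** On cell [i] this is [v j i.+1] divided by the right end [i.+1 / N j], so the integral up to
    [k / N j] is exactly the sum of the [v j i / i], [1 <= i <= k]. Sampling at the right end keeps
    the denominator positive. *)
Let s j : R -> R := stepf (N j) (fun i => (N j)%:R * (v j i.+1 / i.+1%:R)).

Let NR j : 0 < (N j)%:R :> R. Proof. by rewrite ltr0n. Qed.

Let C0 : 0 <= C.
Proof.
have := vC (N0 0) (leqnn (N 0)); rewrite divff ?gt_eqF// sqrtr1 mulr1.
exact: le_trans (normr_ge0 _).
Qed.

(** The sampling point [w] is to the right of [u], so the bound [C w^(-1/2)] given by [vC] is at
    most [C u^(-1/2)]. *)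
Lemma step_dominated j (u : R) : 0 < u < 1 -> `|s j u| <= C * u `^ (- 2^-1).
Proof.
move=> /andP[u0 u1]; rewrite /s /stepf; set i := Num.truncn _.
have Nu0 : 0 <= (N j)%:R * u by rewrite mulr_ge0// ltW.
have iN : (i < N j)%N by rewrite truncn_lt_nat// gtr_pMr.
set w : R := i.+1%:R / (N j)%:R.
have uw : u <= w by rewrite ler_pdivlMr// mulrC ltW// truncnS_gt.
have w0 : 0 < w by exact: lt_le_trans uw.
have -> : (N j)%:R * (v j i.+1 / i.+1%:R) = v j i.+1 / w.
  by rewrite /w invf_div mulrCA mulrA.
rewrite normrM normfV [`|w|]gtr0_norm// ler_pdivrMr//.
apply: le_trans (vC (ltn0Sn i) iN) _; rewrite -/w -mulrA ler_wpM2l//.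
have sw0 : 0 < Num.sqrt w by rewrite sqrtr_gt0.
have su0 : 0 < Num.sqrt u by rewrite sqrtr_gt0.
rewrite powRN powR12_sqrt ?(ltW u0)// ler_pdivlMl// -[leRHS](sqr_sqrtr (ltW w0)) expr2.
by rewrite ler_wpM2r ?(ltW sw0)// ler_sqrt// ltW.
Qed.

Lemma step_pointwise (u : R) : 0 < u < 1 -> s j u @[j --> \oo] --> f u / u.
Proof.
move=> /andP[u0 u1]; pose i j := Num.truncn ((N j)%:R * u).
pose w j : R := (i j).+1%:R / (N j)%:R.
have Nu0 j : 0 <= (N j)%:R * u by rewrite mulr_ge0// ltW.
have iN j : (i j < N j)%N by rewrite truncn_lt_nat// gtr_pMr.
have w01 j : 0 <= w j <= 1 by rewrite divr_ge0//= ler_pdivrMr// mul1r ler_nat.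
have u01 : 0 <= u <= 1 by rewrite !ltW.
have Ninv : (N j)%:R^-1 @[j --> \oo] --> (0 : R).
  apply/cvgrPdist_le => e e0; near=> j; rewrite sub0r normrN gtr0_norm ?invr_gt0//.
  have Nj : ((Num.truncn e^-1).+1 <= N j)%N by near: j; exact: Noo.
  rewrite -[leRHS]invrK lef_pV2 ?posrE ?invr_gt0//.
  by rewrite (le_trans (ltW (truncnS_gt _)))// ler_nat.
have wu : w @ \oo --> u.
  have -> : w = (fun j => (i j)%:R / (N j)%:R + (N j)%:R^-1).
    by apply/funext => j; rewrite /w -natr1 mulrDl mul1r.
  by rewrite -[X in _ --> X]addr0; apply: cvgD => //; apply: cvg_truncn_ratio => //; exact: ltW.
have -> : s ^~ u = (fun j => v j (i j).+1 / w j).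
  by apply/funext => j; rewrite /s /stepf -/(i j) /w invf_div mulrCA mulrA.
apply: cvgM; last by apply: cvgV => //; rewrite gt_eqF.
have fw := strassen_cvg_right fS u01 w01 wu.
apply/cvgrPdist_le => e e0; have e20 : 0 < e / 2 by rewrite divr_gt0.
have /cvgrPdist_le/(_ _ e20) := fw; have := vf e20.
apply: filterS2 => j /(_ (w j) (w01 j)).
rewrite /w mulrCA divff ?gt_eqF// mulr1 natrK -/(w j) => h1 h2.
rewrite -(subrK (f (w j)) (f u)) -addrA (le_trans (ler_normD _ _))// [e]splitr lerD//.
by rewrite distrC.
Unshelve. all: by end_near. Qed.

(** Dominated convergence runs on the open interval: at [u = 1] the step function reads
    [v j (N j).+1], on which no bound is assumed. Convergence in [L^1], rather than of each
    integral, later gives uniformity in [t]. *)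
Lemma step_L1_cvg : Rintegral mu `[0, 1] (fun u => `|s j u - f u / u|) @[j --> \oo] --> (0 : R).
Proof.
have ms (D : set R) j : measurable_fun D (fun u => (s j u)%:E).
  by apply/measurable_EFinP; apply: measurable_funTS; exact: measurable_stepf.
have sub : `]0, 1[ `<=` (`[0, 1] : set R) by apply: subset_itv; rewrite bnd_simp.
have mff : measurable_fun `](0 : R), 1[ (fun u => (f u / u)%:E).
  by apply/measurable_EFinP; apply: measurable_funS (measurable_strassen_ratio fS).
have idom : mu.-integrable `]0, 1[ (EFin \o (fun u : R => C * u `^ (- 2^-1))).
  apply: integrable_realZ => //; exact: integrableS integrable_invsqrt.
have oo01 (u : R) : `](0 : R), 1[%classic u -> 0 < u < 1 by rewrite /= in_itv.
have cvg_oo u : `](0 : R), 1[%classic u -> (s j u)%:E @[j --> \oo] --> (f u / u)%:E.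
  move=> /oo01 u01; apply: cvg_EFin; first exact: nearW.
  exact: step_pointwise.
have dom_oo j (u : R) : `](0 : R), 1[%classic u -> (`|(s j u)%:E| <= (C * u `^ (- 2^-1))%:E)%E.
  by move=> /oo01 u01; rewrite lee_fin; exact: step_dominated.
have aeF : Filter (almost_everywhere mu) := ae_filter_ringOfSetsType mu.
have [_ L1 _] : [/\ mu.-integrable `]0, 1[ (fun u => (f u / u)%:E),
    [sequence (\int[mu]_(x in `]0%R, 1%R[) `|(s j x)%:E - (f x / x)%:E|)%E]_j @ \oo --> 0%E
  & [sequence (\int[mu]_(x in `]0%R, 1%R[) (s j x)%:E)%E]_j @ \oo
     --> (\int[mu]_(x in `]0%R, 1%R[) (f x / x)%:E)%E].
  apply: (@dominated_convergence _ _ _ mu _ _ (fun j u => (s j u)%:E)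
    (fun u => (f u / u)%:E) (EFin \o (fun u : R => C * u `^ (- 2^-1)))) => //.
  - by move=> n; exact: ms.
  - by apply: (@nearW _ _ _ aeF) => u; exact: cvg_oo.
  - by apply: (@nearW _ _ _ aeF) => u j; exact: dom_oo.
have md j : measurable_fun `[(0 : R), 1] (fun u => `|(s j u)%:E - (f u / u)%:E|)%E.
  apply: measurableT_comp => //; apply: emeasurable_funB; first exact: ms.
  by apply/measurable_EFinP; exact: measurable_strassen_ratio.
have E j : Rintegral mu `[0, 1] (fun u => `|s j u - f u / u|) =
    fine (\int[mu]_(x in `]0%R, 1%R[) `|(s j x)%:E - (f x / x)%:E|)%E.
  rewrite /Rintegral; congr fine; rewrite -integral_itv_obnd_cbnd; last first.
    by apply: measurable_funS (md j) => //; apply: subset_itvr; rewrite bnd_simp.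
  rewrite -integral_itv_bndo_bndc//.
  by apply: measurable_funS (md j) => //; exact: sub.
under eq_fun do rewrite E.
exact: fine_cvg L1.
Qed.

Lemma step_functional_cvg : unif_cvg01
  (fun j t => \sum_(1 <= k < (Num.truncn ((N j)%:R * t)).+1) v j k / k%:R)
  (fun t => Rintegral mu `[0, t] (fun u => f u / u)).
Proof.
move=> e e0; have e20 : 0 < e / 2 by rewrite divr_gt0.
have e0' := ltW e0.
have iff := integrable_strassen_ratio fS.
have is' j : mu.-integrable `[0, 1] (EFin \o s j) by exact: integrable_stepf.
have /cvgrPdist_le/(_ _ e20) L1 := step_L1_cvg.
near=> j; move=> t /andP[t0 t1].
have Lj : Rintegral mu `[0, 1] (fun u => `|s j u - f u / u|) <= e / 2.
  have : `|0 - Rintegral mu `[0, 1] (fun u => `|s j u - f u / u|)| <= e / 2 by near: j.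
  by rewrite sub0r normrN; apply: le_trans; exact: ler_norm.
have CN : C * Num.sqrt (N j)%:R^-1 <= e / 2.
  rewrite -(@ler_pXn2r _ 2)// ?nnegrE ?mulr_ge0 ?sqrtr_ge0 ?(ltW e20)//.
  rewrite exprMn sqr_sqrtr ?invr_ge0// ler_pdivrMr// -ler_pdivrMl ?exprn_gt0//.
  have Nj : ((Num.truncn (((e / 2) ^+ 2)^-1 * C ^+ 2)).+1 <= N j)%N by near: j; exact: Noo.
  by rewrite (le_trans (ltW (truncnS_gt _)))// ler_nat.
have Nt0 : 0 <= (N j)%:R * t by rewrite mulr_ge0.
set k := Num.truncn _.
have /andP[kt tk] : k%:R <= (N j)%:R * t < k.+1%:R by exact: truncn_itv.
have kN : (k <= N j)%N by rewrite -(ler_nat R) (le_trans kt)// ler_piMr// ltW.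
pose tau : R := k%:R / (N j)%:R.
have tau0 : 0 <= tau by rewrite divr_ge0// ltW.
have taut : tau <= t by rewrite ler_pdivrMr// mulrC.
have -> : \sum_(1 <= i < k.+1) v j i / i%:R = Rintegral mu `[0, tau] (s j).
  rewrite Rintegral_stepf// -mulr_sumr mulrA mulVf ?gt_eqF// mul1r.
  by rewrite big_add1/= big_mkord.
have h1 : `|Rintegral mu `[0, t] (s j) - Rintegral mu `[0, t] (fun u => f u / u)| <= e / 2.
  rewrite -RintegralB; [|by []|exact: (integrable_itv0 t1 (is' j))|exact: (integrable_itv0 t1 iff)].
  have id : mu.-integrable `[0, 1] (EFin \o (fun u => s j u - f u / u)) by exact: integrable_realB.
  apply: le_trans (le_normr_Rintegral _ _) _ => //; first exact: integrable_itv0.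
  apply: le_trans Lj; rewrite -subr_ge0 Rintegral_increment//; last exact: integrable_real_norm.
  by apply: Rintegral_ge0 => u _.
(* Between [tau] and [t] lies part of one cell, of mass at most
   [|v j k.+1| / k.+1 <= C / sqrt (N j)]. When [tau < t], also [k < N j], so [vC] applies to
   [k.+1]. *)
have h2 : `|Rintegral mu `[0, t] (s j) - Rintegral mu `[0, tau] (s j)| <= e / 2.
  rewrite Rintegral_increment//; last exact: integrable_itv0.
  have [->|tau_neq] := eqVneq tau t.
    by rewrite set_itv_ge ?Rintegral_set0 ?normr0 ?(ltW e20)// bnd_simp ltxx.
  have {}tau_lt : tau < t by rewrite lt_neqAle tau_neq.
  have kN' : (k < N j)%N.
    rewrite -(ltr_nat R) -[X in _ < X]mul1r -ltr_pdivrMr// (lt_le_trans tau_lt)//.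
  pose c : R := (N j)%:R * (v j k.+1 / k.+1%:R).
  have -> : Rintegral mu `]tau, t] (s j) = Rintegral mu `]tau, t] (cst c).
    apply: eq_Rintegral => u; rewrite inE/= in_itv/= => /andP[tauu ut].
    rewrite -/(s j u) /c.
    apply: (@stepf_cell _ _ (fun i => (N j)%:R * (v j i.+1 / i.+1%:R))) => //.
    rewrite -/tau (ltW tauu)/= (le_lt_trans ut)//.
    by rewrite ltr_pdivlMr// mulrC.
  have fmu : fine (mu `]tau, t]) = t - tau by rewrite lebesgue_itvoc.
  rewrite Rintegral_cst// fmu normrM [X in _ * X]ger0_norm ?subr_ge0//.
  apply: le_trans CN.
  have tt : t - tau <= (N j)%:R^-1.
    rewrite lerBlDr -[X in X + _]mul1r -mulrDl ler_pdivlMr// mulrC ltW// (lt_le_trans tk)//.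
    by rewrite -natr1 addrC.
  apply: (@le_trans _ _ (`|c| * (N j)%:R^-1)); first by rewrite ler_wpM2l.
  rewrite /c normrM normr_nat mulrAC divff ?gt_eqF// mul1r normrM normfV normr_nat.
  rewrite ler_pdivrMr ?ltr0n//; apply: le_trans (vC (ltn0Sn k) kN') _.
  rewrite -mulrA ler_wpM2l// sqrtrM// mulrC ler_wpM2l ?sqrtr_ge0//.
  rewrite -(@ler_pXn2r _ 2)// ?nnegrE ?sqrtr_ge0// sqr_sqrtr//.
  by rewrite expr2 ler_peMr// ler1n.
rewrite -(subrKA (Rintegral mu `[0, t] (s j))) (le_trans (ler_normD _ _))// [e]splitr lerD//.
by rewrite distrC.
Unshelve. all: by end_near. Qed.

End functional.

End log_integral.

(** * Strassen's law for the rescaled paths *)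

Section extraction.
Context {R : realType}.

Lemma subseq_index_ge phi : subseq_index phi -> forall n, (n <= phi n)%N.
Proof. by move=> phiS; elim=> // n IH; exact: leq_ltn_trans (phiS n). Qed.

Lemma subseq_choice (Q : nat -> nat -> Prop) :
  (forall k N, exists2 n, (N <= n)%N & Q k n) ->
  exists psi, subseq_index psi /\ forall k, Q k (psi k).
Proof.
move=> H.
have /choice[next Hn] : forall p : nat * nat, exists n, (p.1 <= n)%N /\ Q p.2 n.
  by move=> [N k]; have [n Nn gn] := H k N; exists n.
pose psi := fix psi k := if k is k'.+1 then next ((psi k').+1, k) else next (0%N, 0%N).
exists psi; split => [k|[|k]]; first by have [] := Hn ((psi k).+1, k.+1).
  by have [] := Hn (0, 0)%N.
by have [] := Hn ((psi k).+1, k.+1).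
Qed.

Lemma truncn_inv_le (e : R) k : 0 < e -> (Num.truncn e^-1 <= k)%N -> k.+1%:R^-1 <= e.
Proof.
move=> e0 ek; rewrite -[leRHS]invrK lef_pV2 ?posrE ?invr_gt0//.
by rewrite (le_trans (ltW (truncnS_gt _)))// ler_nat.
Qed.

Lemma subseq_of_frequently (g : nat -> R -> R) (f : R -> R) :
  (forall e : R, 0 < e -> forall N, exists2 n, (N <= n)%N &
     forall t : R, 0 <= t <= 1 -> `|g n t - f t| <= e) ->
  exists psi, subseq_index psi /\ unif_cvg01 (fun k => g (psi k)) f.
Proof.
move=> H.
have [psi [psiS gpsi]] := @subseq_choice
  (fun k n => forall t : R, 0 <= t <= 1 -> `|g n t - f t| <= k.+1%:R^-1)
  (fun k N => H k.+1%:R^-1 ltac:(by rewrite invr_gt0) N).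
exists psi; split => // e e0; exists (Num.truncn e^-1) => // k /= ek t t01.
by apply: (le_trans (gpsi k t t01)); exact: truncn_inv_le.
Qed.

Lemma ultra_cvg_itv (U : set_system nat) (h : nat -> R) (C : R) : UltraFilter U ->
  U [set n | `|h n| <= C] -> exists l : R, h @ U --> l.
Proof.
move=> UU UC; have cC : compact (`[- C, C]%classic : set R) by exact: segment_compact.
have [|l [_ lh]] := cC (h @ U) _.
  have -> : `[- C, C]%classic = [set x : R | `|x| <= C].
    by apply/seteqP; split => x; rewrite /= in_itv/= ler_norml.
  exact: UC.
exists l => B lB; have [//|UB] := in_ultra_setVsetC (h @^-1` B) UU.
by have [x []] := lh (~` B) B UB lB.
Qed.

(* A limit along an ultrafilter replaces the diagonal extraction. *)
Lemma equicont_subseq (g : nat -> R -> R) (C : R) :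
  (\forall n \near \oo, forall t : R, 0 <= t <= 1 -> `|g n t| <= C) ->
  (forall e : R, 0 < e -> exists2 m : nat, (0 < m)%N & \forall n \near \oo,
     forall t : R, 0 <= t <= 1 -> `|g n t - g n ((Num.truncn (m%:R * t))%:R / m%:R)| <= e) ->
  exists psi, subseq_index psi /\ exists f, unif_cvg01 (fun k => g (psi k)) f.
Proof.
move=> gC geq.
have [U [UU ooU]] := @ultraFilterLemma nat \oo _.
have /choice[f Hf] : forall t, exists l : R, 0 <= t <= 1 -> g ^~ t @ U --> l.
  move=> t; have [t01|] := boolP (0 <= t <= 1); last by exists 0.
  have [|l gl] := @ultra_cvg_itv U (g ^~ t) C UU; last by exists l.
  by apply: ooU; apply: filterS gC => n /(_ t t01).
have [psi [psiS psif]] : exists psi, subseq_index psi /\ unif_cvg01 (fun k => g (psi k)) f.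
  apply: subseq_of_frequently => e e0 N.
  have e60 : 0 < e / 6 by rewrite divr_gt0.
  have [m m0 gm] := geq _ e60.
  have m0R : 0 < m%:R :> R by rewrite ltr0n.
  have grid01 i : (i <= m)%N -> 0 <= (i%:R / m%:R : R) <= 1.
    by move=> im; rewrite divr_ge0//= ler_pdivrMr// mul1r ler_nat.
  pose S := [set n | (forall t, 0 <= t <= 1 ->
      `|g n t - g n ((Num.truncn (m%:R * t))%:R / m%:R)| <= e / 6) /\
    forall i : 'I_m.+1, `|f (i%:R / m%:R) - g n (i%:R / m%:R)| <= e / 6].
  have US : U S.
    apply: filterI; first exact: ooU gm.
    apply: filter_forall => i.
    have := Hf (i%:R / m%:R) (grid01 i _); rewrite -ltnS => /(_ (ltn_ord i)).
    by move=> /cvgrPdist_le; apply.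
  have UN : U [set n | (N <= n)%N] by apply: ooU; exists N.
  have [n [[Sn1 Sn2] Nn]] : S `&` [set n | (N <= n)%N] !=set0.
    exact: filter_ex (filterI US UN).
  exists n => // t t01.
  (* [n] was fixed before [t], but the auxiliary [n'] may depend on [t]. Five differences of size
     [e / 6] link, in order, [f t], [g n' t], [g n'] at the grid point, [f] there, [g n] there, and
     [g n t]. *)
  have [n' [[Sn'1 Sn'2] n't]] : S `&` [set n' | `|f t - g n' t| <= e / 6] !=set0.
    have Uf : U [set n' | `|f t - g n' t| <= e / 6].
      by have /cvgrPdist_le := Hf t t01; apply.
    exact: filter_ex (filterI US Uf).
  have im : (Num.truncn (m%:R * t) < m.+1)%N.
    have /andP[t0 t1] := t01.
    by rewrite truncn_lt_nat ?mulr_ge0// (@le_lt_trans _ _ m%:R) ?ltr_nat// ler_piMr// ltW.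
  have := Sn1 t t01; have := Sn2 (Ordinal im); have := Sn'1 t t01; have := Sn'2 (Ordinal im).
  move: n't; rewrite /= !ler_norml => /andP[? ?] /andP[? ?] /andP[? ?] /andP[? ?] /andP[? ?].
  by apply/andP; split; lra.
by exists psi; split => //; exists f.
Qed.

End extraction.

Section lil_path.
Context {R : realType}.
Implicit Types (V : nat -> R) (f : R -> R).

Lemma ler_norm_sqr (x y : R) : (`|x| <= `|y|) = (x ^+ 2 <= y ^+ 2).
Proof.
by rewrite -[x ^+ 2]real_normK ?num_real// -[y ^+ 2]real_normK ?num_real// ler_pXn2r ?nnegrE.
Qed.

Lemma near_oo_comp (N : nat -> nat) (Q : nat -> Prop) :
  (forall M, \forall j \near \oo, (M <= N j)%N) ->
  (\forall n \near \oo, Q n) -> \forall j \near \oo, Q (N j).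
Proof. by move=> Noo [M _ QM]; apply: filterS (Noo M) => j; exact: QM. Qed.

Definition lil_path V (n : nat) (t : R) : R := V (Num.truncn (n%:R * t)) / lil_scale n.

Lemma truncn_ratio n i m : (0 < m)%N ->
  Num.truncn (n%:R * (i%:R / m%:R) : R) = (n * i %/ m)%N.
Proof.
move=> m0; have m0R : 0 < m%:R :> R by rewrite ltr0n.
apply/eqP; rewrite truncn_eq; last by rewrite mulr_ge0// divr_ge0.
rewrite mulrA -natrM ler_pdivlMr// ltr_pdivrMr// -!natrM ler_nat ltr_nat leq_divM/=.
by rewrite mulnC -ltn_divLR ?ltnS//.
Qed.

Lemma truncn_itv (n : nat) (t : R) : 0 <= t <= 1 ->
  (Num.truncn (n%:R * t))%:R <= n%:R * t /\ n%:R * t < (Num.truncn (n%:R * t))%:R + 1.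
Proof. by move=> /andP[t0 _]; rewrite truncn_le ?mulr_ge0// natr1 truncnS_gt. Qed.

Lemma truncn_le_scale (n : nat) (t : R) : 0 <= t <= 1 -> (Num.truncn (n%:R * t) <= n)%N.
Proof.
move=> t01; have [h _] := truncn_itv n t01; rewrite -(ler_nat R).
by apply: (le_trans h); rewrite ler_piMr//; case/andP: t01.
Qed.

Lemma lil_path_equicont V : lil_equicont V -> forall e : R, 0 < e -> exists2 de : R, 0 < de &
  \forall n \near \oo, forall s t : R, 0 <= s <= 1 -> 0 <= t <= 1 -> `|s - t| <= de ->
    `|lil_path V n s - lil_path V n t| <= e.
Proof.
move=> Veq e e0; have [de de0 H] := Veq e e0.
(* Half of [de] is kept for the truncations, which change [n (s - t)] by at most [1 <= de n / 2]. *)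
exists (de / 2); first by rewrite divr_gt0.
near=> n; move=> s t s01 t01 st.
have n4 : (4 <= n)%N by near: n; exists 4%N.
have nde : 2 / de <= n%:R.
  near: n; exists (Num.truncn (2 / de)).+1 => // n /= hn.
  by rewrite (le_trans (ltW (truncnS_gt _)))// ler_nat.
rewrite ler_pdivrMr// in nde.
rewrite -mulrBl normrM normfV (ger0_norm (lil_scale_ge0 _)) ler_pdivrMr ?lil_scale_gt0//.
apply: (near H n); rewrite ?truncn_le_scale//.
have [a1 a2] := truncn_itv n s01; have [b1 b2] := truncn_itv n t01.
have n0 : 0 <= n%:R :> R by [].
have := ler_wpM2l n0 st; rewrite -[X in X * `|_|](ger0_norm n0) -normrM mulrBr.
by rewrite !ler_norml => /andP[? ?]; apply/andP; split; nra.
Unshelve. all: by end_near. Qed.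

(** Transfers [energy_bound] to all large [n]: [n] is replaced by [m N] with [N = a 2 ^ p <= n / m]
    and [A <= a < 2 A], so finitely many [a] occur. The relative error is of order [1 / A], absorbed
    by equicontinuity, and [m lil_scale N ^ 2 <= lil_scale n ^ 2] keeps the energy bound. *)
Lemma lil_path_energy V m (e : R) : energy_bound V -> lil_equicont V -> (0 < m)%N -> 0 < e ->
  \forall n \near \oo, exists2 y : nat -> R,
    m%:R * \sum_(i < m) y i ^+ 2 <= 1 + e &
    forall i, (i < m)%N ->
      `|lil_path V n (i.+1%:R / m%:R) - lil_path V n (i%:R / m%:R) - y i| <= e.
Proof.
move=> Ven Veq m0 e0.
have m0R : 0 < m%:R :> R by rewrite ltr0n.
have [de de0 Hde] := Veq (e / 2) ltac:(lra).
pose A := (Num.truncn (2 / de)).+1.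
have A0 : (0 < A)%N by [].
have Ade : 2 <= A%:R * de by rewrite -ler_pdivrMr// ltW// truncnS_gt.
pose r := Num.truncn e^-1.
have re : r.+1%:R^-1 <= e by exact: truncn_inv_le.
have [p0 _ Hp0] : \forall p \near \oo, forall a : 'I_(2 * A),
    \sum_(i < m) (V (i.+1 * (a.+1 * 2 ^ p))%N - V (i * (a.+1 * 2 ^ p))%N) ^+ 2
      <= (1 + r.+1%:R^-1) * lil_scale (a.+1 * 2 ^ p) ^+ 2.
  by apply: filter_forall => a; exact: Ven.
near=> n.
pose N' := (n %/ m)%N; pose p := trunc_log 2 (N' %/ A).
have nbig : (2 ^ (maxn p0 2) * A * m <= n)%N by near: n; exists (2 ^ (maxn p0 2) * A * m)%N.
have N'big : (2 ^ (maxn p0 2) <= N' %/ A)%N by rewrite !leq_divRL.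
have N'A0 : (0 < N' %/ A)%N by rewrite (leq_trans _ N'big)// expn_gt0.
have /andP[pl pu] : (2 ^ p <= N' %/ A < 2 ^ p.+1)%N by exact: trunc_log_bounds.
have : (maxn p0 2 <= p)%N by exact: trunc_log_max.
rewrite geq_max => /andP[p0p p2].
have p20 : (0 < 2 ^ p)%N by rewrite expn_gt0.
pose a := (N' %/ 2 ^ p)%N.
have aA : (A <= a)%N by rewrite leq_divRL// mulnC -leq_divRL.
have a2A : (a < 2 * A)%N by rewrite ltn_divLR// mulnAC -expnS -ltn_divLR.
pose N := (a * 2 ^ p)%N.
have NN' : (N <= N')%N by exact: leq_divM.
have N'N : (N' <= N + 2 ^ p)%N.
  by rewrite {1}(divn_eq N' (2 ^ p)) leq_add2l ltnW// ltn_mod.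
have mN' : (m * N' <= n)%N by rewrite mulnC leq_divM.
have nN' : (n < m * N' + m)%N by rewrite {1}(divn_eq n m) mulnC ltn_add2l ltn_mod.
have a0 : (0 < a)%N by exact: leq_trans aA.
have N4 : (4 <= N)%N.
  by rewrite (@leq_trans (2 ^ p))// ?leq_pmull// (@leq_pexp2l 2 2).
have mNn : (m * N <= n)%N by rewrite (leq_trans _ mN')// leq_mul2l NN' orbT.
have Nn : (N <= n)%N by rewrite (leq_trans _ mNn)// leq_pmull.
have n4 : (4 <= n)%N by exact: leq_trans Nn.
have s0 := @lil_scale_gt0 R n n4.
exists (fun i => (V (i.+1 * N)%N - V (i * N)%N) / lil_scale n).
  under eq_bigr do rewrite exprMn.
  rewrite -mulr_suml exprVn mulrA ler_pdivrMr ?exprn_gt0//.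
  have := Hp0 p p0p (Ordinal (leq_ltn_trans (leq_pred a) a2A)); rewrite /= prednK// -/N.
  move=> /(ler_wpM2l (ltW m0R)) /le_trans; apply.
  rewrite mulrCA ler_pM ?mulr_ge0 ?exprn_ge0 ?lil_scale_ge0//; [by rewrite lerD2l|].
  rewrite !lil_scale_sqr//.
  have := @lnln_mono R N n (leq_trans _ N4) Nn => /(_ isT).
  have := lnln_gt0 (R:=R) N4.
  have : m%:R * N%:R <= n%:R :> R by rewrite -natrM ler_nat.
  move=> mN x0 xy; rewrite mulrA mulrCA -!mulrA ler_wpM2l// mulrA ler_pM ?mulr_ge0//.
  exact: ltW.
move=> i im.
have cl k : (k <= m)%N -> `|V (n * k %/ m)%N - V (k * N)%N| <= e / 2 * lil_scale n.
  move=> km; apply: (near Hde n) => //.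
  - by rewrite (leq_trans (leq_div2r m (leq_mul (leqnn n) km)))// mulnK.
  - by rewrite (leq_trans _ mNn)// leq_mul2r km orbT.
  have q1 : (k * N <= n * k %/ m)%N.
    by rewrite leq_divRL// -mulnA [(n * k)%N]mulnC leq_mul2l [(N * m)%N]mulnC mNn orbT.
  (* Each of the [k <= m] steps loses at most [2 ^ p] in rounding [N'] down to [N] and at most 1 in
     rounding [n / m] down to [N']. *)
  have q2 : (n * k %/ m <= k * N + 2 * (m * 2 ^ p))%N.
    rewrite (@leq_trans (k * N'.+1))//.
      rewrite (leq_trans (leq_div2r m (_ : _ <= k * N'.+1 * m)%N)) ?mulnK//.
      by rewrite mulnC -mulnA leq_mul2l mulSn [(N' * m)%N]mulnC addnC (ltnW nN') orbT.
    rewrite (@leq_trans (k * (N + 2 * 2 ^ p)))//.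
      by rewrite leq_mul2l mul2n -addnn addnA -addn1 leq_add ?orbT.
    by rewrite mulnDr leq_add2l mulnCA leq_mul2l leq_mul2r km orbT.
  have q3 : (A * (m * 2 ^ p) <= n)%N.
    rewrite mulnCA (leq_trans _ mN')// leq_mul2l mulnC -leq_divRL// pl orbT//.
  rewrite -natrB// ger0_norm// (@le_trans _ _ (2 * (m * 2 ^ p)%:R))//.
    by rewrite -natrM ler_nat leq_subLR.
  rewrite (@le_trans _ _ (A%:R * de * (m * 2 ^ p)%:R))//; first by rewrite ler_wpM2r.
  by rewrite mulrAC mulrC ler_wpM2l ?(ltW de0)// -natrM ler_nat.
rewrite /lil_path !truncn_ratio//.
rewrite -!mulrBl normrM normfV (ger0_norm (ltW s0)) ler_pdivrMr//.
have := cl i.+1 im; have := cl i (ltnW im).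
rewrite !ler_norml => /andP[? ?] /andP[? ?]; apply/andP; split; lra.
Unshelve. all: by end_near. Qed.

Lemma strassen_of_limit V (N : nat -> nat) f : V 0%N = 0 -> energy_bound V -> lil_equicont V ->
  (forall M, \forall j \near \oo, (M <= N j)%N) ->
  unif_cvg01 (fun j => lil_path V (N j)) f -> strassen_class f.
Proof.
move=> V0 Ven Veq Noo Nf.
have shift Q := @near_oo_comp N Q Noo.
apply: riesz_strassen.
- move=> p; set m := (2 ^ p)%N.
  have m0 : (0 < m)%N by rewrite expn_gt0.
  have m0R : 0 < m%:R :> R by rewrite ltr0n.
  have -> : m%:R^-1 * \sum_(i < m) (m%:R * (f (i.+1%:R / m%:R) - f (i%:R / m%:R))) ^+ 2 =
      m%:R * \sum_(i < m) (f (i.+1%:R / m%:R) - f (i%:R / m%:R)) ^+ 2.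
    under eq_bigr do rewrite exprMn.
    by rewrite -mulr_sumr; field; rewrite gt_eqF.
  apply/ler_addgt0Pr => e e0.
  (* Three errors [h] separate [y i] from the increment of [f], and
     [(x + z)^2 <= (1 + h) x^2 + (1 + 1/h) z^2] with [|z| <= 3 h] gives the term [9 (h + h^2)]. The
     total [(1 + h)^2 + 9 m^2 (h + h^2)] is at most [1 + h (4 + 18 m^2)]. *)
  pose h : R := Num.min 1 (e / (4 + 18 * m%:R ^+ 2)).
  have D0 : 0 < 4 + 18 * m%:R ^+ 2 :> R by rewrite ltr_wpDr// mulr_ge0// exprn_ge0.
  have h0 : 0 < h by rewrite lt_min ltr01 divr_gt0.
  have h1 : h <= 1 by rewrite ge_min lexx.
  have he : h * (4 + 18 * m%:R ^+ 2) <= e.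
    by rewrite -ler_pdivlMr// ge_min lexx orbT.
  have /shift [] := @lil_path_energy V m h Ven Veq m0 h0.
  move=> J1 _ H1.
  have [J2 _ H2] := Nf h h0.
  pose j := maxn J1 J2.
  have {H1}[y ye yd] := H1 j (leq_maxl _ _).
  have {}H2 := H2 j (leq_maxr _ _).
  have grid i : (i <= m)%N -> 0 <= (i%:R / m%:R : R) <= 1.
    by move=> im; rewrite divr_ge0//= ler_pdivrMr// mul1r ler_nat.
  apply: (@le_trans _ _ (m%:R * \sum_(i < m) ((1 + h) * y i ^+ 2 + 9 * (h + h ^+ 2)))).
    rewrite ler_wpM2l//; apply: ler_sum => i _.
    have := yd i (ltn_ord i).
    have := H2 _ (grid i.+1 (ltn_ord i)); have := H2 _ (grid i (ltnW (ltn_ord i))).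
    move: (f _) (f _) (lil_path _ _ _) (lil_path _ _ _) (y i) => a b c d x.
    rewrite !ler_norml => /andP[? ?] /andP[? ?] /andP[? ?].
    have z2 : (a - b - x) ^+ 2 <= 9 * h ^+ 2.
      rewrite -[9 * _]/(9 * h ^+ 2) (_ : 9 * h ^+ 2 = (3 * h) ^+ 2); last by ring.
      rewrite -ler_norm_sqr [leRHS]ger0_norm ?mulr_ge0 ?(ltW h0)// ler_norml.
      by apply/andP; split; lra.
    have h9 : 0 <= (h * x - (a - b - x)) ^+ 2 by exact: sqr_ge0.
    rewrite -(@ler_pM2l _ h)//; move: z2 h9; move: (a - b) => q; nra.
  rewrite big_split/= -mulr_sumr sumr_const card_ord -[_ *+ m]mulr_natl mulrDr mulrCA.
  have : (1 + h) * (m%:R * \sum_(i < m) y i ^+ 2) <= (1 + h) * (1 + h).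
    by rewrite ler_wpM2l// addr_ge0// ltW.
  have m2 : 0 <= m%:R ^+ 2 :> R by rewrite exprn_ge0.
  have : m%:R * (m%:R * (9 * (h + h ^+ 2))) <= 18 * m%:R ^+ 2 * h.
    rewrite mulrA -expr2; nra.
  move: he; nra.
- apply/eqP; rewrite -normr_le0; apply/ler_addgt0Pr => e e0; rewrite add0r.
  have [J _ H] := Nf e e0; have := H J (leqnn _) 0; rewrite lexx ler01 => /(_ isT).
  by rewrite /lil_path mulr0 truncn0 V0 mul0r sub0r normrN.
- move=> e e0; have e30 : 0 < e / 3 by rewrite divr_gt0.
  have [de de0 Hde] := lil_path_equicont Veq e30.
  exists de => // s t s01 t01 st.
  have [J1 _ H1] := shift _ Hde; have [J2 _ H2] := Nf _ e30.
  pose j := maxn J1 J2.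
  have := H1 j (leq_maxl _ _) s t s01 t01 st.
  have /= := H2 j (leq_maxr _ _) s s01; have /= := H2 j (leq_maxr _ _) t t01.
  rewrite !ler_norml => /andP[? ?] /andP[? ?] /andP[? ?]; apply/andP; split; lra.
Qed.

(** Rounding is towards 0, so that it never increases the energy of a list of targets. *)
Lemma int_truncation (x : R) : exists z : int, `|z%:~R| <= `|x| /\ `|z%:~R - x| <= 1.
Proof.
wlog x0 : x / 0 <= x.
  move=> H; have [/H//|/ltW x0] := leP 0 x.
  have [|z [z1 z2]] := H (- x); first by rewrite oppr_ge0.
  exists (- z); rewrite mulrNz (_ : - z%:~R - x = - (z%:~R - - x)); last by ring.
  by rewrite !normrN -[leRHS]normrN.
exists (Num.truncn x)%:Z; rewrite -pmulrn.
have := truncn_le x; rewrite x0 => h1; have h2 := truncnS_gt x; rewrite -natr1 in h2.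
rewrite (ger0_norm (ler0n _ _)) (ger0_norm x0); split => //.
by rewrite ler_norml; apply/andP; split; lra.
Qed.

(** The increments of [f] over the grid [i / b], [i >= 1], are shrunk to bring their energy strictly
    below 1, rounded to rationals and used as targets; at [n = b ^ j.+1] the path at [i / b] is
    [V (i * b ^ j)] over the scale. *)
Lemma strassen_approx V f : V 0%N = 0 -> lil_equicont V -> approx_targets V ->
  strassen_class f -> forall e : R, 0 < e -> forall N, exists2 n, (N <= n)%N &
    forall t : R, 0 <= t <= 1 -> `|lil_path V n t - f t| <= e.
Proof.
move=> V0 Veq Vtar fS e e0 N.
have e8 : 0 < e / 8 by rewrite divr_gt0.
have [de de0 [N1 _ Hde]] := lil_path_equicont Veq e8.
(* Over one cell of length [1 / b], the path then moves by at most [e / 8], and so does [f]; this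
   disposes of the first cell, which has no target. *)
pose m := maxn (Num.truncn de^-1) (Num.truncn ((e / 8) ^+ 2)^-1).
pose b := m.+2.
have b0 : 0 < b%:R :> R by rewrite ltr0n.
have inv_le (x : R) : 0 < x -> (Num.truncn x^-1 <= m)%N -> b%:R^-1 <= x.
  by move=> x0 xm; apply: truncn_inv_le => //; exact: leqW.
have bde : b%:R^-1 <= de by rewrite inv_le// leq_maxl.
have be : b%:R^-1 <= (e / 8) ^+ 2 by rewrite inv_le// ?exprn_gt0// leq_maxr.
have grid i : (i <= b)%N -> 0 <= (i%:R / b%:R : R) <= 1.
  by move=> ib; rewrite divr_ge0//= ler_pdivrMr// mul1r ler_nat.
have fb (s t : R) : 0 <= s <= 1 -> 0 <= t <= 1 -> `|t - s| <= b%:R^-1 -> `|f t - f s| <= e / 8.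
  move=> s01 t01 st; rewrite -[leRHS]ger0_norm ?(ltW e8)// ler_norm_sqr.
  by rewrite (le_trans (strassen_holder fS s01 t01))// (le_trans st).
(* Each grid step costs [3 / r.+1]: the precision of the target, the rounding, and the shrinking of
   an increment at most 1. Over at most [b] steps this stays below [e / 8]. *)
pose r := Num.truncn (24 * b%:R / e).
have r0 : 0 < r.+1%:R^-1 :> R by rewrite invr_gt0.
have r1 : r.+1%:R^-1 <= 1 :> R by rewrite invf_le1// ler1n.
have re : 24 * b%:R * r.+1%:R^-1 <= e.
  by rewrite ler_pdivrMr// [e * _]mulrC -ler_pdivrMr// ltW// truncnS_gt.
pose Df i : R := f (i.+2%:R / b%:R) - f (i.+1%:R / b%:R).
pose q i : R := (1 - r.+1%:R^-1) * Df i.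
have /choice[zf Hz] : forall i, exists z : int, `|z%:~R| <= `|q i * r.+1%:R| /\
    `|z%:~R - q i * r.+1%:R| <= 1.
  by move=> i; exact: int_truncation.
pose z := mkseq zf m.+1.
have zE i : (i < m.+1)%N -> nth 0 z i = zf i by move=> im; rewrite nth_mkseq.
have Hsum : b%:R * (\sum_(i < m.+1) ((nth 0 z i)%:~R / r.+1%:R) ^+ 2) < 1 :> R.
  apply: (@le_lt_trans _ _ (b%:R * \sum_(i < m.+1) q i ^+ 2)).
    rewrite ler_wpM2l//; apply: ler_sum => i _; rewrite zE//.
    by rewrite -ler_norm_sqr normrM normfV (ger0_norm (ler0n _ r.+1)) ler_pdivrMr//
      -[X in _ <= _ * X](ger0_norm (ler0n _ r.+1)) -normrM; have [] := Hz i.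
  apply: (@le_lt_trans _ _ ((1 - r.+1%:R^-1) ^+ 2)).
    under eq_bigr do rewrite exprMn.
    rewrite -mulr_sumr mulrCA ler_piMr ?sqr_ge0//.
    apply: le_trans (strassen_grid fS (ltn0Sn m.+1)); rewrite ler_wpM2l//.
    by rewrite [leRHS]big_ord_recl/= lerDr sqr_ge0.
  move: r0 r1; move: (_^-1) => x; nra.
have [j jN Hj] := Vtar m r r z Hsum (maxn (maxn N N1) 4).
pose n := (b ^ j.+1)%N.
have nj : (maxn (maxn N N1) 4 <= n)%N.
  by rewrite (leq_trans jN)// ltnW// (leq_trans (ltn_expl j (isT : 1 < b)%N))// leq_pexp2l.
move: nj; rewrite !geq_max -andbA => /and3P[nN nN1 n4].
exists n => //.
have {}Hde := Hde n nN1.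
have nb : (n = b * b ^ j)%N by rewrite /n expnS.
have s0 := @lil_scale_gt0 R n n4.
have pathE i : lil_path V n (i%:R / b%:R) = V (i * b ^ j)%N / lil_scale n.
  by rewrite /lil_path truncn_ratio// nb mulnAC [(b * i)%N]mulnC -mulnAC mulnK.
have path0 : lil_path V n 0 = 0 by rewrite /lil_path mulr0 truncn0 V0 mul0r.
have f0 : f 0 = 0 by case: fS.
have dist1 : `|1%:R / b%:R - 0| <= b%:R^-1 :> R by rewrite subr0 mul1r ger0_norm// invr_ge0.
have in00 : 0 <= (0 : R) <= 1 by rewrite lexx ler01.
have step i : (i < b)%N -> `|lil_path V n (i.+1%:R / b%:R) - f (i.+1%:R / b%:R)|
    <= e / 4 + i%:R * (3 * r.+1%:R^-1).
  elim: i => [|i IH] ib.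
    rewrite mul0r addr0.
    have := Hde (1%:R / b%:R) 0 (grid 1%N isT) in00 (le_trans dist1 bde).
    have := fb 0 (1%:R / b%:R) in00 (grid 1%N isT) dist1.
    rewrite path0 f0 !subr0 => h1 h2.
    by apply: (le_trans (ler_normB _ _)); lra.
  have im : (i < m.+1)%N by exact: ib.
  have := IH (ltnW ib).
  have hd : `|Df i| <= 1.
    rewrite -[leRHS]normr1 ler_norm_sqr expr1n.
    have i1 := grid i.+2 ib; have i2 := grid i.+1 (ltnW ib).
    apply: (le_trans (strassen_holder fS i2 i1)).
    by move: i1 i2; clear => /andP[? ?] /andP[? ?]; rewrite ler_norml; apply/andP; split; lra.
  have {Hz}[_ hz] := Hz i.
  have hz' : `|(zf i)%:~R / r.+1%:R - q i| <= r.+1%:R^-1.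
    rewrite -(@ler_pM2r _ r.+1%:R)// mulVf// -[X in _ * X <= _](ger0_norm (ler0n _ r.+1)) -normrM.
    by rewrite mulrBl divfK.
  have hv : `|lil_path V n (i.+2%:R / b%:R) - lil_path V n (i.+1%:R / b%:R) - (zf i)%:~R / r.+1%:R|
      <= r.+1%:R^-1.
    have := Hj i im; rewrite zE// -/b -/n !pathE => hj.
    rewrite -(@ler_pM2r _ (lil_scale n))// -[X in _ * X <= _](gtr0_norm s0) -normrM.
    by rewrite !mulrBl !divfK ?gt_eqF.
  move: hv hz' hd; rewrite /q /Df.
  move: (f _) (f _) (lil_path _ _ _) (lil_path _ _ _) ((zf i)%:~R / r.+1%:R) => a c u v w.
  rewrite -[i.+1%:R]natr1.
  move: r0; move: (_^-1) => y y0 h1 h2 h3.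
  have h3' : `|y * (c - a)| <= y by rewrite normrM gtr0_norm// ler_piMr// ltW.
  move: h3' h2 h1; rewrite mulrBl mul1r !ler_norml => /andP[? ?] /andP[? ?] /andP[? ?] /andP[? ?].
  by apply/andP; split; lra.
move=> t t01; pose i := Num.truncn (b%:R * t).
have ib : (i <= b)%N by exact: truncn_le_scale.
have ti : `|t - i%:R / b%:R| <= b%:R^-1.
  have [h1 h2] := truncn_itv b t01.
  have -> : t - i%:R / b%:R = (b%:R * t - i%:R) / b%:R by field; rewrite gt_eqF.
  rewrite normrM normfV (gtr0_norm b0) ler_piMl ?invr_ge0//.
  by rewrite ler_norml; apply/andP; split; rewrite /i; lra.
have gi := grid i ib.
have h1 := Hde _ _ t01 gi (le_trans ti bde).
have h2 := fb _ _ gi t01 ti.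
have h3 : `|lil_path V n (i%:R / b%:R) - f (i%:R / b%:R)| <= 3 * (e / 8).
  case: (i) ib => [|i'] ib; first by rewrite mul0r path0 f0 subrr normr0 mulr_ge0// ltW.
  apply: (le_trans (step i' ib)).
  have : i'%:R <= b%:R :> R by rewrite ler_nat ltnW.
  move: (r0) re; move: (_^-1) => y y0 re ib'.
  have := ler_wpM2r (ltW y0) ib'; lra.
move: h1 h2 h3; rewrite !ler_norml => /andP[? ?] /andP[? ?] /andP[? ?].
by apply/andP; split; lra.
Qed.

Lemma lil_path_subseq V (N : nat -> nat) C : 0 <= C -> lil_equicont V ->
  (\forall n \near \oo, `|V n| <= C * lil_scale n) ->
  (forall M, \forall j \near \oo, (M <= N j)%N) ->
  exists psi, subseq_index psi /\ exists f, unif_cvg01 (fun k => lil_path V (N (psi k))) f.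
Proof.
move=> C0 Veq VC Noo.
have shift Q := @near_oo_comp N Q Noo.
apply: (@equicont_subseq _ (fun j => lil_path V (N j)) (C + 1)).
  have [M _ HM] := lil_bound_uniform C0 ltr01 VC.
  apply: (shift (fun n => forall t : R, 0 <= t <= 1 -> `|lil_path V n t| <= C + 1)).
  exists (maxn M 4) => // n /=; rewrite geq_max => /andP[Mn n4] t t01.
  rewrite /lil_path normrM normfV (gtr0_norm (lil_scale_gt0 n4)).
  by rewrite ler_pdivrMr ?lil_scale_gt0// HM// truncn_le_scale.
move=> e e0; have [de de0 H] := lil_path_equicont Veq e0.
exists (Num.truncn de^-1).+1 => //.
set m := (Num.truncn de^-1).+1; have m0 : 0 < m%:R :> R by rewrite ltr0n.
apply: filterS (shift _ H) => j Hj t t01; have /andP[t0 t1] := t01.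
have [h1 h2] := truncn_itv m t01.
apply: Hj => //.
  rewrite divr_ge0//= ler_pdivrMr// mul1r (le_trans h1)// ler_piMr//.
have -> : t - (Num.truncn (m%:R * t))%:R / m%:R = (m%:R * t - (Num.truncn (m%:R * t))%:R) / m%:R.
  by field; rewrite gt_eqF.
apply: (@le_trans _ _ m%:R^-1); last exact: truncn_inv_le.
rewrite normrM normfV (gtr0_norm m0) ler_piMl ?invr_ge0//.
by rewrite ger0_norm ?subr_ge0// lerBlDl addrC ltW// addrC.
Qed.

End lil_path.

(** * From products to rescaled paths *)

Section log_path.
Context {R : realType}.

Lemma ln_le_subr1 (x : R) : 0 < x -> ln x <= x - 1.
Proof.
by move=> x0; have := @le_ln1Dx R (x - 1); rewrite [1 + _]addrC subrK; apply; lra.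
Qed.

Lemma norm_ln1D_le (r : R) : `|r| <= 2^-1 -> `|ln (1 + r) - r| <= 2 * r ^+ 2.
Proof.
rewrite ler_norml => /andP[r1 r2].
have r0 : 0 < 1 + r by lra.
have h1 : ln (1 + r) <= r by apply: le_ln1Dx; lra.
have h2 : r / (1 + r) <= ln (1 + r).
  have := @le_ln1Dx R (- (r / (1 + r))).
  have -> : 1 + - (r / (1 + r)) = (1 + r)^-1 by field; rewrite gt_eqF.
  rewrite lnV ?posrE// lerN2; apply.
  by rewrite ltrN2 ltr_pdivrMr//; lra.
have h3 : r - 2 * r ^+ 2 <= r / (1 + r).
  by rewrite ler_pdivlMr//; nra.
by rewrite ler_norml; apply/andP; split; nra.
Qed.

Lemma norm_expR_sub_le (a b B e : R) : `|b| <= B -> 0 <= e <= 2^-1 ->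
  `|a - b| <= e -> `|expR a - expR b| <= expR B * (2 * e).
Proof.
move=> bB /andP[e0 e1]; rewrite -{2}[a](subrK b).
move: (a - b) => x; rewrite ler_norml => /andP[x1 x2].
rewrite expRD -[X in _ - X]mul1r -mulrBl normrM (ger0_norm (expR_ge0 _)) mulrC.
rewrite ler_pM//; first by rewrite ler_expR (le_trans _ bB)// ler_norm.
have h1 := expR_ge1Dx x; have h2 := expR_ge1Dx (- x).
have h3 : expR x * expR (- x) = 1 by rewrite -expRD subrr expR0.
have h4 := expR_gt0 x.
by rewrite ler_norml; apply/andP; split; nra.
Qed.

Lemma lil_scale_le_linear (e : R) : 0 < e -> \forall n \near \oo, lil_scale n <= e * n%:R.
Proof.
move=> e0; pose c := e ^+ 2 / 4; have c0 : 0 < c by rewrite divr_gt0// exprn_gt0.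
near=> n.
have n4 : (4 <= n)%N by near: n; exists 4%N.
have n0 : 0 < n%:R :> R by rewrite ltr0n (leq_trans _ n4).
have nK : - ln c / c <= n%:R.
  near: n; exists (Num.truncn (- ln c / c)).+1 => // n /= hn.
  by rewrite (le_trans (ltW (truncnS_gt _)))// ler_nat.
rewrite -(@ler_pXn2r _ 2)// ?nnegrE ?lil_scale_ge0 ?mulr_ge0 ?(ltW e0)// lil_scale_sqr//.
have l1 : ln (ln n%:R) <= ln n%:R :> R.
  apply: le_trans (_ : ln n%:R - 1 <= _); last by lra.
  have ln0 : 0 < ln n%:R :> R by rewrite ln_gt0// ltr1n (leq_trans _ n4).
  exact: ln_le_subr1.
have l2 : ln n%:R <= 2 * c * n%:R.
  rewrite ler_pdivrMr// in nK.
  have := @ln_le_subr1 (c * n%:R) (mulr_gt0 c0 n0); rewrite lnM ?posrE//; lra.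
have l3 : ln (ln n%:R) <= e ^+ 2 / 2 * n%:R by rewrite (le_trans l1)// (le_trans l2)// /c; lra.
by rewrite exprMn; nra.
Unshelve. all: by end_near. Qed.

Variables (S V : nat -> R) (mu sigma C : R).
Hypotheses (S0 : forall k, (1 <= k)%N -> 0 < S k) (mu0 : 0 < mu) (sigma0 : 0 < sigma).
Hypotheses (C0 : 0 <= C) (VC : \forall n \near \oo, `|V n| <= C * lil_scale n).
Hypothesis SV : (fun n : nat => (S n - n%:R * mu - sigma * V n) / Num.sqrt (n%:R * ln (ln n%:R)))
  @ \oo --> (0 : R).

Let gam := mu / sigma.
Let gam0 : 0 < gam. Proof. by rewrite divr_gt0. Qed.

(** The weight [k] makes this comparable to [V k] itself; the sum of the [log_path k / k] is [gam]
    times the logarithm of the product. *)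
Definition log_path (k : nat) : R := gam * k%:R * ln (S k / (k%:R * mu)).

(** With [r = S n / (n mu) - 1], the quantity [gam n r] is exactly [V n] plus the approximation
    error over [sigma]. So [gam n |r| <= K lil_scale n], and the quadratic remainder of [ln (1 + r)]
    costs at most [2 |r|] times that, with [r] small. *)
Lemma log_path_near (e : R) : 0 < e -> \forall n \near \oo, `|log_path n - V n| <= e * lil_scale n.
Proof.
move=> e0.
pose h := Num.min 1 (e / 2).
have h0 : 0 < h by rewrite lt_min ltr01 divr_gt0.
have h1 : h <= 1 by rewrite ge_min lexx.
have he : h <= e / 2 by rewrite ge_min lexx orbT.
pose K := C + 1; have K0 : 0 < K by rewrite ltr_wpDl.
pose q := Num.min 2^-1 (e / (4 * K)).
have q0 : 0 < q by rewrite lt_min invr_gt0 ltr0n divr_gt0 ?mulr_gt0.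
have q1 : q <= 2^-1 by rewrite ge_min lexx.
have qe : 2 * (K * q) <= e / 2.
  have : q <= e / (4 * K) by rewrite ge_min lexx orbT.
  by rewrite ler_pdivlMr ?mulr_gt0//; lra.
have qK0 : 0 < q * gam / K by rewrite divr_gt0// (mulr_gt0 q0 gam0).
have hs : 0 < h * sigma by rewrite mulr_gt0.
have := SV => /cvgrPdist_le/(_ _ hs) SVn.
near=> n.
have n4 : (4 <= n)%N by near: n; exists 4%N.
have n0 : 0 < n%:R :> R by rewrite ltr0n (leq_trans _ n4).
have L0 := @lnln_gt0 R n n4.
have s0 := @lil_scale_gt0 R n n4.
have d1 : `|(S n - n%:R * mu - sigma * V n) / sigma| <= h * lil_scale n.
  have : `|0 - (S n - n%:R * mu - sigma * V n) / Num.sqrt (n%:R * ln (ln n%:R))| <= h * sigma.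
    by near: n; exact: SVn.
  have w0 : 0 < Num.sqrt (n%:R * ln (ln n%:R)) :> R by rewrite sqrtr_gt0 mulr_gt0.
  rewrite sub0r normrN !normrM !normfV (gtr0_norm w0) (gtr0_norm sigma0) !ler_pdivrMr//.
  move=> /le_trans; apply; rewrite mulrAC ler_wpM2r ?(ltW sigma0)// ler_wpM2l ?(ltW h0)//.
  rewrite ler_wsqrtr// -mulrA ler_peMl ?ler1n// mulr_ge0// ltW//.
have VCn : `|V n| <= C * lil_scale n by near: n; exact: VC.
have ln_small : lil_scale n <= q * gam / K * n%:R by near: n; exact: lil_scale_le_linear.
pose r := S n / (n%:R * mu) - 1.
have rE : gam * n%:R * r = V n + (S n - n%:R * mu - sigma * V n) / sigma.
  by rewrite /gam /r; field; rewrite !gt_eqF.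
have rK : gam * n%:R * `|r| <= K * lil_scale n.
  have gn : 0 <= gam * n%:R by rewrite mulr_ge0// ltW.
  rewrite -[X in X * _](ger0_norm gn) -normrM rE (le_trans (ler_normD _ _))//.
  rewrite [leRHS]mulrDl mul1r lerD// (le_trans d1)// ler_piMl// ltW//.
have rq : `|r| <= q.
  rewrite -(@ler_pM2l _ (gam * n%:R)) ?(mulr_gt0 gam0 n0)//; apply: (le_trans rK).
  move: ln_small; rewrite mulrAC ler_pdivlMr// mulrC => /le_trans; apply; lra.
have lr := norm_ln1D_le (le_trans rq q1).
have -> : log_path n = gam * n%:R * ln (1 + r) by rewrite /log_path /r addrC subrK.
have -> : gam * n%:R * ln (1 + r) - V n = gam * n%:R * (ln (1 + r) - r) +
   (S n - n%:R * mu - sigma * V n) / sigma by rewrite mulrBr rE; ring.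
apply: (le_trans (ler_normD _ _)).
have t1 : `|gam * n%:R * (ln (1 + r) - r)| <= e / 2 * lil_scale n.
  rewrite normrM (gtr0_norm (mulr_gt0 gam0 n0)).
  apply: (@le_trans _ _ (2 * (gam * n%:R * `|r|) * `|r|)).
    rewrite [leRHS](_ : _ = gam * n%:R * (2 * `|r| ^+ 2)); last by ring.
    by rewrite [`|r| ^+ 2]real_normK ?num_real// ler_wpM2l// mulr_ge0 ?(ltW gam0).
  apply: (@le_trans _ _ (2 * (K * lil_scale n) * q)).
    apply: ler_pM => //; first by rewrite mulr_ge0// mulr_ge0// mulr_ge0// (ltW gam0).
    by rewrite ler_wpM2l.
  rewrite [leLHS](_ : _ = 2 * (K * q) * lil_scale n); last by ring.
  by rewrite ler_wpM2r// ltW.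
have t2 : h * lil_scale n <= e / 2 * lil_scale n by rewrite ler_wpM2r// ltW.
by move: d1 t1 t2; lra.
Unshelve. all: by end_near. Qed.

Lemma prod_path_exp n (t : R) : (4 <= n)%N -> prod_path S mu gam n t =
  expR (\sum_(1 <= k < (Num.truncn (n%:R * t)).+1) log_path k / lil_scale n / k%:R).
Proof.
move=> n4; rewrite /prod_path -/(lil_scale n).
have s0 := @lil_scale_gt0 R n n4.
have pos k : (1 <= k)%N -> 0 < S k / (k%:R * mu) by move=> k1; rewrite divr_gt0 ?S0 ?mulr_gt0 ?ltr0n.
have [p0 pE] : 0 < \prod_(1 <= k < (Num.truncn (n%:R * t)).+1) (S k / (k%:R * mu)) /\
    gam * ln (\prod_(1 <= k < (Num.truncn (n%:R * t)).+1) (S k / (k%:R * mu))) =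
    \sum_(1 <= k < (Num.truncn (n%:R * t)).+1) log_path k / k%:R.
  elim: (Num.truncn _) => [|m [p0 IH]]; first by rewrite !big_geq// ln1 mulr0.
  rewrite !(big_nat_recr m.+1)//= mulr_gt0 ?pos//; split=> //.
  rewrite lnM ?posrE ?pos// mulrDr IH; congr (_ + _).
  have m1 : m.+1%:R != 0 :> R by rewrite pnatr_eq0.
  by rewrite /log_path; move: (ln _) => x; field.
rewrite /powR gt_eqF//; congr expR.
by rewrite mulrAC pE mulr_suml; apply: eq_bigr => k _; rewrite mulrAC.
Qed.

Lemma log_path_close (e : R) : 0 < e -> \forall n \near \oo, forall t : R, 0 <= t <= 1 ->
  `|lil_path log_path n t - lil_path V n t| <= e.
Proof.
move=> e0; have e20 : 0 < e / 2 by rewrite divr_gt0.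
have [M _ HM] := lil_bound_uniform (ltW e20) e20 (log_path_near e20).
exists (maxn M 4) => // n /=; rewrite geq_max => /andP[Mn n4] t t01.
have s0 := @lil_scale_gt0 R n n4.
rewrite /lil_path -mulrBl normrM normfV (gtr0_norm s0) ler_pdivrMr//.
by rewrite [e](splitr e) HM// truncn_le_scale.
Qed.

Lemma prod_path_cvg (N : nat -> nat) f : (forall M, \forall j \near \oo, (M <= N j)%N) ->
  strassen_class f -> unif_cvg01 (fun j => lil_path V (N j)) f ->
  unif_cvg01 (fun j => prod_path S mu gam (N j)) (exp_int_ratio f).
Proof.
move=> Noo fS Nf.
have logC : \forall n \near \oo, `|log_path n| <= (C + 1) * lil_scale n.
  apply: filterS2 VC (log_path_near ltr01) => n h1 h2.
  rewrite -[log_path n](subrK (V n)) (le_trans (ler_normD _ _))//.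
  by rewrite mulrDl addrC lerD.
have C10 : 0 <= C + 1 by rewrite addr_ge0.
have [M0 _ HM0] := lil_bound_sqrt C10 logC.
have [J _ HJ] := Noo (maxn M0 4).
(* The bounds hold for late indices only, whereas the convergence of the sums asks for them at every
   [j]. *)
pose N' j := N (j + J)%N.
have N'ge j : (maxn M0 4 <= N' j)%N by apply: HJ => /=; rewrite leq_addl.
have N'M j : (M0 <= N' j)%N by rewrite (leq_trans _ (N'ge j))// leq_maxl.
have N'4 j : (4 <= N' j)%N by rewrite (leq_trans _ (N'ge j))// leq_maxr.
have shift (Q : nat -> Prop) : (\forall j \near \oo, Q j) -> \forall j \near \oo, Q (j + J)%N.
  by move=> [K _ HK]; exists K => // j /= Kj; apply: HK => /=; rewrite (leq_trans Kj)// leq_addr.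
have N'oo K : \forall j \near \oo, (K <= N' j)%N by exact: (shift (fun j => (K <= N j)%N)).
have N'f : unif_cvg01 (fun j t => log_path (Num.truncn ((N' j)%:R * t)) / lil_scale (N' j)) f.
  move=> e e0; have e20 : 0 < e / 2 by rewrite divr_gt0.
  have [K _ HK] := log_path_close e20.
  apply: filterS2 (shift _ (Nf _ e20)) (N'oo K) => j h1 h2 t t01.
  rewrite [e](splitr e).
  have := lerD (HK _ h2 t t01) (h1 t t01); apply: le_trans.
  by rewrite (le_trans _ (ler_normD _ _))// addrA subrK.
have N'0 j : (0 < N' j)%N by exact: leq_trans (N'4 j).
have bnd j k : (0 < k)%N -> (k <= N' j)%N ->
    `|log_path k / lil_scale (N' j)| <= (C + 1 + 1) * Num.sqrt (k%:R / (N' j)%:R).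
  move=> k0 kN; have s0 := @lil_scale_gt0 R _ (N'4 j).
  by rewrite normrM normfV (gtr0_norm s0) ler_pdivrMr//; exact: (HM0 _ (N'M j) k k0 kN).
have main := @step_functional_cvg R (fun j k => log_path k / lil_scale (N' j)) N' f (C + 1 + 1)
  fS N'0 N'oo N'f bnd.
(* A bound for the limiting exponents uniform in [t], which makes the exponential Lipschitz near
   them. *)
pose B := Rintegral lebesgue_measure `[(0 : R), 1] (fun u => `|f u / u|).
have intB t : 0 <= t <= 1 -> `|Rintegral lebesgue_measure `[(0:R), t] (fun u => f u / u)| <= B.
  have iff := integrable_strassen_ratio fS.
  move=> /andP[t0 t1]; apply: le_trans (le_normr_Rintegral _ _) _ => //.
    exact: integrable_itv0.
  rewrite /B -subr_ge0 Rintegral_increment//; last exact: integrable_real_norm.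
  by apply: Rintegral_ge0 => u _.
move=> e e0.
pose h := Num.min 2^-1 (e / (2 * expR B)).
have h0 : 0 < h by rewrite lt_min invr_gt0 ltr0n divr_gt0 ?mulr_gt0 ?expR_gt0.
have h1 : h <= 2^-1 by rewrite ge_min lexx.
have he : expR B * (2 * h) <= e.
  have : h <= e / (2 * expR B) by rewrite ge_min lexx orbT.
  by rewrite ler_pdivlMr ?mulr_gt0 ?expR_gt0//; lra.
have [K _ HK] := main h h0.
exists (K + J)%N => // j /= Kj t t01.
have Jj : (J <= j)%N by rewrite (leq_trans _ Kj)// leq_addl.
have Kj' : (K <= j - J)%N by rewrite -(leq_add2r J) subnK.
have := HK _ Kj' t t01; rewrite /N' subnK// => hh.
have Nj4 : (4 <= N j)%N by have := N'4 (j - J)%N; rewrite /N' subnK.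
rewrite prod_path_exp// /exp_int_ratio (le_trans _ he)//.
apply: norm_expR_sub_le hh; first exact: intB.
by rewrite (ltW h0).
Qed.

End log_path.

(** * The maximum of the limit functional *)

Section extremal.
Context {R : realType}.
Notation mu := (@lebesgue_measure R).

(** Discrete counterpart of [- ln (i / M)]; the sums below mimic [int_0^1 - ln = 1] and
    [int_0^1 ln^2 = 2]. *)
Definition htail (M i : nat) : R := \sum_(i <= k < M) k.+1%:R^-1.

Lemma htailS M i : (i <= M)%N -> htail M.+1 i = htail M i + M.+1%:R^-1.
Proof. by move=> iM; rewrite /htail big_nat_recr. Qed.

Lemma htail_diag M : htail M M = 0. Proof. by rewrite /htail big_geq. Qed.

Lemma sum_partial_sums (d : nat -> R) M :
  \sum_(k < M) (\sum_(i < k.+1) d i) / k.+1%:R = \sum_(i < M) d i * htail M i.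
Proof.
elim: M => [|M IH]; first by rewrite !big_ord0.
rewrite big_ord_recr/= IH [in RHS]big_ord_recr/= htailS// htail_diag add0r.
rewrite [in LHS]big_ord_recr/= mulrDl addrA; congr (_ + _).
rewrite mulr_suml -big_split/=; apply: eq_bigr => i _.
by rewrite htailS 1?ltnW// mulrDr.
Qed.

Lemma sum_htail M : \sum_(i < M) htail M i = M%:R.
Proof.
have := @sum_partial_sums (fun _ => 1) M.
under [in RHS]eq_bigr do rewrite mul1r.
move=> <-; rewrite (eq_bigr (fun=> 1)) => [|k _]; first by rewrite sumr_const card_ord.
by rewrite sumr_const card_ord divff// pnatr_eq0.
Qed.

(** Going to [M.+1] adds [1 / M.+1] to each tail; by [sum_htail] the sum of squares grows by
    [(2 M + 1) / (M + 1) < 2]. *)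
Lemma sum_htail_sqr M : \sum_(i < M) htail M i ^+ 2 <= 2 * M%:R.
Proof.
elim: M => [|M IH]; first by rewrite big_ord0 mulr0.
have M0 : 0 < M.+1%:R :> R by rewrite ltr0n.
rewrite (eq_bigr (fun i : 'I_M.+1 =>
    htail M i ^+ 2 + (2 * M.+1%:R^-1) * htail M i + M.+1%:R^-1 ^+ 2)); last first.
  by move=> i _; rewrite htailS -1?ltnS//; ring.
rewrite !big_split/= sumr_const card_ord -mulr_sumr !big_ord_recr/= htail_diag.
rewrite expr0n/= !addr0 sum_htail -[M.+1%:R^-1 ^+ 2 *+ _]mulr_natl.
have -> : M.+1%:R * M.+1%:R^-1 ^+ 2 = M.+1%:R^-1 :> R by field; rewrite gt_eqF.
have h : M.+1%:R^-1 * (M%:R + 1) = 1 :> R by rewrite natr1 mulVf// gt_eqF.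
have i0 : 0 <= M.+1%:R^-1 :> R by rewrite invr_ge0.
move: IH h i0; rewrite -natr1; move: (\sum_(_ < _) _) (_^-1) => x y; nra.
Qed.

Let sqrt2 : R := Num.sqrt 2.
Let sqrt2_gt0 : 0 < sqrt2. Proof. by rewrite sqrtr_gt0. Qed.
Let sqrt2_sqr : sqrt2 ^+ 2 = 2. Proof. by rewrite sqr_sqrtr. Qed.

(* Discrete form of [int_0^1 f/u = - int_0^1 f' ln u <= sqrt 2]: summation by
   parts, then [2 d h <= n sqrt 2 d^2 + h^2 / (n sqrt 2)] termwise. *)
Lemma strassen_sum_le f n : strassen_class f -> (0 < n)%N ->
  \sum_(1 <= k < n.+1) f (k%:R / n%:R) / k%:R <= sqrt2.
Proof.
move=> fS n0; have n0R : 0 < n%:R :> R by rewrite ltr0n.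
pose d i : R := f (i.+1%:R / n%:R) - f (i%:R / n%:R).
have f0 : f 0 = 0 by case: fS.
have dE k : f (k%:R / n%:R) = \sum_(i < k) d i.
  rewrite -(big_mkord xpredT d) telescope_sumr//.
  by rewrite mul0r f0 subr0.
rewrite big_add1/= big_mkord.
under eq_bigr do rewrite dE.
rewrite sum_partial_sums.
apply: (@le_trans _ _ (\sum_(i < n)
    (2^-1 * (n%:R * sqrt2) * d i ^+ 2 + (2 * (n%:R * sqrt2))^-1 * htail n i ^+ 2))).
  apply: ler_sum => i _.
  have c0 : 0 < n%:R * sqrt2 by rewrite mulr_gt0.
  move: (n%:R * sqrt2) c0 (d i) (htail n i) => c c0 x y.
  have h : 0 <= (2 * c)^-1 * (c * x - y) ^+ 2 by rewrite mulr_ge0 ?sqr_ge0// invr_ge0 ltW// mulr_gt0.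
  rewrite -subr_ge0 (le_trans h)// le_eqVlt; apply/orP; left; apply/eqP.
  by field; rewrite gt_eqF.
rewrite big_split/= -!mulr_sumr.
have h1 := strassen_grid fS n0; have h2 := sum_htail_sqr n.
rewrite -/sqrt2.
have e1 : 2^-1 * (n%:R * sqrt2) * \sum_(i < n) d i ^+ 2 <= 2^-1 * sqrt2.
  rewrite -mulrA ler_wpM2l// [n%:R * _]mulrC -mulrA ler_piMr// ltW//.
have e2 : (2 * (n%:R * sqrt2))^-1 * \sum_(i < n) htail n i ^+ 2 <= 2^-1 * sqrt2.
  rewrite ler_pdivrMl ?mulr_gt0//; apply: (le_trans h2).
  rewrite (_ : 2 * (n%:R * sqrt2) * (2^-1 * sqrt2) = n%:R * sqrt2 ^+ 2); last by field.
  by rewrite sqrt2_sqr mulrC.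
lra.
Qed.

(** The convergence of weighted sums is reused with [v j k] the values of [f] itself on the grid,
    [f(t)^2 <= t] supplying the constant 1. At [t = 1] the sums are those of [strassen_sum_le]. *)
Lemma strassen_ratio_integral_le f : strassen_class f ->
  Rintegral mu `[0, 1] (fun u => f u / u) <= sqrt2.
Proof.
move=> fS; apply/ler_addgt0Pr => e e0.
have Noo M : \forall j \near \oo, (M <= j.+1)%N.
  by exists M => // j /= Mj; exact: leq_trans (leqnSn _).
have fc : unif_cvg01 (fun j t => f ((Num.truncn (j.+1%:R * t))%:R / j.+1%:R)) f.
  move=> h h0; have h20 : 0 < h ^+ 2 by rewrite exprn_gt0.
  exists (Num.truncn (h ^+ 2)^-1) => // j /= jh t t01.
  have j0 : 0 < j.+1%:R :> R by rewrite ltr0n.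
  have [h1 h2] := truncn_itv j.+1 t01; have /andP[t0 t1] := t01.
  rewrite -[leRHS]ger0_norm ?(ltW h0)// ler_norm_sqr.
  apply: le_trans (truncn_inv_le h20 jh).
  apply: le_trans (strassen_holder fS t01 _) _.
    by rewrite divr_ge0//= ler_pdivrMr// mul1r (le_trans h1)// ler_piMr.
  rewrite (_ : _ - t = ((Num.truncn (j.+1%:R * t))%:R - j.+1%:R * t) / j.+1%:R); last first.
    by field; rewrite gt_eqF.
  rewrite normrM normfV (gtr0_norm j0) ler_piMl ?invr_ge0//.
  by rewrite ler_norml; apply/andP; split; lra.
have fb j k : (0 < k)%N -> (k <= j.+1)%N -> `|f (k%:R / j.+1%:R)| <= 1 * Num.sqrt (k%:R / j.+1%:R).
  move=> k0 kj; have q0 : 0 <= k%:R / j.+1%:R :> R by rewrite divr_ge0.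
  rewrite mul1r -[leRHS]ger0_norm ?sqrtr_ge0// ler_norm_sqr (sqr_sqrtr q0).
  by apply: strassen_sqr_le; rewrite // q0/= ler_pdivrMr ?ltr0n// mul1r ler_nat.
have [K _ HK] := @step_functional_cvg R (fun j k => f (k%:R / j.+1%:R)) (fun j => j.+1) f 1
  fS (fun j => ltn0Sn j) Noo fc fb e e0.
have := HK K (leqnn K) 1; rewrite ler01 lexx => /(_ isT).
rewrite mulr1 natrK => h.
have := strassen_sum_le fS (ltn0Sn K).
move: h; rewrite ler_norml => /andP[? ?]; lra.
Qed.

Lemma Rintegral_FTC_tail (g F phi : R -> R) (de t : R) : 0 < de -> de <= t -> t <= 1 ->
  mu.-integrable `[0, 1] (EFin \o g) ->
  (forall x, de <= x <= t -> g x = phi x) ->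
  (forall x : R, 0 < x -> is_derive x 1 F (phi x)) ->
  (forall x : R, 0 < x -> {for x, continuous phi}) ->
  Rintegral mu `[0, t] g - Rintegral mu `[0, de] g = F t - F de.
Proof.
move=> de0 det t1 gi gphi dF cphi.
rewrite Rintegral_increment ?(ltW de0)//; last exact: integrable_itv0.
rewrite Rintegral_itv_obnd_cbnd; last by apply: integrable_itvoc => //; exact: ltW.
have -> : Rintegral mu `[de, t] g = Rintegral mu `[de, t] phi.
  by apply: eq_Rintegral => x; rewrite inE/= in_itv/=; exact: gphi.
by rewrite /Rintegral (FTC2_pos de0 det dF cphi).
Qed.

Lemma is_derive_xlnx (x : R) : 0 < x -> is_derive x 1 (fun u : R => u - u * ln u) (- ln x).
Proof.
move=> x0; have dl := is_derive1_ln x0.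
apply: (is_derive_eq (is_deriveB (is_derive_id x 1) (is_deriveM (is_derive_id x 1) dl))).
by rewrite /GRing.scale/=; field; rewrite gt_eqF.
Qed.

Lemma is_derive_xln2x (x : R) : 0 < x ->
  is_derive x 1 (fun u : R => u * (ln u * ln u) + 2 * (u - u * ln u)) (ln x ^+ 2).
Proof.
move=> x0; have dl := is_derive1_ln x0.
apply: (is_derive_eq (is_deriveD (is_deriveM (is_derive_id x 1) (is_deriveM dl dl))
  (is_deriveZ 2 (is_derive_xlnx x0)))).
by rewrite -[(ln (R:=R) * ln (R:=R)) x]/(ln x * ln x) /GRing.scale/=; field; rewrite gt_eqF.
Qed.

Lemma is_derive_ratio (c x : R) : 0 < x ->
  is_derive x 1 (fun u : R => u + (u - u * ln u) - c * ln u) (1 - ln x - c / x).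
Proof.
move=> x0; have dl := is_derive1_ln x0.
apply: (is_derive_eq (is_deriveB (is_deriveD (is_derive_id x 1) (is_derive_xlnx x0))
  (is_deriveZ c dl))).
by rewrite /GRing.scale/=; field; rewrite gt_eqF.
Qed.

(* The maximiser of [f |-> int_0^1 f/u] has derivative [-ln v / sqrt 2]; it is
   truncated at [expR (- s)] to keep the derivative bounded. *)
Let slope (s v : R) : R := sqrt2^-1 * - ln (Num.max v (expR (- s))).
Let pathf (s t : R) : R := Rintegral mu `[0, t] (slope s).

Let c0 : 0 < sqrt2^-1. Proof. by rewrite invr_gt0. Qed.

Lemma ln_maxr_itv (s v : R) : 0 < s -> v <= 1 -> 0 <= - ln (Num.max v (expR (- s))) <= s.
Proof.
move=> s0 v1.
have m0 : 0 < Num.max v (expR (- s)) by rewrite lt_max expR_gt0 orbT.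
apply/andP; split.
  by rewrite oppr_ge0 ln_le0// ge_max v1/= -expR0 ler_expR oppr_le0 ltW.
rewrite lerNl -[leLHS]expRK ler_ln ?posrE ?expR_gt0//.
by rewrite le_max lexx orbT.
Qed.

Lemma measurable_slope s : measurable_fun setT (slope s).
Proof.
apply: measurable_funM => //; apply: measurableT_comp => //.
apply: (@measurableT_comp _ _ _ _ _ _ (@ln R)) => //.
exact: measurable_maxr.
Qed.

Lemma slope_itv s v : 0 < s -> v <= 1 -> 0 <= slope s v <= sqrt2^-1 * s.
Proof.
move=> s0 v1; have /andP[h1 h2] := ln_maxr_itv s0 v1.
by rewrite /slope mulr_ge0 ?(ltW c0)//= ler_wpM2l ?(ltW c0).
Qed.

Lemma integrable_slope_exp s k : 0 < s ->
  mu.-integrable `[0, 1] (EFin \o (fun v => slope s v ^+ k)).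
Proof.
move=> s0; apply: (@integrable_real_bounded _ _ _ _ _ _ _ ((sqrt2^-1 * s) ^+ k)) => //.
- by have /= -> := @lebesgue_itvcc R 0 1 ler01; rewrite ltry.
- by apply: measurable_funTS; apply: measurable_funX; exact: measurable_slope.
move=> v; rewrite /= in_itv/= => /andP[v0 v1].
have /andP[h1 h2] := slope_itv s0 v1.
by rewrite ger0_norm ?exprn_ge0//; apply: lerXn2r; rewrite ?nnegrE// (le_trans h1).
Qed.

Lemma integrable_slope s : 0 < s -> mu.-integrable `[0, 1] (EFin \o slope s).
Proof. by move=> /(integrable_slope_exp 1). Qed.

Section fixed_truncation.
Variables (s : R).
Hypothesis s0 : 0 < s.
Let de := expR (- s).
Let de0 : 0 < de. Proof. exact: expR_gt0. Qed.
Let de1 : de <= 1. Proof. by rewrite -expR0 ler_expR oppr_le0 ltW. Qed.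
Let lnde : ln de = - s. Proof. exact: expRK. Qed.

Lemma slope_low v : v <= de -> slope s v = sqrt2^-1 * s.
Proof. by move=> vd; rewrite /slope max_r// lnde opprK. Qed.

Lemma slope_high v : de <= v -> slope s v = sqrt2^-1 * - ln v.
Proof. by move=> vd; rewrite /slope max_l. Qed.

Lemma Rintegral_low (g : R -> R) c : (forall v, 0 <= v <= de -> g v = c) ->
  Rintegral mu `[0, de] g = c * de.
Proof.
move=> gc; have -> : Rintegral mu `[0, de] g = Rintegral mu `[0, de] (cst c).
  by apply: eq_Rintegral => v; rewrite inE/= in_itv/=; exact: gc.
by rewrite Rintegral_cst//= lebesgue_itvcc ?(ltW de0)//= subr0.
Qed.

Lemma pathf_high t : de <= t -> t <= 1 -> pathf s t = sqrt2^-1 * (t - t * ln t - de).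
Proof.
move=> dt t1.
have low : Rintegral mu `[0, de] (slope s) = sqrt2^-1 * s * de.
  by apply: Rintegral_low => v /andP[_]; exact: slope_low.
have H1 x : de <= x <= t -> slope s x = sqrt2^-1 * - ln x.
  by move=> /andP[dx _]; exact: slope_high.
have H2 (x : R) : 0 < x ->
    is_derive x 1 (fun u => sqrt2^-1 * (u - u * ln u)) (sqrt2^-1 * - ln x).
  by move=> x0; exact: is_deriveZ (is_derive_xlnx x0).
have H3 (x : R) : 0 < x -> {for x, continuous (fun u => sqrt2^-1 * - ln u)}.
  move=> x0; apply: cvgM; first exact: cvg_cst.
  by apply: cvgN; exact: continuous_ln.
have := Rintegral_FTC_tail de0 dt t1 (integrable_slope s0) H1 H2 H3.
rewrite low lnde /pathf; move: (Rintegral _ _ _) => I; lra.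
Qed.

(** The energy is [1 - de (1 + s)]: the terms in [s^2] from the constant part and from the boundary
    value at [de] cancel. *)
Lemma pathf_strassen : strassen_class (pathf s).
Proof.
split; first by rewrite /pathf set_itv1 Rintegral_set1.
exists (slope s); split; first exact: measurable_funTS (@measurable_slope s).
split; first exact: integrable_slope.
split; last by [].
have i2 := integrable_slope_exp 2 s0.
rewrite -EFin_Rintegral// lee_fin.
have ci : sqrt2^-1 ^+ 2 = 2^-1 by rewrite exprVn sqrt2_sqr.
have low : Rintegral mu `[0, de] (fun v => slope s v ^+ 2) = 2^-1 * s ^+ 2 * de.
  apply: Rintegral_low => v /andP[_ vd].
  by rewrite slope_low// exprMn ci.
have H1 x : de <= x <= 1 -> slope s x ^+ 2 = 2^-1 * ln x ^+ 2.
  by move=> /andP[dx _]; rewrite slope_high// exprMn ci sqrrN.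
have H2 (x : R) : 0 < x ->
    is_derive x 1 (fun u => 2^-1 * (u * (ln u * ln u) + 2 * (u - u * ln u))) (2^-1 * ln x ^+ 2).
  by move=> x0; exact: is_deriveZ (is_derive_xln2x x0).
have H3 (x : R) : 0 < x -> {for x, continuous (fun u => 2^-1 * ln u ^+ 2)}.
  move=> x0; apply: cvgM; first exact: cvg_cst.
  by apply: cvgM; exact: continuous_ln.
have := Rintegral_FTC_tail de0 de1 (lexx _) i2 H1 H2 H3.
rewrite low lnde ln1; move: (Rintegral _ _ _) => I.
have : 0 <= de * s by rewrite mulr_ge0 ?(ltW de0)// ltW.
by move: (de0); move: de => x; lra.
Qed.

(** The integral over [[de, 1]] is exactly the left side; the part over [[0, de]] is nonnegative and
    dropped. *)
Lemma pathf_ratio_ge :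
  sqrt2 * (1 - de * (1 + s)) <= Rintegral mu `[0, 1] (fun u => pathf s u / u).
Proof.
have fS := pathf_strassen; have iff := integrable_strassen_ratio fS.
have H1 x : de <= x <= 1 -> pathf s x / x = sqrt2^-1 * (1 - ln x - de / x).
  move=> /andP[dx x1]; rewrite pathf_high//.
  by field; rewrite !gt_eqF// (lt_le_trans de0).
have H2 (x : R) : 0 < x -> is_derive x 1
    (fun u => sqrt2^-1 * (u + (u - u * ln u) - de * ln u)) (sqrt2^-1 * (1 - ln x - de / x)).
  by move=> x0; exact: is_deriveZ (is_derive_ratio de x0).
have H3 (x : R) : 0 < x -> {for x, continuous (fun u => sqrt2^-1 * (1 - ln u - de / u))}.
  move=> x0; apply: cvgM; first exact: cvg_cst.
  apply: cvgB; first by apply: cvgB; [exact: cvg_cst|exact: continuous_ln].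
  by apply: cvgM; [exact: cvg_cst|apply: cvgV; [rewrite gt_eqF|]].
have p0 : 0 <= Rintegral mu `[0, de] (fun u => pathf s u / u).
  apply: Rintegral_ge0 => // u; rewrite /= in_itv/= => /andP[u0 ud].
  rewrite divr_ge0//; apply: Rintegral_ge0 => // v; rewrite /= in_itv/= => /andP[v0 vu].
  by have /andP[] := slope_itv s0 (le_trans vu (le_trans ud de1)).
have := Rintegral_FTC_tail de0 de1 (lexx _) iff H1 H2 H3.
have si : sqrt2 = 2 * sqrt2^-1 by rewrite -sqrt2_sqr; field; rewrite gt_eqF.
rewrite lnde ln1 [in X in _ -> X]si; move: p0; move: (Rintegral _ _ _) (Rintegral _ _ _) => I J; lra.
Qed.

End fixed_truncation.

Lemma strassen_ratio_integral_sup (e : R) : 0 < e -> exists2 f, strassen_class f &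
  sqrt2 - e <= Rintegral mu `[0, 1] (fun u => f u / u).
Proof.
(* [expR (s / 2) >= 1 + s / 2] gives [expR (- s) (1 + s) <= 4 / s = e / 2], and [sqrt 2 <= 2] makes
   the loss at most [e]. *)
move=> e0; pose s : R := 8 / e; have s0 : 0 < s by rewrite divr_gt0.
exists (pathf s); first exact: pathf_strassen.
apply: le_trans (pathf_ratio_ge s0).
have h1 : 1 + s / 2 <= expR (s / 2) by exact: expR_ge1Dx.
have h2 : expR (- s) * (1 + s) <= 4 / s.
  have -> : - s = - (s / 2) + - (s / 2) by lra.
  rewrite expRD expRN.
  have x0 := expR_gt0 (s / 2); move: (expR _) h1 x0 => x h1 x0.
  rewrite ler_pdivlMr// -invfM -mulrA mulrC ler_pdivrMr ?mulr_gt0//.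
  nra.
have h3 : sqrt2 <= 2.
  by rewrite -(@ler_pXn2r _ 2)// ?nnegrE ?(ltW sqrt2_gt0)// sqrt2_sqr; lra.
have h4 : 4 / s = e / 2 by rewrite /s; field; rewrite gt_eqF.
have h5 : 0 < expR (- s) * (1 + s) by rewrite mulr_gt0 ?expR_gt0// addr_gt0.
rewrite h4 in h2; move: h2 h5; move: (_ * _) => x; nra.
Qed.

End extremal.

(** * The conclusions for one fixed path *)

Section strong_approximation.
Context {R : realType}.
Variables (S V : nat -> R) (mu sigma C : R).
Hypotheses (S0 : forall k, (1 <= k)%N -> 0 < S k) (mu0 : 0 < mu) (sigma0 : 0 < sigma).
Hypotheses (V0 : V 0%N = 0) (Vosc : dyadic_osc V) (Ven : energy_bound V) (Vtar : approx_targets V).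
Hypothesis SV : (fun n : nat => (S n - n%:R * mu - sigma * V n) / Num.sqrt (n%:R * ln (ln n%:R)))
  @ \oo --> (0 : R).

Let X n := prod_path S mu (mu / sigma) (n + 3)%N.
Let Veq : lil_equicont V. Proof. exact: lil_equicont_of_dyadic. Qed.
Let VC : \forall n \near \oo, `|V n| <= 24 * lil_scale n. Proof. exact: lil_bound_of_dyadic. Qed.

Let subseq_oo phi : subseq_index phi -> forall M, \forall j \near \oo, (M <= phi j + 3)%N.
Proof.
move=> phiS M; exists M => // j /= Mj.
by rewrite (leq_trans Mj)// (leq_trans (subseq_index_ge phiS j))// leq_addr.
Qed.

(** Compactness, the inclusion of the limit points and the upper bound of the limsup all rest on
    this. The subsequence is extracted for the paths of [V], and its limit is carried over to the
    products. *)
Lemma prod_path_subseq phi : subseq_index phi -> exists psi, subseq_index psi /\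
  exists2 f, strassen_class f & unif_cvg01 (fun n => X (phi (psi n))) (exp_int_ratio f).
Proof.
move=> phiS.
have [psi [psiS [f cf]]] := lil_path_subseq (ler0n _ 24) Veq VC (subseq_oo phiS).
have ppS : subseq_index (phi \o psi).
  have phimono i j : (i < j)%N -> (phi i < phi j)%N.
    elim: j => // j IH; rewrite ltnS leq_eqVlt => /predU1P[->|/IH h]; first exact: phiS.
    exact: ltn_trans h (phiS j).
  by move=> n; apply: phimono.
have fS := strassen_of_limit V0 Ven Veq (subseq_oo ppS) cf.
exists psi; split => //; exists f => //.
exact: (prod_path_cvg S0 mu0 sigma0 (ler0n _ 24) VC SV (subseq_oo ppS) fS cf).
Qed.

Lemma prod_path_attained f : strassen_class f ->
  limit_point01 X (exp_int_ratio f).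
Proof.
move=> fS.
have [psi [psiS cf]] : exists psi, subseq_index psi /\
    unif_cvg01 (fun k => (fun n => lil_path V (n + 3)) (psi k)) f.
  apply: (@subseq_of_frequently _ (fun n => lil_path V (n + 3)) f) => e e0 N.
  have [n Nn Hn] := strassen_approx V0 Veq Vtar fS e0 (N + 3)%N.
  have n3 : (3 <= n)%N by rewrite (leq_trans _ Nn)// leq_addl.
  by exists (n - 3)%N; [rewrite leq_subRL// addnC|rewrite subnK].
exists psi; split => //.
exact: (prod_path_cvg S0 mu0 sigma0 (ler0n _ 24) VC SV (subseq_oo psiS) fS cf).
Qed.

Lemma unif_cvg01_unique (g : nat -> R -> R) h1 h2 : unif_cvg01 g h1 -> unif_cvg01 g h2 ->
  forall t, 0 <= t <= 1 -> h1 t = h2 t.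
Proof.
move=> g1 g2 t t01; apply/eqP; rewrite -subr_eq0 -normr_le0; apply/ler_addgt0Pr => e e0.
have e20 : 0 < e / 2 by rewrite divr_gt0.
have [M1 _ H1] := g1 _ e20; have [M2 _ H2] := g2 _ e20.
have := H1 (maxn M1 M2) (leq_maxl _ _) t t01; have := H2 (maxn M1 M2) (leq_maxr _ _) t t01.
by rewrite /= !ler_norml => /andP[? ?] /andP[? ?]; apply/andP; split; lra.
Qed.

Lemma prod_path_rel_compact : rel_compact01 X.
Proof.
move=> phi /prod_path_subseq[psi [psiS [f fS cf]]].
by exists psi; split => //; exists (exp_int_ratio f).
Qed.

Lemma prod_path_limit_points h : limit_point01 X h <->
  exists f, strassen_class f /\ forall x, 0 <= x <= 1 -> h x = exp_int_ratio f x.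
Proof.
split=> [[phi [phiS ch]]|[f [fS hf]]].
  have [psi [psiS [f fS cf]]] := prod_path_subseq phiS.
  exists f; split => //; apply: unif_cvg01_unique cf => e e0.
  have [M _ HM] := ch e e0; exists M => // n /= Mn; apply: HM => /=.
  exact: leq_trans (subseq_index_ge psiS n).
have [phi [phiS cf]] := prod_path_attained fS.
exists phi; split => // e e0; apply: filterS (cf e e0) => n Hn t t01.
by rewrite hf//; exact: Hn.
Qed.

(** Values above [expR (sqrt 2) + e] infinitely often would give, along a subsequence, a limit above
    the maximum of the functional. For the lower bound a nearly extremal [f] is approached along a
    subsequence. *)
Lemma prod_path_limsup : limn_esup (fun n => (X n 1)%:E) = (expR (Num.sqrt 2))%:E.
Proof.
have in11 : 0 <= (1 : R) <= 1 by rewrite ler01 lexx.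
have up (e : R) : 0 < e -> \forall n \near \oo, X n 1 <= expR (Num.sqrt 2) + e.
  move=> e0; apply: contrapT => notup.
  have [|phi [phiS Hphi]] := @subseq_choice (fun _ n => expR (Num.sqrt 2) + e < X n 1).
    move=> _ N; apply: contrapT => H; apply: notup; exists N => // n /= Nn.
    by rewrite leNgt; apply/negP => h; apply: H; exists n.
  have [psi [psiS [f fS cf]]] := prod_path_subseq phiS.
  have [M _ HM] := cf (e / 2) ltac:(lra).
  have := HM M (leqnn M) 1 in11; have := Hphi (psi M).
  have : exp_int_ratio f 1 <= expR (Num.sqrt 2).
    by rewrite ler_expR; exact: strassen_ratio_integral_le.
  by rewrite ler_norml => h1 h2 /andP[h3 h4]; lra.
have low (e : R) : 0 < e -> forall N, exists2 n, (N <= n)%N & expR (Num.sqrt 2) - e <= X n 1.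
  move=> e0 N.
  pose e1 := expR (Num.sqrt 2 : R); have e10 : 0 < e1 by exact: expR_gt0.
  (* This tolerance in the exponent costs at most [e / 2], by [e1 expR (- x) >= e1 - e1 x]. *)
  have h0 : 0 < e / 2 / e1 by rewrite !divr_gt0.
  have [f fS fge] := strassen_ratio_integral_sup h0.
  have [phi [phiS cf]] := prod_path_attained fS.
  have [M _ HM] := cf (e / 2) ltac:(lra).
  pose j := maxn M N.
  exists (phi j); first by rewrite (leq_trans _ (subseq_index_ge phiS j))// leq_maxr.
  have := HM j (leq_maxl _ _) 1 in11.
  have : e1 - e / 2 <= exp_int_ratio f 1.
    apply: (@le_trans _ _ (expR (Num.sqrt 2 - e / 2 / e1))); last by rewrite ler_expR.
    rewrite expRD -/e1 (@le_trans _ _ (e1 * (1 - e / 2 / e1)))//.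
      rewrite le_eqVlt; apply/orP; left; apply/eqP; field; rewrite gt_eqF//.
    by rewrite ler_wpM2l ?(ltW e10)//; exact: expR_ge1Dx.
  by rewrite ler_norml -/e1 => h1 /andP[h3 h4]; lra.
apply/eqP; rewrite eq_le; apply/andP; split.
  apply/lee_addgt0Pr => e e0; have [N _ HN] := up e e0.
  apply: (@le_trans _ _ (ereal_sup ((fun n => (X n 1)%:E) @` [set n | (N <= n)%N]))).
    apply: ereal_inf_lbound; exists [set n | (N <= n)%N] => //; exists N => //.
  by apply: ge_ereal_sup => _ [n Nn <-]; rewrite -EFinD lee_fin; exact: HN.
apply: le_ereal_inf_tmp => _ [A [N _ NA] <-].
apply/lee_subgt0Pr => e e0; have [n Nn Hn] := low e e0 N.
apply: (@le_trans _ _ (X n 1)%:E); first by rewrite -EFinB lee_fin.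
by apply: ereal_sup_ubound; exists n => //; exact: NA.
Qed.

End strong_approximation.

Theorem theorem1p2 (R : realType) (d : measure_display) (T : measurableType d)
  (P : probability T R) (S : nat -> T -> R) (W : R -> T -> R) (mu sigma : R) :
  (forall k, measurable_fun setT (S k)) ->
  (forall k w, (1 <= k)%N -> 0 < S k w) ->
  std_wiener P W -> 0 < mu -> 0 < sigma ->
  {ae P, forall w,
     (fun n : nat => (S n w - n%:R * mu - sigma * W n%:R w)
                       / Num.sqrt (n%:R * ln (ln n%:R))) @ \oo --> (0 : R)} ->
  {ae P, forall w,
     let X := fun n => prod_path (fun k => S k w) mu (mu / sigma) (n + 3)%N in
     rel_compact01 X /\
     (forall h : R -> R, limit_point01 X h <->
        exists f, strassen_class f /\ forall x, 0 <= x <= 1 -> h x = exp_int_ratio f x) /\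
     limn_esup (fun n => (X n 1)%:E) = (expR (Num.sqrt 2))%:E}.
Proof.
move=> _ S0 PW mu0 sigma0 SW.
have [_ [W0 _]] := PW.
(* Five almost sure events, none depending on the subsequences or functions quantified later; what
   follows is deterministic. *)
apply: filterS2 (filterI W0 SW) (filterI (ae_dyadic_osc PW)
  (filterI (ae_energy_bound PW) (ae_approx_targets PW))) => w [W0w SWw] [osc [en tar]].
have S0w k : (1 <= k)%N -> 0 < S k w by exact: S0.
split; first exact: (prod_path_rel_compact S0w mu0 sigma0 W0w osc en SWw).
split; first by move=> h; exact: (prod_path_limit_points S0w mu0 sigma0 W0w osc en tar SWw).
exact: (prod_path_limsup S0w mu0 sigma0 W0w osc en tar SWw).
Qed.
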